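(* Consider the stochastic problem of the context under Assumptions 1-4 there. Let $\{(x^k,\lambda^k)\}$ be generated by the stochastic algorithm of the context with $$\hat P\succeq L_fI+\rho A^\top A,\qquad Ax^0=b,\qquad\lambda^0=0 .$$ Let $\theta=\frac nN$, and for an integer $t\ge 1$ let $$\hat x^t=\frac{\alpha_{t+1}x^{t+1}+\theta\sum_{k=1}^t\alpha_kx^k}{\alpha_{t+1}+\theta\sum_{k=1}^t\alpha_k}.$$ Let $(x^*,\lambda^* )$ be a primal-dual solution, $D_x:=\alpha_0(\hat P-\rho A^\top A)+I$, and $$C_0=(1-\theta)\alpha_0[F(x^0)-F(x^* )]+\frac12\|x^0-x^*\|_{D_x}^2+\frac{\alpha_0}{2\rho}\max\{(1+\|\lambda^*\|)^2,4\|\lambda^*\|^2\}.$$ 1. If $\alpha_k=\frac{\alpha_0}{\sqrt k}$ for all $k\ge1$, for a certain $\alpha_0>0$, then for $t\ge2$, $$\max\Big\{\big|\mathbb E[F(\hat x^t)-F(x^* )]\big|,\ \mathbb E\|A\hat x^t-b\|\Big\}\le\frac{C_0}{\theta\alpha_0\sqrt t}+\frac{\alpha_0(\log t+2)\sigma^2}{2\theta\sqrt t}.$$ 2. If the maximum number of iterations $t$ is fixed a priori, then by choosing $\alpha_k=\frac{\alpha_0}{\sqrt t}$ for all $k\ge1$, with any given $\alpha_0>0$, $$\max\Big\{\big|\mathbb E[F(\hat x^t)-F(x^* )]\big|,\ \mathbb E\|A\hat x^t-b\|\Big\}\le\frac{C_0}{\theta\alpha_0\sqrt t}+\frac{\alpha_0\sigma^2}{\theta\sqrt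 t}.$$
   Context: Problem. $x=(x_1;\dots;x_N)$ is a real vector partitioned into $N$ blocks, $A=(A_1,\dots,A_N)$ is a conformally partitioned matrix, $b$ a vector, $\mathcal X=\mathcal X_1\times\cdots\times\mathcal X_N$, $f(x)=\mathbb E_\xi f_\xi(x)$ with $\xi$ a random vector, $u(x)=\sum_iu_i(x_i)$, $F=f+u$. The problem is $\min_xF(x)$ s.t. $Ax=b$, $x\in\mathcal X$. Notation. $\|z\|_W^2:=z^\top Wz$; $\|\cdot\|$ Euclidean norm; $W\succeq V$ means $W-V$ is positive semidefinite. For $I\subset\{1,\dots,N\}$: $x_I,\mathcal X_I,A_I,\nabla_If,G^k_I$ denote the sub-vector, product of sets, column-block sub-matrix, partial gradient, and sub-vector of $G^k$ indexed by $I$; $u_I(x_I)=\sum_{i\in I}u_i(x_i)$. Assumption 1: the $\mathcal X_i$ are closed convex, $f$ is a smooth convex function, the $u_i$ are proper closed convex functions. Assumption 2: there is at least one primal-dual solution $(x^*,\lambda^* )$, i.e. $x^*\in\mathcal X$, $Ax^*=b$ and $F(x)-F(x^* )-(x-x^* )^\top A^\top\lambda^*\ge0$ for all $x\in\mathcal X$. Assumption 3: there is a constant $L_f$ such that for every $I\subset\{1,\dots,N\}$ with $|I|=n$, $\|\nabla_If(x+U_I\tilde x)-\nabla_If(x)\|\le L_f\|\tilde x_I\|$ for all $x,\tilde x$, where $U_I\tilde x$ keeps the blocks of $\tilde x$ indexed by $I$ and is zero elsewhere. Assumption 4: let $\delta^k=G^k-\nabla f(x^k)$, where $G^k$ is the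 stochastic approximation of $\nabla f(x^k)$ used in the algorithm. There is a constant $\sigma$ such that for all $k$, $\mathbb E[\delta^k\mid x^k]=0$ and $\mathbb E\|\delta^k\|^2\le\sigma^2$. Algorithm (RPDBUS). Fix $1\le n\le N$, $\rho>0$, positive numbers $\alpha_0,\alpha_1,\dots$, a symmetric positive semidefinite block diagonal matrix $\hat P$ (blocks conformal with $x$), an initial point $x^0\in\mathcal X$ with $F(x^0)<\infty$, an initial multiplier $\lambda^0$, and $r^0=Ax^0-b$. For $k=0,1,\dots$: draw $I_k\subset\{1,\dots,N\}$ uniformly among all subsets of cardinality $n$, independently of the previous history and of $G^k$. Set $x_i^{k+1}=x_i^k$ for $i\notin I_k$ and, for $I=I_k$, $$x_I^{k+1}=\arg\min_{x_I\in\mathcal X_I}\langle G_I^k-A_I^\top\lambda^k,x_I\rangle+u_I(x_I)+\tfrac\rho2\|A_I(x_I-x_I^k)+r^k\|^2+\tfrac12\|x_I-x_I^k\|_{P^k+\frac{I}{\alpha_k}}^2,$$ $$r^{k+1}=r^k+A_I(x_I^{k+1}-x_I^k),\qquad\lambda^{k+1}=\lambda^k-\Big(1-\frac{(N-n)\alpha_{k+1}}{N\alpha_k}\Big)\rho\,r^{k+1},$$ where $P^k=\hat P_{I_k}-\rho A_{I_k}^\top A_{I_k}$ ($\hat P_{I_k}$ denotes the diagonal blocks of $\hat P$ indexed by $I_k$), and in $\frac{I}{\alpha_k}$ the symbol $I$ is the identity matrix. *)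

(* Defs.v *)
From HB Require Import structures.
From mathcomp Require Export all_boot all_order all_algebra.
From mathcomp Require Export all_classical all_reals all_analysis.
Set Implicit Arguments.
Unset Strict Implicit.
Unset Printing Implicit Defensive.
Import Order.TTheory GRing.Theory Num.Theory.
Import numFieldNormedType.Exports.
Local Open Scope classical_set_scope.
Local Open Scope ring_scope.

(* x = (x_1; ...; x_N) with x_i of dimension d i; the i-th block is
   submxcol x i, and that of a matrix A = (A_1, ..., A_N) is submxrow A i. *)
Notation bvec R d := ('cV[R]_(\sum_i d i)).

(* The norm MathComp-Analysis puts on matrices is the sup norm, so the
   Euclidean norm is defined here. *)
Definition dotv (R : realType) (n : nat) (y z : 'cV[R]_n) : R :=
  (y^T *m z) 0 0.

Definition wnorm2 (R : realType) (n : nat) (W : 'M[R]_n) (z : 'cV[R]_n) : R :=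
  (z^T *m W *m z) 0 0.

Definition enorm (R : realType) (n : nat) (z : 'cV[R]_n) : R :=
  Num.sqrt (dotv z z).

Definition psd (R : realType) (n : nat) (W : 'M[R]_n) : Prop :=
  W^T = W /\ forall z : 'cV[R]_n, 0 <= wnorm2 W z.

Definition loewner_ge (R : realType) (n : nat) (W V : 'M[R]_n) : Prop :=
  psd (W - V).

Section Blocks.
Context {R : realType} {N : nat} {d : 'I_N -> nat}.

(* The dimension of x_I; the blocks of x_I are numbered by j < #|I|, block j
   being the block enum_val j of x. *)
Definition subdim (I : {set 'I_N}) : nat := (\sum_(j < #|I|) d (enum_val j))%N.

Definition subvec (I : {set 'I_N}) (x : bvec R d) : 'cV[R]_(subdim I) :=
  \mxcol_(j < #|I|) submxcol x (enum_val j).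

Definition subcols (m : nat) (I : {set 'I_N})
    (A : 'M[R]_(m, \sum_i d i)) : 'M[R]_(m, subdim I) :=
  \mxrow_(j < #|I|) submxrow A (enum_val j).

Definition subdiag (I : {set 'I_N}) (W : 'M[R]_(\sum_i d i)) :
    'M[R]_(subdim I) :=
  \mxdiag_(j < #|I|) submxblock W (enum_val j) (enum_val j).

Definition block_diagonal (W : 'M[R]_(\sum_i d i)) : Prop :=
  forall i j : 'I_N, i != j -> submxblock W i j = 0.

(* U_I x: keeps the blocks in I, zero elsewhere. *)
Definition padv (I : {set 'I_N}) (x : bvec R d) : bvec R d :=
  \mxcol_i (if i \in I then submxcol x i else 0).

Definition prodset (X : forall i, set 'cV[R]_(d i)) : set (bvec R d) :=
  [set x | forall i, X i (submxcol x i)].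

Definition sub_prodset (X : forall i, set 'cV[R]_(d i)) (I : {set 'I_N}) :
    set 'cV[R]_(subdim I) :=
  [set z | forall j : 'I_#|I|, X (enum_val j) (submxcol z j)].

Definition sub_u (u : forall i, 'cV[R]_(d i) -> \bar R) (I : {set 'I_N})
    (z : 'cV[R]_(subdim I)) : \bar R :=
  (\sum_(j < #|I|) u (enum_val j) (submxcol z j))%E.

Definition objective (f : bvec R d -> R) (u : forall i, 'cV[R]_(d i) -> \bar R)
    (x : bvec R d) : \bar R :=
  ((f x)%:E + \sum_i u i (submxcol x i))%E.

End Blocks.

Arguments sub_prodset {R N d} X I _.

Definition grad (R : realType) (n : nat) (f : 'cV[R]_n -> R) (x : 'cV[R]_n) :
    'cV[R]_n :=
  \col_j 'D_(delta_mx j 0) f x.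

Definition proper_efun (R : realType) (V : Type) (g : V -> \bar R) : Prop :=
  (forall x, g x != -oo%E) /\ exists x, g x != +oo%E.

Definition convex_efun (R : realType) (V : lmodType R) (g : V -> \bar R) :
    Prop :=
  forall (x y : V) (t : R), 0 < t -> t < 1 ->
    (g (t *: x + (1 - t) *: y)%R <= t%:E * g x + (1 - t)%R%:E * g y)%E.

Definition is_argmin (R : realType) (V : Type) (X : set V) (g : V -> \bar R)
    (z : V) : Prop :=
  X z /\ forall y, X y -> (g z <= g y)%E.

Definition convex_composite (R : realType) (N : nat) (d : 'I_N -> nat)
    (X : forall i, set 'cV[R]_(d i)) (f : bvec R d -> R)
    (u : forall i, 'cV[R]_(d i) -> \bar R) : Prop :=
  [/\ forall i, closed (X i) /\ convex_set (X i),
      forall x, differentiable f x,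
      convex_function setT f &
      forall i, [/\ proper_efun (u i), lower_semicontinuous (u i)
                  & convex_efun (u i)]].

Definition primal_dual_solution (R : realType) (N : nat) (d : 'I_N -> nat)
    (m : nat) (A : 'M[R]_(m, \sum_i d i)) (b : 'cV[R]_m)
    (X : forall i, set 'cV[R]_(d i)) (F : bvec R d -> \bar R)
    (xs : bvec R d) (ls : 'cV[R]_m) : Prop :=
  [/\ prodset X xs, A *m xs = b &
      forall x, prodset X x ->
        (0 <= F x - F xs - (dotv (x - xs) (A^T *m ls))%R%:E)%E].

Definition block_lipschitz_grad (R : realType) (N : nat) (d : 'I_N -> nat) (n : nat)
    (f : bvec R d -> R) (Lf : R) : Prop :=
  forall I : {set 'I_N}, #|I| = n -> forall x y : bvec R d,
    enorm (subvec I (grad f (x + padv I y)) - subvec I (grad f x))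
      <= Lf * enorm (subvec I y).

Section Random.
Context {R : realType} {dsp : measure_display} {T : measurableType dsp}.

Definition random_vec (n : nat) (v : T -> 'cV[R]_n) : Prop :=
  forall i, measurable_fun setT (fun w => v w i 0).

(* sigma(v) *)
Definition sigma_vec (n : nat) (v : T -> 'cV[R]_n) : set (set T) :=
  g_sigma_preimage (fun (i : 'I_n) w => v w i 0).

(* Z is a version of the conditional expectation of Y given the
   sub-sigma-algebra S. *)
Definition is_cond_exp (P : probability T R) (S : set (set T))
    (Y Z : T -> R) : Prop :=
  [/\ P.-integrable setT (EFin \o Y),
      P.-integrable setT (EFin \o Z),
      forall B : set R, measurable B -> S (Z @^-1` B) &
      forall E, S E ->
        (\int[P]_(w in E) (Y w)%:E = \int[P]_(w in E) (Z w)%:E)%E].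

Definition expectation_function (P : probability T R) (q n : nat)
    (xi : T -> 'cV[R]_q) (fxi : 'cV[R]_q -> 'cV[R]_n -> R)
    (f : 'cV[R]_n -> R) : Prop :=
  random_vec xi /\ forall x,
    P.-integrable setT (fun w => (fxi (xi w) x)%:E) /\
    ((f x)%:E = 'E_P[fun w => fxi (xi w) x])%E.

Definition unbiased_bounded_variance (P : probability T R) (n : nat) (f : 'cV[R]_n -> R)
    (x G : nat -> T -> 'cV[R]_n) (sigma : R) : Prop :=
  forall k, let delta := fun w => G k w - grad f (x k w) in
    (forall i, is_cond_exp P (sigma_vec (x k)) (fun w => delta w i 0) (cst 0))
    /\ ('E_P[fun w => (enorm (delta w) ^+ 2)%R] <= (sigma ^+ 2)%R%:E)%E.

(* The sigma-algebra of everything known when I_k is drawn: the iterates up to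
   index k, G^0, ..., G^k and I_0, ..., I_(k-1). *)
Definition history (N D m : nat) (x : nat -> T -> 'cV[R]_D)
    (lam r : nat -> T -> 'cV[R]_m) (G : nat -> T -> 'cV[R]_D)
    (I : nat -> T -> {set 'I_N}) (k : nat) : set (set T) :=
  <<s [set E | (exists2 j, (j <= k)%N &
                  [\/ sigma_vec (x j) E, sigma_vec (lam j) E,
                      sigma_vec (r j) E | sigma_vec (G j) E])
            \/ (exists2 j, (j < k)%N &
                  exists S : {set 'I_N}, E = [set w | I j w = S])] >>.

Definition uniform_draw (P : probability T R) (N n : nat)
    (J : T -> {set 'I_N}) : Prop :=
  [/\ forall w, #|J w| = n,
      forall S : {set 'I_N}, measurable [set w | J w = S] &
      forall S : {set 'I_N}, #|S| = n ->
        P [set w | J w = S] = (('C(N, n))%:R^-1)%R%:E].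

Definition indep_draw (P : probability T R) (N : nat)
    (J : T -> {set 'I_N}) (H : set (set T)) : Prop :=
  forall (S : {set 'I_N}) E, H E ->
    (P ([set w | J w = S] `&` E) = P [set w | J w = S] * P E)%E.

End Random.

Definition subproblem (R : realType) (N : nat) (d : 'I_N -> nat) (m : nat)
    (A : 'M[R]_(m, \sum_i d i)) (u : forall i, 'cV[R]_(d i) -> \bar R)
    (rho : R) (Phat : 'M[R]_(\sum_i d i)) (I : {set 'I_N})
    (Gk xk : bvec R d) (lamk rk : 'cV[R]_m) (al : R)
    (z : 'cV[R]_(subdim (d := d) I)) : \bar R :=
  let AI := subcols I A in
  let PI := subdiag I Phat - rho *: (AI^T *m AI) in
  ((dotv (subvec I Gk - AI^T *m lamk) z)%R%:E + sub_u u z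
   + (rho / 2 * enorm (AI *m (z - subvec I xk) + rk) ^+ 2)%R%:E
   + (2^-1 * wnorm2 (PI + (al^-1)%:M) (z - subvec I xk))%R%:E)%E.

Definition rpdbus (R : realType) (dsp : measure_display)
    (T : measurableType dsp) (P : probability T R)
    (N : nat) (d : 'I_N -> nat) (m n : nat)
    (A : 'M[R]_(m, \sum_i d i)) (b : 'cV[R]_m)
    (X : forall i, set 'cV[R]_(d i)) (u : forall i, 'cV[R]_(d i) -> \bar R)
    (rho : R) (alpha : nat -> R) (Phat : 'M[R]_(\sum_i d i))
    (x0 : bvec R d) (lam0 : 'cV[R]_m)
    (I : nat -> T -> {set 'I_N}) (G x : nat -> T -> bvec R d)
    (r lam : nat -> T -> 'cV[R]_m) : Prop :=
  [/\ forall w, [/\ x 0%N w = x0, r 0%N w = A *m x0 - b & lam 0%N w = lam0],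
      forall k, random_vec (G k) /\ random_vec (x k),
      forall k, uniform_draw P n (I k)
                /\ indep_draw P (I k) (history x lam r G I k) &
      forall k w, let J := I k w in
        [/\ forall i, i \notin J ->
              submxcol (x k.+1 w) i = submxcol (x k w) i,
            is_argmin (sub_prodset X J)
              (subproblem A u rho Phat (G k w) (x k w) (lam k w) (r k w)
                 (alpha k))
              (subvec J (x k.+1 w)),
            r k.+1 w
              = r k w + subcols J A *m (subvec J (x k.+1 w) - subvec J (x k w))
          & lam k.+1 w
              = lam k w - ((1 - (N - n)%:R * alpha k.+1 / (N%:R * alpha k))
                           * rho) *: r k.+1 w]].

Definition xhat (R : realType) (T : Type) (D : nat) (theta : R)
    (alpha : nat -> R) (x : nat -> T -> 'cV[R]_D) (t : nat) (w : T) :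
    'cV[R]_D :=
  (alpha t.+1 + theta * \sum_(1 <= k < t.+1) alpha k)^-1
  *: (alpha t.+1 *: x t.+1 w
      + theta *: \sum_(1 <= k < t.+1) alpha k *: x k w).

Definition C0 (R : realType) (N : nat) (d : 'I_N -> nat) (m : nat)
    (A : 'M[R]_(m, \sum_i d i)) (F : bvec R d -> \bar R)
    (rho theta alpha0 : R) (Phat : 'M[R]_(\sum_i d i))
    (x0 xs : bvec R d) (ls : 'cV[R]_m) : \bar R :=
  let Dx := alpha0 *: (Phat - rho *: (A^T *m A)) + 1%:M in
  (((1 - theta) * alpha0)%R%:E * (F x0 - F xs)
   + (2^-1 * wnorm2 Dx (x0 - xs))%R%:E
   + (alpha0 / (2 * rho)
      * Num.max ((1 + enorm ls) ^+ 2) (4 * enorm ls ^+ 2))%R%:E)%E.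

Definition max_error (R : realType) (dsp : measure_display)
    (T : measurableType dsp) (P : probability T R) (D m : nat)
    (A : 'M[R]_(m, D)) (b : 'cV[R]_m) (F : 'cV[R]_D -> \bar R)
    (xs : 'cV[R]_D) (y : T -> 'cV[R]_D) : \bar R :=
  Order.max `| \int[P]_w (F (y w) - F xs) |%E
            'E_P[fun w => enorm (A *m y w - b)%R]%E.

(* Main.v *)
(* Write (xs, ls) for the primal-dual solution. One iteration is a proximal
   step, so the three-point inequality, the descent lemma along the drawn
   blocks and convexity give a one-step inequality for the gap, with an error
   M_k that has mean zero because the draw is independent of the past and the
   noise is conditionally centered. Weighted by alpha_k and summed, the
   primal terms telescope and the multiplier terms become <lambda_k, r_k>.
   The averaging weights differ from the weights beta_k of that sum by
   alpha_(k-1) - alpha_k >= 0; multiplying by the gap F(x_k) - F(xs) - <ls,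
   r_k> >= 0 passes from one to the other. What is left is a sum of products
   of the residuals with lambda_k - ls and with a free vector e, which a
   quadratic potential in lambda_k - ls bounds. Taking for e the vectors ls,
   r/|r| and |ls| r/|r|, with r the residual of the average, bounds both
   errors before taking expectations. Square integrability of the iterates is
   obtained from the same one-step inequality by induction. *)
Require Import Defs.
From HB Require Import structures.
From mathcomp Require Import all_boot all_order all_algebra.
From mathcomp Require Import all_classical all_reals all_analysis.
From mathcomp Require Import measurable_realfun.
From mathcomp Require Import ring lra zify.
Import Order.TTheory GRing.Theory Num.Theory.
Import numFieldNormedType.Exports.
Set Implicit Arguments.
Unset Strict Implicit.
Unset Printing Implicit Defensive.
Local Open Scope classical_set_scope.
Local Open Scope ring_scope.

(** * Euclidean products and weighted norms *)

Section Euclidean.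
Context {R : realType}.
Implicit Types n m : nat.

(** Two of the vectors e depend on the sample through the residual of the average, so the inequality
    with e must hold on every path; the expectation then meets only the noise and M_k, neither of
    which involves e.

    The delicate point is the constant. The normaliser W of [xhat] is at least theta * alpha_0 *
    sqrt t, and the ratio S of the two is exactly the factor that the multiplier argument may lose
    while still giving the dual term of [C0]. [admissible] isolates this budget. For steps alpha_0 /
    sqrt k the obstacle is that alpha_0 = alpha_1: the potential has no slack at its first step,
    although the coefficient of <e, nu_k> drops there. Hence the smoothed coefficients [hh], and a
    numerical check that their cost fits in S.

    On the probabilistic side only the noise is assumed to have a second moment. That M_k is
    integrable requires square integrable iterates and gradients, and the Lipschitz assumption moves
    only n blocks at a time; co-coercivity along single blocks replaces a global Lipschitz bound. *)

Lemma dotvE n (y z : 'cV[R]_n) : dotv y z = \sum_i y i 0 * z i 0.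
Proof. by rewrite /dotv mxE; apply: eq_bigr => i _; rewrite mxE. Qed.

Lemma dotvC n (y z : 'cV[R]_n) : dotv y z = dotv z y.
Proof. by rewrite !dotvE; apply: eq_bigr => i _; rewrite mulrC. Qed.

Lemma dotvDl n (x y z : 'cV[R]_n) : dotv (x + y) z = dotv x z + dotv y z.
Proof. by rewrite /dotv linearD mulmxDl mxE. Qed.

Lemma dotvDr n (x y z : 'cV[R]_n) : dotv z (x + y) = dotv z x + dotv z y.
Proof. by rewrite dotvC dotvDl !(dotvC z). Qed.

Lemma dotvZl n a (x y : 'cV[R]_n) : dotv (a *: x) y = a * dotv x y.
Proof. by rewrite /dotv linearZ -scalemxAl mxE. Qed.

Lemma dotvZr n a (x y : 'cV[R]_n) : dotv x (a *: y) = a * dotv x y.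
Proof. by rewrite dotvC dotvZl dotvC. Qed.

Lemma dotvNl n (x y : 'cV[R]_n) : dotv (- x) y = - dotv x y.
Proof. by rewrite -scaleN1r dotvZl mulN1r. Qed.

Lemma dotvNr n (x y : 'cV[R]_n) : dotv x (- y) = - dotv x y.
Proof. by rewrite dotvC dotvNl dotvC. Qed.

Lemma dotvBl n (x y z : 'cV[R]_n) : dotv (x - y) z = dotv x z - dotv y z.
Proof. by rewrite dotvDl dotvNl. Qed.

Lemma dotvBr n (x y z : 'cV[R]_n) : dotv z (x - y) = dotv z x - dotv z y.
Proof. by rewrite dotvDr dotvNr. Qed.

Lemma dot0v n (x : 'cV[R]_n) : dotv 0 x = 0.
Proof. by rewrite -(scale0r 0) dotvZl mul0r. Qed.

Lemma dotv0 n (x : 'cV[R]_n) : dotv x 0 = 0.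
Proof. by rewrite dotvC dot0v. Qed.

Lemma dotv_suml n (J : Type) (s : seq J) (p : pred J) (y : J -> 'cV[R]_n) x :
  dotv (\sum_(j <- s | p j) y j) x = \sum_(j <- s | p j) dotv (y j) x.
Proof.
by elim/big_rec2: _ => [|j a b _ <-]; rewrite ?dot0v ?dotvDl.
Qed.

Lemma dotv_sumr n (J : Type) (s : seq J) (p : pred J) (y : J -> 'cV[R]_n) x :
  dotv x (\sum_(j <- s | p j) y j) = \sum_(j <- s | p j) dotv x (y j).
Proof.
by rewrite dotvC dotv_suml; apply: eq_bigr => j _; rewrite dotvC.
Qed.

Lemma dotv_ge0 n (x : 'cV[R]_n) : 0 <= dotv x x.
Proof. by rewrite dotvE; apply: sumr_ge0 => i _; rewrite -expr2 sqr_ge0. Qed.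

Lemma dotv_eq0 n (x : 'cV[R]_n) : dotv x x = 0 -> x = 0.
Proof.
rewrite dotvE => /eqP; rewrite psumr_eq0 => [/allP h|i _]; last first.
  by rewrite -expr2 sqr_ge0.
apply/colP => i; rewrite mxE; apply/eqP.
by have := h i (mem_index_enum _); rewrite mulf_eq0 orbb.
Qed.

Lemma dotv_mull m n (A : 'M[R]_(m, n)) y z :
  dotv (A *m y) z = dotv y (A^T *m z).
Proof. by rewrite /dotv trmx_mul mulmxA. Qed.

Lemma dotv_mulr m n (A : 'M[R]_(m, n)) y z :
  dotv z (A *m y) = dotv (A^T *m z) y.
Proof. by rewrite dotvC dotv_mull dotvC. Qed.

Lemma wnorm2E n (W : 'M[R]_n) z : wnorm2 W z = dotv z (W *m z).
Proof. by rewrite /wnorm2 /dotv mulmxA. Qed.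

Lemma wnorm2DW n (W V : 'M[R]_n) z : wnorm2 (W + V) z = wnorm2 W z + wnorm2 V z.
Proof. by rewrite !wnorm2E mulmxDl dotvDr. Qed.

Lemma wnorm2BW n (W V : 'M[R]_n) z : wnorm2 (W - V) z = wnorm2 W z - wnorm2 V z.
Proof. by rewrite !wnorm2E mulmxBl dotvBr. Qed.

Lemma wnorm2ZW n a (W : 'M[R]_n) z : wnorm2 (a *: W) z = a * wnorm2 W z.
Proof. by rewrite !wnorm2E -scalemxAl dotvZr. Qed.

Lemma wnorm2_scalar n a (z : 'cV[R]_n) : wnorm2 a%:M z = a * dotv z z.
Proof. by rewrite wnorm2E mul_scalar_mx dotvZr. Qed.

Lemma wnorm2_gram m n (A : 'M[R]_(m, n)) z :
  wnorm2 (A^T *m A) z = dotv (A *m z) (A *m z).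
Proof. by rewrite wnorm2E dotv_mull mulmxA. Qed.

Lemma enorm_sqr n (z : 'cV[R]_n) : enorm z ^+ 2 = dotv z z.
Proof. by rewrite /enorm sqr_sqrtr ?dotv_ge0. Qed.

Lemma enorm_ge0 n (z : 'cV[R]_n) : 0 <= enorm z.
Proof. exact: sqrtr_ge0. Qed.

Lemma enorm0 n : enorm (0 : 'cV[R]_n) = 0.
Proof. by rewrite /enorm dot0v sqrtr0. Qed.

Lemma enorm_eq0 n (z : 'cV[R]_n) : enorm z = 0 -> z = 0.
Proof. by move=> h; apply: dotv_eq0; rewrite -enorm_sqr h expr0n. Qed.

Lemma enormZ n a (z : 'cV[R]_n) : enorm (a *: z) = `|a| * enorm z.
Proof.
by rewrite /enorm dotvZl dotvZr mulrA -expr2 sqrtrM ?sqr_ge0// sqrtr_sqr.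
Qed.

Lemma young_dotv n c (y z : 'cV[R]_n) : 0 < c ->
  dotv y z <= c / 2 * dotv y y + (2 * c)^-1 * dotv z z.
Proof.
move=> c0; have := dotv_ge0 (c *: y - z).
rewrite dotvBl !dotvBr !dotvZl !dotvZr (dotvC z y) => h.
have -> : c / 2 * dotv y y + (2 * c)^-1 * dotv z z =
  (2 * c)^-1 * (c * (c * dotv y y) + dotv z z) by field; rewrite gt_eqF.
rewrite ler_pdivlMl ?mulr_gt0//; lra.
Qed.

Lemma cauchy_schwarz n (y z : 'cV[R]_n) : dotv y z <= enorm y * enorm z.
Proof.
have [/eqP/enorm_eq0 ->|y0] := boolP (enorm y == 0).
  by rewrite dot0v enorm0 mul0r.
have [/eqP/enorm_eq0 ->|z0] := boolP (enorm z == 0).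
  by rewrite dotv0 enorm0 mulr0.
have py : 0 < enorm y by rewrite lt_neqAle eq_sym y0 enorm_ge0.
have pz : 0 < enorm z by rewrite lt_neqAle eq_sym z0 enorm_ge0.
(* This value of the parameter balances the two terms of Young's inequality. *)
have := @young_dotv _ (enorm z / enorm y) y z (divr_gt0 pz py).
rewrite -!enorm_sqr => /le_trans; apply; rewrite le_eqVlt; apply/orP; left.
by apply/eqP; field; rewrite !gt_eqF.
Qed.

Lemma cauchy_schwarz_norm n (y z : 'cV[R]_n) : `|dotv y z| <= enorm y * enorm z.
Proof.
rewrite ler_norml cauchy_schwarz andbT lerNl -dotvNl.
by apply: le_trans (cauchy_schwarz _ _) _; rewrite -scaleN1r enormZ normrN1 mul1r.
Qed.

Lemma psd_polar n (B : 'M[R]_n) (y z : 'cV[R]_n) : B^T = B ->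
  wnorm2 B (y + z) = wnorm2 B y + 2 * dotv (B *m y) z + wnorm2 B z.
Proof.
move=> sB; rewrite !wnorm2E mulmxDr !(dotvDl, dotvDr) (dotvC z (B *m y)).
by rewrite (dotv_mulr B z y) sB; lra.
Qed.

Lemma sqr_col_le_dotv n (y : 'cV[R]_n) i : y i 0 ^+ 2 <= dotv y y.
Proof.
rewrite dotvE (bigD1 i)//= expr2 lerDl.
by apply: sumr_ge0 => j _; rewrite -expr2 sqr_ge0.
Qed.

End Euclidean.

(** * Block vectors and padding by zeros *)

Lemma submxcolZ (R : realType) (N : nat) (d : 'I_N -> nat) (a : R)
    (x : bvec R d) i :
  submxcol (a *: x) i = a *: submxcol x i.
Proof. by apply/matrixP => k l; rewrite !mxE. Qed.

Section BlockVectors.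
Context {R : realType} {N : nat} {d : 'I_N -> nat}.
Implicit Types (x y z : bvec R d) (I : {set 'I_N}).

Lemma dotv_blocks x y : dotv x y = \sum_i dotv (submxcol x i) (submxcol y i).
Proof.
rewrite -{1}(submxcolK x) -{1}(submxcolK y) /dotv tr_mxcol mul_mxrow_mxcol.
by rewrite summxE.
Qed.

Lemma dotv_subvec I x y :
  dotv (subvec I x) (subvec I y) = \sum_(i in I) dotv (submxcol x i) (submxcol y i).
Proof.
rewrite /dotv /subvec tr_mxcol mul_mxrow_mxcol summxE.
by rewrite [RHS]big_enum_val.
Qed.

Lemma submxcol_padv I x i : submxcol (padv I x) i = if i \in I then submxcol x i else 0.
Proof. by rewrite /padv mxcolK. Qed.

Lemma subvec_padv I x : subvec I (padv I x) = subvec I x.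
Proof.
by apply: eq_mxcol => j; rewrite submxcol_padv enum_valP.
Qed.

(** The dimension of a sub-vector depends on the random set I. Padding by zeros moves everything to
    the full space; with [mul_subcols] and [wnorm2_subdiag] this rewrites the whole sub-problem
    there. *)
Lemma dotv_padv I x y : dotv x (padv I y) = dotv (subvec I x) (subvec I y).
Proof.
rewrite dotv_subvec dotv_blocks [RHS]big_mkcond/=; apply: eq_bigr => i _.
by rewrite submxcol_padv; case: ifP => // _; rewrite dotv0.
Qed.

Lemma dotv_padv2 I x y : dotv (padv I x) (padv I y) = dotv x (padv I y).
Proof. by rewrite [in RHS]dotv_padv dotv_padv subvec_padv. Qed.

Lemma mul_subcols m (A : 'M[R]_(m, \sum_i d i)) I x :
  subcols I A *m subvec I x = A *m padv I x.
Proof.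
rewrite /subcols /subvec mul_mxrow_mxcol.
rewrite -[in RHS](submxrowK A) /padv mul_mxrow_mxcol.
rewrite -(big_enum_val (fun i => submxrow A i *m submxcol x i)) big_mkcond/=.
by apply: eq_bigr => i _; case: ifP; rewrite ?mulmx0.
Qed.

Lemma subcols_tr m (A : 'M[R]_(m, \sum_i d i)) I l :
  (subcols I A)^T *m l = subvec I (A^T *m l).
Proof.
rewrite /subcols /subvec tr_mxrow mxcol_mul; apply: eq_mxcol => j.
by rewrite -submxcol_mul tr_submxrow.
Qed.

Lemma subvecB I x y : subvec I (x - y) = subvec I x - subvec I y.
Proof. by rewrite /subvec -mxcolB; apply: eq_mxcol => j; rewrite submxcolB. Qed.

Lemma subvecD I x y : subvec I (x + y) = subvec I x + subvec I y.
Proof. by rewrite /subvec -mxcolD; apply: eq_mxcol => j; rewrite submxcolD. Qed.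

Lemma submxcol_subvec I x j : submxcol (subvec I x) j = submxcol x (enum_val j).
Proof. by rewrite /subvec mxcolK. Qed.

Lemma block_diagonal_mul (W : 'M[R]_(\sum_i d i)) x i : block_diagonal W ->
  submxcol (W *m x) i = submxblock W i i *m submxcol x i.
Proof.
move=> bW; rewrite -submxcol_mul -[in LHS](submxcolK x).
rewrite -[submxcol W i]submxrowK mul_mxrow_mxcol.
rewrite (bigD1 (op := @GRing.add 'cV[R]_(d i)) i)//= -submxblockEv -[RHS]addr0.
congr (_ + _); apply: big1 => j ji.
by rewrite -submxblockEv bW 1?eq_sym// mul0mx.
Qed.

Lemma wnorm2_block (W : 'M[R]_(\sum_i d i)) x : block_diagonal W ->
  wnorm2 W x = \sum_i wnorm2 (submxblock W i i) (submxcol x i).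
Proof.
move=> bW; rewrite wnorm2E dotv_blocks; apply: eq_bigr => i _.
by rewrite block_diagonal_mul// wnorm2E.
Qed.

Lemma wnorm2_subdiag (W : 'M[R]_(\sum_i d i)) I x : block_diagonal W ->
  wnorm2 (subdiag I W) (subvec I x) = wnorm2 W (padv I x).
Proof.
move=> bW; rewrite wnorm2E /subdiag {2}/subvec mul_mxdiag_mxcol.
transitivity (\sum_(i in I) wnorm2 (submxblock W i i) (submxcol x i)).
  rewrite /dotv /subvec tr_mxcol mul_mxrow_mxcol summxE [RHS]big_enum_val.
  by apply: eq_bigr => j _; rewrite wnorm2E.
rewrite wnorm2_block// big_mkcond; apply: eq_bigr => i _.
by rewrite submxcol_padv; case: ifP => // _; rewrite wnorm2E dot0v.
Qed.

Lemma padvD I x y : padv I (x + y) = padv I x + padv I y.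
Proof.
by apply/mxcolP => i; rewrite submxcolD !submxcol_padv; case: ifP;
   rewrite ?submxcolD ?addr0.
Qed.

Lemma padv_idem I x : padv I (padv I x) = padv I x.
Proof. by apply/mxcolP => i; rewrite !submxcol_padv; case: (i \in I). Qed.

Lemma padvZ I (a : R) x : padv I (a *: x) = a *: padv I x.
Proof.
by apply/mxcolP => i; rewrite submxcolZ !submxcol_padv; case: ifP;
   rewrite ?submxcolZ ?scaler0.
Qed.

Lemma subvecZ I (a : R) x : subvec I (a *: x) = a *: subvec I x.
Proof.
by rewrite /subvec; apply/matrixP => k l; rewrite !mxE.
Qed.

End BlockVectors.

(** * Gradients, convexity and descent along a line *)

Section Calculus.
Context {R : realType}.

Lemma convex_setE (V : lmodType R) (S : set V) (x y : V) (s : R) :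
  convex_set S -> S x -> S y -> 0 < s -> s < 1 -> S (s *: x + (1 - s) *: y).
Proof.
move=> cS Sx Sy s0 s1.
by have := cS x y (Itv01 (ltW s0) (ltW s1)); rewrite !inE => /(_ Sx Sy).
Qed.

Lemma convex_functionE (V : lmodType R) (f : V -> R) (x y : V) (s : R) :
  convex_function setT f -> 0 < s -> s < 1 ->
  f (s *: x + (1 - s) *: y) <= s * f x + (1 - s) * f y.
Proof.
move=> cf s0 s1.
have := cf (Itv01 (ltW s0) (ltW s1)) x y; rewrite !inE => /(_ I I).
by [].
Qed.

Lemma derive_grad n (f : 'cV[R]_n -> R) x v : differentiable f x ->
  'D_v f x = dotv (grad f x) v.
Proof.
move=> df; rewrite deriveE// {1}(_ : v = \sum_i v i 0 *: delta_mx i 0).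
  rewrite linear_sum dotvE; apply: eq_bigr => i _.
  by rewrite linearZ /= mxE -deriveE// mulrC.
by apply/colP => i; rewrite summxE (bigD1 i)//= !mxE !eqxx mulr1 big1 ?addr0//
   => j ji; rewrite !mxE eq_sym (negbTE ji) mulr0.
Qed.

Lemma is_derive_line n (f : 'cV[R]_n -> R) x v (s : R) :
  (forall x, differentiable f x) ->
  is_derive s 1 (fun s => f (x + s *: v)) (dotv (grad f (x + s *: v)) v).
Proof.
move=> df.
have E : (fun h : R => h^-1 *: (((fun s => f (x + s *: v)) \o shift s) (h *: 1)
     - f (x + s *: v)))
   = (fun h => h^-1 *: ((f \o shift (x + s *: v)) (h *: v) - f (x + s *: v))).
  apply/funext => h /=; congr (_ *: (f _ - _)).
  by rewrite scalerDl [h *: 1]mulr1 addrCA.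
split; first by rewrite /derivable E; exact: diff_derivable.
by rewrite /derive E -derive_grad.
Qed.

(** By convexity the difference quotients from x towards y with step h in (0, 1) are at most f y - f
    x; the directional derivative is their limit as h decreases to 0. *)
Lemma gradient_inequality n (f : 'cV[R]_n -> R) x y :
  (forall x, differentiable f x) -> convex_function setT f ->
  f x + dotv (grad f x) (y - x) <= f y.
Proof.
move=> df cf; have [dl] := is_derive_line x (y - x) 0 df.
rewrite scale0r addr0 => <-.
rewrite addrC -lerBrDr.
apply: (@cvgr_to_le _ _ _ _ _ _ _ (cvg_dnbhs_at_right dl)).
near=> h => /=.
have h0 : 0 < h by [].
have h1 : h < 1 by near: h; exact: nbhs_right_lt.
rewrite /= addr0 scale0r addr0 [h *: 1]mulr1 [_ *: _]mulrC ler_pdivrMr//.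
have -> : x + h *: (y - x) = h *: y + (1 - h) *: x.
  by rewrite scalerBr scalerBl scale1r addrCA addrA.
by have := convex_functionE y x cf h0 h1; lra.
Unshelve. all: by end_near. Qed.

(** The mean value theorem replaces integration of the gradient: subtracting s * g0 + c / 2 * s ^ 2
    from f (x + s v) leaves a function whose derivative is nonpositive on (0, 1). *)
Lemma descent_inequality n (f : 'cV[R]_n -> R) x v c :
  (forall x, differentiable f x) ->
  (forall s, 0 < s -> s < 1 ->
     dotv (grad f (x + s *: v)) v <= dotv (grad f x) v + s * c) ->
  f (x + v) <= f x + dotv (grad f x) v + c / 2.
Proof.
move=> df hc; set g0 := dotv (grad f x) v.
pose g (s : R) : R := f (x + s *: v) - (s * g0 + c / 2 * s ^+ 2).
pose dg s := dotv (grad f (x + s *: v)) v - (g0 + c * s).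
have dgE (s : R) : is_derive s 1 g (dg s).
  have d1 := is_derive_line x v s df.
  have -> : g = (fun s => f (x + s *: v))
      - (g0 *: (@id R) + (c / 2) *: ((@id R) ^+ 2)).
    apply/funext => z; rewrite /g !fctE /=; congr (_ - (_ + _)); exact: mulrC.
  apply: is_deriveB.
  apply: is_derive_eq; rewrite /GRing.scale/= !mulr1 expr1 /=.
  by rewrite mulrA divfK ?pnatr_eq0.
have gc : {within `[0, 1], continuous g}.
  by apply: derivable_within_continuous => z _; case: (dgE z).
have [z z01] := MVT ltr01 (fun z _ => dgE z) gc.
rewrite /g /dg !scale1r scale0r addr0 => e.
have /andP[z0 z1] : (0 < z) && (z < 1) by move: z01; rewrite in_itv.
by have := hc z z0 z1; rewrite -/g0 in e *; lra.
Qed.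

End Calculus.

(** * The three-point inequality *)

Section ThreePoint.
Context {R : realType}.

Lemma ge0_of_small_perturbations (a c : R) :
  (forall s, 0 < s -> s < 1 -> 0 <= a + s * c) -> 0 <= a.
Proof.
move=> h; rewrite leNgt; apply/negP => a0.
have c0 : 0 <= `|c| by [].
have D0 : 0 < `|c| + 1 - a by lra.
(* The step - a / (|c| + 1 - a) lies in (0, 1) and makes s * |c| smaller than - a, which contradicts
   the hypothesis when a < 0. *)
have s0 : 0 < - a / (`|c| + 1 - a) by rewrite divr_gt0//; lra.
have s1 : - a / (`|c| + 1 - a) < 1 by rewrite ltr_pdivrMr//; lra.
have := h _ s0 s1.
have cc : - a / (`|c| + 1 - a) * c <= - a / (`|c| + 1 - a) * `|c|.
  by rewrite ler_pM2l// ler_norm.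
have : - a / (`|c| + 1 - a) * `|c| < - a.
  rewrite mulrAC ltr_pdivrMr//; nra.
lra.
Qed.

Lemma wnorm2Z n (W : 'M[R]_n) a z : wnorm2 W (a *: z) = a ^+ 2 * wnorm2 W z.
Proof. by rewrite !wnorm2E -scalemxAr dotvZl dotvZr mulrA expr2. Qed.

(** Minimality along the segment from p to y, divided by s with s tending to 0, gives the
    first-order condition 0 <= [H]. The quadratic part expands exactly around p, and its remainder
    is the term in y - p. *)
Lemma three_point n (h : 'cV[R]_n -> R) (g p x y : 'cV[R]_n) (B : 'M[R]_n)
    (Psi := fun z => h z + dotv g (z - x) + 2^-1 * wnorm2 B (z - x)) :
  B^T = B ->
  (forall s, 0 < s -> s < 1 ->
     h (s *: y + (1 - s) *: p) <= s * h y + (1 - s) * h p) ->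
  (forall s, 0 < s -> s < 1 -> Psi p <= Psi (s *: y + (1 - s) *: p)) ->
  Psi p + 2^-1 * wnorm2 B (y - p) <= Psi y.
Proof.
move=> sB hc hmin.
pose H := h y - h p + dotv g (y - p) + dotv (B *m (p - x)) (y - p).
have Ez (s : R) : s *: y + (1 - s) *: p - x = (p - x) + s *: (y - p).
  by rewrite scalerBl scale1r scalerBr; apply/colP => i; rewrite !mxE; ring.
have W (s : R) : wnorm2 B (p - x + s *: (y - p)) = wnorm2 B (p - x)
    + 2 * s * dotv (B *m (p - x)) (y - p) + s ^+ 2 * wnorm2 B (y - p).
  by rewrite psd_polar// dotvZr wnorm2Z; ring.
have : 0 <= H.
  apply: (@ge0_of_small_perturbations _ (2^-1 * wnorm2 B (y - p))) => s s0 s1.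
  have := hmin s s0 s1; rewrite /Psi Ez W (dotvDr (p - x)) dotvZr.
  have := hc s s0 s1 => h1 h2.
  rewrite -(pmulr_rge0 _ s0) /H; nra.
have yx : y - x = (p - x) + (y - p) by rewrite [RHS]addrC subrKA.
have := W 1; rewrite scale1r -yx => W1.
have dg : dotv g (y - x) = dotv g (p - x) + dotv g (y - p) by rewrite -dotvDr -yx.
by rewrite /H /Psi dg W1; lra.
Qed.

End ThreePoint.

(** * The objective on its effective domain *)

Section Composite.
Context {R : realType} {N : nat} {d : 'I_N -> nat}.
Variables (X : forall i : 'I_N, set 'cV[R]_(d i)) (f : bvec R d -> R).
Variable u : forall i : 'I_N, 'cV[R]_(d i) -> \bar R.
Arguments u : clear implicits.
Hypothesis cc : convex_composite X f u.

(* On the effective domain of u, F is real-valued and equal to realF. *)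
Definition edom (x : bvec R d) := forall i, u i (submxcol x i) \is a fin_num.
Definition realu i (z : 'cV[R]_(d i)) := fine (u i z).
Arguments realu : clear implicits.
Definition realF x := f x + \sum_i realu i (submxcol x i).

Lemma u_gtNy i z : u i z != -oo%E.
Proof. by case: cc => _ _ _ /(_ i) [[+ _] _ _]; apply. Qed.

Arguments u_gtNy : clear implicits.

Lemma realuK x i : edom x -> u i (submxcol x i) = (realu i (submxcol x i))%:E.
Proof. by move=> ex; rewrite fineK. Qed.

Lemma objective_fin x : edom x -> objective f u x = (realF x)%:E.
Proof.
move=> ex; rewrite /objective (eq_bigr (fun i => (realu i (submxcol x i))%:E)).
  by rewrite sumEFin.
by move=> i _; rewrite realuK.
Qed.

Lemma sum_u_fin (J : finType) (p : pred J) (v : J -> \bar R) :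
  (forall j, p j -> v j != -oo%E) -> (\sum_(j | p j) v j < +oo)%E ->
  forall j, p j -> v j \is a fin_num.
Proof.
move=> vN vlt j pj; rewrite fin_numE vN//=; apply/negP => /eqP vj.
move: vlt; rewrite (bigD1 j)//= vj addye ?ltxx//.
apply/negP => /eqP /esum_eqNyP [i [_ /andP[pi _]] /eqP].
by rewrite (negbTE (vN i pi)).
Qed.

Lemma objective_edom x : (objective f u x < +oo)%E -> edom x.
Proof.
rewrite /objective => h i; apply: (@sum_u_fin _ xpredT (fun i => u i (submxcol x i))) => //.
  by move=> j _; exact: u_gtNy.
by move: h; case: (\sum_i _)%E => [r||] //= _; rewrite ltry.
Qed.

Lemma edom_conv (s : R) x y : edom x -> edom y -> 0 < s -> s < 1 ->
  edom (s *: x + (1 - s) *: y).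
Proof.
move=> ex ey s0 s1 i; case: cc => _ _ _ /(_ i) [_ _ cu].
have := cu (submxcol x i) (submxcol y i) s s0 s1.
rewrite (realuK i ex) (realuK i ey) -!EFinM -EFinD submxcolD !submxcolZ => h.
by rewrite fin_numE u_gtNy/= -ltey; exact: le_lt_trans h (ltry _).
Qed.

Lemma realu_conv (s : R) x y i : edom x -> edom y -> 0 < s -> s < 1 ->
  realu i (submxcol (s *: x + (1 - s) *: y) i)
    <= s * realu i (submxcol x i) + (1 - s) * realu i (submxcol y i).
Proof.
move=> ex ey s0 s1; have ez := edom_conv ex ey s0 s1.
case: cc => _ _ _ /(_ i) [_ _ cu].
have := cu (submxcol x i) (submxcol y i) s s0 s1.
by rewrite (realuK i ex) (realuK i ey) -!EFinM -EFinD -!submxcolZ -submxcolD realuK// lee_fin.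
Qed.

Lemma realF_conv (s : R) x y : edom x -> edom y -> 0 < s -> s < 1 ->
  realF (s *: x + (1 - s) *: y) <= s * realF x + (1 - s) * realF y.
Proof.
move=> ex ey s0 s1; case: (cc) => _ _ cf _.
rewrite /realF !mulrDr addrACA lerD ?convex_functionE//.
by rewrite !mulr_sumr -big_split/= ler_sum// => i _; exact: realu_conv.
Qed.

Lemma prodset_conv (s : R) x y : prodset X x -> prodset X y -> 0 < s -> s < 1 ->
  prodset X (s *: x + (1 - s) *: y).
Proof.
move=> Xx Xy s0 s1 i; rewrite submxcolD !submxcolZ.
by case: cc => /(_ i) [_ cX] _ _ _; apply: convex_setE.
Qed.

(** A new point enters as a convex combination with the previous average, in the ratio W / (W + v).
    Domain and feasibility are carried through the induction because [realF] represents the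
    objective, and is convex, on the effective domain. *)
Lemma realF_jensen (w : nat -> R) (y : nat -> bvec R d) t :
  (forall k, 0 < w k) -> (forall k, edom (y k)) -> (forall k, prodset X (y k)) ->
  let W := \sum_(1 <= k < t.+2) w k in
  let z := W^-1 *: \sum_(1 <= k < t.+2) w k *: y k in
  [/\ 0 < W, edom z, prodset X z &
      W * realF z <= \sum_(1 <= k < t.+2) w k * realF (y k)].
Proof.
move=> w0 ey Xy; elim: t => [|t IH].
  by rewrite /= !big_nat1 scalerA mulVf ?gt_eqF// scale1r.
move: IH => /=; set W := \sum_(_ <= _ < _) w _.
set z := \sum_(_ <= _ < _) _ *: _; set S := \sum_(_ <= _ < _) _ * _.
move=> [W0 ez Xz h]; rewrite big_nat_recr//= -/W big_nat_recr//= -/z.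
rewrite big_nat_recr//= -/S; set v := w t.+2.
have v0 : 0 < v by exact: w0.
have Wv : 0 < W + v by lra.
have s0 : 0 < W / (W + v) by rewrite divr_gt0.
have s1 : W / (W + v) < 1 by rewrite ltr_pdivrMr//; lra.
have E : (W + v)^-1 *: (z + v *: y t.+2) =
   (W / (W + v)) *: (W^-1 *: z) + (1 - W / (W + v)) *: y t.+2.
  rewrite scalerA scalerDr scalerA mulrAC divff ?mul1r ?gt_eqF//.
  by congr (_ + _ *: _); field; rewrite gt_eqF.
rewrite E; split=> //.
- exact: edom_conv.
- exact: prodset_conv.
have := realF_conv ez (ey t.+2) s0 s1.
rewrite -(ler_pM2l Wv) => /le_trans; apply.
have -> : (W + v) * (W / (W + v) * realF (W^-1 *: z)
     + (1 - W / (W + v)) * realF (y t.+2))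
   = W * realF (W^-1 *: z) + v * realF (y t.+2) by field; rewrite gt_eqF.
by rewrite lerD2r; exact: h.
Qed.

End Composite.
Arguments realu {R N d} u i z.
Arguments u_gtNy {R N d X f u} cc i z.

(** * Splitting along the drawn blocks *)

Section BlockStep.
Context {R : realType} {N : nat} {d : 'I_N -> nat}.
Implicit Types (x y z : bvec R d) (J : {set 'I_N}).

Lemma padv_split J z : padv J z + padv (~: J) z = z.
Proof.
apply/mxcolP => i; rewrite submxcolD !submxcol_padv inE.
by case: (i \in J); rewrite ?addr0 ?add0r.
Qed.

Lemma dotv_split J z :
  dotv z z = dotv (padv J z) (padv J z) + dotv (padv (~: J) z) (padv (~: J) z).
Proof. by rewrite !dotv_padv2 -dotvDr padv_split. Qed.

Lemma wnorm2_split (W : 'M[R]_(\sum_i d i)) J z : block_diagonal W ->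
  wnorm2 W z = wnorm2 W (padv J z) + wnorm2 W (padv (~: J) z).
Proof.
move=> bW; rewrite !(wnorm2_block _ bW) -big_split/=; apply: eq_bigr => i _.
rewrite !submxcol_padv inE !wnorm2E.
by case: (i \in J); rewrite /= dot0v ?addr0 ?add0r.
Qed.

(** Along a direction z supported on J only the J-part of the gradient counts, and by the Lipschitz
    bound and Cauchy-Schwarz the slope grows by at most s * Lf * |z|^2. *)
Lemma block_descent n (f : bvec R d -> R) (Lf : R) J x z :
  (forall x, differentiable f x) -> block_lipschitz_grad n f Lf -> #|J| = n ->
  padv J z = z -> f (x + z) <= f x + dotv (grad f x) z + Lf / 2 * dotv z z.
Proof.
move=> df lf Jn Jz.
suff : f (x + z) <= f x + dotv (grad f x) z + (Lf * dotv z z) / 2 by lra.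
apply: descent_inequality => // s s0 s1.
rewrite -lerBlDl -dotvBl -{2}Jz dotv_padv subvecB.
apply: le_trans (cauchy_schwarz _ _) _.
have := lf J Jn x (s *: z); rewrite padvZ Jz subvecZ enormZ gtr0_norm// => h.
apply: le_trans (ler_wpM2r (enorm_ge0 _) h) _.
rewrite -[in leRHS]Jz -[in leRHS]dotv_padv2 padv_idem dotv_padv2 dotv_padv -enorm_sqr.
by rewrite le_eqVlt; apply/orP; left; apply/eqP; ring.
Qed.

End BlockStep.

(** Splitting the linearised gap by blocks confines the draw to an indicator: the sum over the drawn
    blocks is theta times the full sum plus the terms with factor 1_(i in J) - theta, which average
    to zero. *)
Definition blockgap (R : realType) (N : nat) (d : 'I_N -> nat)
    (u : forall i : 'I_N, 'cV[R]_(d i) -> \bar R) (g x xs : bvec R d) i : R :=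
  realu u i (submxcol x i) - realu u i (submxcol xs i)
  + dotv (submxcol g i) (submxcol (x - xs) i).
Arguments blockgap {R N d} u g x xs i.

(** * One iteration *)

Section Step.
Context {R : realType} {N : nat} {d : 'I_N -> nat} {m n : nat}.
Variables (A : 'M[R]_(m, \sum_i d i)) (b : 'cV[R]_m).
Variables (X : forall i : 'I_N, set 'cV[R]_(d i)) (f : bvec R d -> R).
Variable u : forall i : 'I_N, 'cV[R]_(d i) -> \bar R.
Arguments u : clear implicits.
Variables (Lf rho : R) (Phat : 'M[R]_(\sum_i d i)).
Hypothesis cc : convex_composite X f u.
Hypothesis lip : block_lipschitz_grad n f Lf.
Hypothesis symP : psd Phat.
Hypothesis bdP : block_diagonal Phat.
Hypothesis geP : loewner_ge Phat (Lf%:M + rho *: (A^T *m A)).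
Hypothesis rho_gt0 : 0 < rho.

Let Q := Phat - rho *: (A^T *m A).
Let theta : R := n%:R / N%:R.

Variables (J : {set 'I_N}) (G x p xs : bvec R d) (lam : 'cV[R]_m) (al : R).
Hypothesis Jn : #|J| = n.
Hypothesis al_gt0 : 0 < al.
Hypothesis ex : edom u x.
Hypothesis Xx : prodset X x.
Hypothesis es : edom u xs.
Hypothesis Xs : prodset X xs.
Hypothesis As : A *m xs = b.
Let r := A *m x - b.
Hypothesis p_off : forall i, i \notin J -> submxcol p i = submxcol x i.
Hypothesis p_min : is_argmin (sub_prodset X J)
  (subproblem A u rho Phat (I := J) G x lam r al) (subvec J p).

Let g := G - A^T *m (lam - rho *: r).
Let B := Phat + (al^-1)%:M.
(** The comparison point of the sub-problem: xs on the drawn blocks, x elsewhere. *)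
Let y := x + padv J (xs - x).

Lemma model_gradientE : g = (G - A^T *m lam) + rho *: (A^T *m r).
Proof. by rewrite /g mulmxBr -scalemxAr opprB addrA addrAC. Qed.

(** Expanding the penalty yields rho / 2 * |A (z - x)|^2, which cancels the - rho A_I^T A_I of the
    proximal matrix. What is left is a linear term with gradient [g], carrying the multiplier lam -
    rho r, and a quadratic term whose matrix [B] is block diagonal. *)
Lemma subproblem_real z : (forall i, i \in J -> u i (submxcol z i) \is a fin_num) ->
  padv J (z - x) = z - x ->
  subproblem A u rho Phat (I := J) G x lam r al (subvec J z) =
  (dotv (subvec J (G - A^T *m lam)) (subvec J x) + rho / 2 * dotv r r
   + (\sum_(i in J) realu u i (submxcol z i) + dotv g (z - x)
      + 2^-1 * wnorm2 B (z - x)))%:E.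
Proof.
move=> uz Jz; rewrite /subproblem.
have -> : sub_u u (subvec J z) = (\sum_(i in J) realu u i (submxcol z i))%:E.
  rewrite -sumEFin [RHS]big_enum_val/= /sub_u; apply: eq_bigr => j _.
  by rewrite submxcol_subvec fineK// uz// enum_valP.
rewrite -!EFinD -subvecB mul_subcols Jz subcols_tr -subvecB; congr _%:E.
rewrite wnorm2DW wnorm2BW wnorm2ZW wnorm2_gram mul_subcols wnorm2_subdiag// Jz.
rewrite wnorm2_scalar.
have -> : dotv (subvec J (z - x)) (subvec J (z - x)) = dotv (z - x) (z - x).
  by rewrite -dotv_padv Jz.
have -> : dotv (subvec J (G - A^T *m lam)) (subvec J z) =
  dotv (subvec J (G - A^T *m lam)) (subvec J x) + dotv (G - A^T *m lam) (z - x).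
  by rewrite -[X in _ + dotv _ X]Jz dotv_padv -dotvDr -subvecD [x + _]addrC subrK.
have -> : dotv g (z - x) = dotv (G - A^T *m lam) (z - x)
    + rho * dotv r (A *m (z - x)).
  by rewrite model_gradientE dotvDl dotvZl -dotv_mulr.
rewrite enorm_sqr /B wnorm2DW wnorm2_scalar; set D := A *m (z - x).
by rewrite (dotvDl D r) !(dotvDr D r) (dotvC r D); lra.
Qed.

Lemma target_block i : submxcol y i = if i \in J then submxcol xs i else submxcol x i.
Proof.
rewrite /y submxcolD submxcol_padv submxcolB.
by case: (i \in J); rewrite ?addr0// addrC subrK.
Qed.

Lemma padv_step : padv J (p - x) = p - x.
Proof.
apply/mxcolP => i; rewrite submxcol_padv submxcolB; case: ifPn => // iJ.
by rewrite p_off// subrr.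
Qed.

Lemma padv_target : padv J (y - x) = y - x.
Proof. by rewrite /y [x + _]addrC addrK padv_idem. Qed.

Lemma target_sub_step : y - p = padv J (xs - p).
Proof.
apply/mxcolP => i; rewrite submxcol_padv !submxcolB target_block.
by case: ifPn => // iJ; rewrite p_off// subrr.
Qed.

Lemma target_edom : edom u y.
Proof. by move=> i; rewrite target_block; case: ifP. Qed.

Lemma target_X : sub_prodset X J (subvec J y).
Proof. by move=> j; rewrite submxcol_subvec target_block enum_valP. Qed.

Lemma step_X : prodset X p.
Proof.
move=> i; have [iJ|iJ] := boolP (i \in J); last by rewrite p_off.
case: p_min => /(_ (enum_rank_in iJ i)) + _.
by rewrite submxcol_subvec enum_rankK_in.
Qed.

(** The sub-problem at p is at most its value at the comparison point, which is finite, so no drawn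
    block can have u_i = +oo. *)
Lemma step_edom : edom u p.
Proof.
move=> i; have [iJ|iJ] := boolP (i \in J); last by rewrite p_off.
case: p_min => _ /(_ _ target_X).
rewrite (subproblem_real (fun i _ => target_edom i) padv_target) => h.
have : (sub_u u (subvec J p) < +oo)%E.
  by move: h; rewrite /subproblem; case: (sub_u _ _) => [c||] //=; rewrite ?ltry ?ltNyr.
have jN (j : 'I_#|J|) : predT j -> u (enum_val j) (submxcol (subvec J p) j) != -oo%E.
  by move=> _; exact: (u_gtNy cc).
move=> /(sum_u_fin jN) /(_ (enum_rank_in iJ i) isT).
by rewrite submxcol_subvec enum_rankK_in.
Qed.

Lemma prox_step :
  \sum_(i in J) realu u i (submxcol p i) + dotv g (p - x) + 2^-1 * wnorm2 B (p - x)
    + 2^-1 * wnorm2 B (y - p)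
  <= \sum_(i in J) realu u i (submxcol xs i) + dotv g (y - x)
    + 2^-1 * wnorm2 B (y - x).
Proof.
have -> : \sum_(i in J) realu u i (submxcol xs i)
    = \sum_(i in J) realu u i (submxcol y i).
  by apply: eq_bigr => i iJ; rewrite target_block iJ.
apply: (@three_point _ _ (fun z => \sum_(i in J) realu u i (submxcol z i))).
- by rewrite /B linearD /= tr_scalar_mx; case: symP => ->.
- move=> s s0 s1; rewrite !mulr_sumr -big_split/=; apply: ler_sum => i iJ.
  exact: (realu_conv cc i target_edom step_edom).
move=> s s0 s1; set z := s *: y + (1 - s) *: p.
have ez : edom u z by exact: (edom_conv cc target_edom step_edom s0 s1).
have zx : padv J (z - x) = z - x.
  have -> : z - x = s *: (y - x) + (1 - s) *: (p - x).
    by apply/colP => i; rewrite !mxE; ring.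
  by rewrite padvD !padvZ padv_target padv_step.
have Xz : sub_prodset X J (subvec J z).
  move=> j; rewrite submxcol_subvec /z submxcolD !submxcolZ.
  case: (cc) => /(_ (enum_val j)) [_ cX] _ _ _; apply: convex_setE => //.
    by rewrite -submxcol_subvec; exact: target_X.
  exact: step_X.
case: p_min => _ /(_ _ Xz).
rewrite (subproblem_real (fun i _ => ez i) zx).
by rewrite (subproblem_real (fun i _ => step_edom i) padv_step) lee_fin lerD2l.
Qed.

Let delta := G - grad f x.

Lemma step_descent :
  realF f u p - realF f u xs - (1 - theta) * (realF f u x - realF f u xs)
  + (\sum_i ((i \in J)%:R - theta) * blockgap u g x xs i
     + theta * dotv delta (x - xs))
  - dotv lam (A *m p - b) + (1 - theta) * dotv lam r
  + rho * dotv (A *m p - b) (A *m p - b) - (1 - theta) * rho * dotv r r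
  + 2^-1 * (wnorm2 Q (p - xs) - wnorm2 Q (x - xs))
  + (2 * al)^-1 * (dotv (p - xs) (p - xs) - dotv (x - xs) (x - xs))
  - al / 2 * dotv delta delta <= 0.
Proof.
have [_ df cf _] := cc.
have theta0 : 0 <= theta by rewrite divr_ge0.
set r' := A *m p - b.
have E1 := prox_step.
have E2 := block_descent x df lip Jn padv_step; rewrite [x + _]addrC subrK in E2.
have E3 : \sum_i realu u i (submxcol p i) - \sum_i realu u i (submxcol x i) =
    \sum_(i in J) realu u i (submxcol p i) - \sum_(i in J) realu u i (submxcol x i).
  rewrite -!sumrB [RHS]big_mkcond/=; apply: eq_bigr => i _.
  by case: ifPn => // iJ; rewrite p_off// subrr.
(* This margin absorbs Lf / 2 * |p - x|^2 from the descent lemma and rho / 2 * |r' - r|^2 left over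
   when the residual terms are collected. *)
have [_ geP'] := geP; have E4 := geP' (p - x).
rewrite wnorm2BW wnorm2DW wnorm2_scalar wnorm2ZW wnorm2_gram in E4.
have E5 := gradient_inequality x xs df cf.
(* The step p - x depends on the noise, so their product is not centered. It is paid for by the
   proximal term |p - x|^2 / (2 * al), leaving al / 2 * |delta|^2. *)
have E6 := young_dotv (- delta) (p - x) al_gt0.
rewrite !dotvNl dotvNr opprK in E6.
have Ap : A *m (p - x) = r' - r by rewrite mulmxBr /r' /r; apply/colP => i; rewrite !mxE; ring.
have Axs : A *m (x - xs) = r by rewrite mulmxBr As.
have Aps : A *m (p - xs) = r' by rewrite mulmxBr As.
have gp : dotv g (p - x) = dotv G (p - x) - dotv lam (r' - r)
    + rho * dotv r (r' - r).
  by rewrite model_gradientE dotvDl dotvBl dotvZl -!dotv_mulr Ap.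
have gx : dotv g (x - xs) = dotv G (x - xs) - dotv lam r + rho * dotv r r.
  by rewrite model_gradientE dotvDl dotvBl dotvZl -!dotv_mulr Axs.
have Sa : \sum_i blockgap u g x xs i = \sum_i realu u i (submxcol x i)
    - \sum_i realu u i (submxcol xs i) + dotv g (x - xs).
  by rewrite dotv_blocks -sumrB -big_split; apply: eq_bigr.
have SI : \sum_(i in J) blockgap u g x xs i =
    \sum_(i in J) realu u i (submxcol x i)
    - \sum_(i in J) realu u i (submxcol xs i) - dotv g (y - x).
  rewrite -padv_target dotv_padv dotv_subvec -sumrB -sumrB; apply: eq_bigr => i iJ.
  by rewrite /blockgap !submxcolB target_block iJ -dotvNr opprB.
have SM : \sum_i ((i \in J)%:R - theta) * blockgap u g x xs i =
    \sum_(i in J) blockgap u g x xs i - theta * \sum_i blockgap u g x xs i.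
  rewrite mulr_sumr [X in X - _]big_mkcond -sumrB; apply: eq_bigr => i _.
  by case: (i \in J); rewrite /= ?mulr1n ?mulr0n; ring.
have wB z : wnorm2 B z = wnorm2 Q z + rho * dotv (A *m z) (A *m z) + al^-1 * dotv z z.
  by rewrite /B /Q wnorm2DW wnorm2_scalar wnorm2BW wnorm2ZW wnorm2_gram; ring.
(* Since p and x agree outside J and [B] is block diagonal, the contributions outside J cancel, and
   the comparison point, which varies with the draw, can be replaced by xs. *)
have E7 : wnorm2 B (y - p) - wnorm2 B (y - x)
    = wnorm2 B (xs - p) - wnorm2 B (xs - x).
  have E8 : padv (~: J) (xs - p) = padv (~: J) (xs - x).
    apply/mxcolP => i; rewrite !submxcol_padv inE !submxcolB.
    by case: ifP => //= iJ; rewrite p_off.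
  rewrite target_sub_step -padv_target /y [x + _]addrC addrK padv_idem.
  rewrite /B !wnorm2DW !wnorm2_scalar (wnorm2_split J (xs - p) bdP).
  rewrite (wnorm2_split J (xs - x) bdP) (dotv_split J (xs - p)).
  by rewrite (dotv_split J (xs - x)) E8; ring.
have wN (W : 'M[R]_(\sum_i d i)) z z' : wnorm2 W (z - z') = wnorm2 W (z' - z).
  by rewrite -opprB -scaleN1r wnorm2Z sqrrN expr1n mul1r.
have wBp : wnorm2 B (p - x) = wnorm2 Phat (p - x) + al^-1 * dotv (p - x) (p - x).
  by rewrite /B wnorm2DW wnorm2_scalar.
rewrite (wN _ xs p) (wN _ xs x) (wB (p - xs)) (wB (x - xs)) Axs Aps in E7.
rewrite wBp gp in E1; rewrite Ap (dotvBl r' r) !(dotvBr r' r) (dotvC r' r) in E4.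
have dG : dotv G (p - x) = dotv delta (p - x) + dotv (grad f x) (p - x).
  by rewrite -dotvDl /delta subrK.
have dGs : dotv G (x - xs) = dotv delta (x - xs) + dotv (grad f x) (x - xs).
  by rewrite -dotvDl /delta subrK.
have E5' : f x - f xs <= dotv (grad f x) (x - xs).
  by rewrite -[x - xs]opprB dotvNr; lra.
have Sge : realF f u x - realF f u xs + dotv delta (x - xs) - dotv lam r
    + rho * dotv r r <= \sum_i blockgap u g x xs i.
  by rewrite Sa gx dGs /realF; lra.
have tS := ler_wpM2l theta0 Sge.
rewrite SM SI.
have ial : (2 * al)^-1 = al^-1 / 2 by rewrite invfM mulrC.
rewrite ial in E6 *; rewrite !(dotvBr r' r) dG in E1.
have F3 : realF f u p = realF f u x + f p - f x
    + \sum_(i in J) realu u i (submxcol p i) - \sum_(i in J) realu u i (submxcol x i).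
  by rewrite /realF; lra.
rewrite F3.
lra.
Qed.

End Step.

(** * A quadratic potential for the multipliers *)

Section DualPotential.
Context {R : realType}.

(** Discriminant criterion: multiply by a and complete the square; when a = 0 the condition forces q
    = 0. *)
Lemma quad_form_ge0 m (a c q : R) (e v : 'cV[R]_m) : 0 <= a -> 0 <= c ->
  q ^+ 2 <= a * c -> 0 <= a * dotv v v + 2 * q * dotv e v + c * dotv e e.
Proof.
move=> a0 c0 qac; have [az|an] := eqVneq a 0.
  have q0 : q = 0.
    by apply/eqP; rewrite -sqrf_eq0 eq_le sqr_ge0 andbT (le_trans qac)// az mul0r.
  by rewrite az q0 mul0r mulr0 mul0r !add0r mulr_ge0// dotv_ge0.
have a1 : 0 < a by rewrite lt_neqAle eq_sym an.
rewrite -(pmulr_rge0 _ a1); have := dotv_ge0 (a *: v + q *: e).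
rewrite !(dotvDl, dotvDr, dotvZl, dotvZr) (dotvC v e).
have := ler_wpM2r (dotv_ge0 e) qac; rewrite expr2; lra.
Qed.

(* Telescoping of the potential a_k |nu_k|^2 + 2 hh_k <e, nu_k>; hh is a
   smoothed version of the coefficients h. *)
Lemma dual_potential m (nu : nat -> 'cV[R]_m) (e : 'cV[R]_m)
    (a h hh c1 c2 : nat -> R) T :
  (forall k, (k < T)%N -> [/\ 0 <= a k, a k.+1 <= a k, 0 <= c1 k & 0 <= c2 k]) ->
  (forall k, (k < T)%N -> (h k - hh k) ^+ 2 <= a k * c1 k) ->
  (forall k, (k < T)%N -> (hh k - hh k.+1) ^+ 2 <= (a k - a k.+1) * c2 k) ->
  a T * dotv (nu T) (nu T) + 2 * hh T * dotv e (nu T)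
  - (a 0%N * dotv (nu 0%N) (nu 0%N) + 2 * hh 0%N * dotv e (nu 0%N))
  - (\sum_(k < T) (c1 k + c2 k)) * dotv e e
  <= \sum_(k < T) (a k * (dotv (nu k.+1) (nu k.+1) - dotv (nu k) (nu k)
       + dotv (nu k.+1 - nu k) (nu k.+1 - nu k))
       + 2 * h k * dotv e (nu k.+1 - nu k)).
Proof.
elim: T => [|T IH] H1 H2 H3; first by rewrite !big_ord0; lra.
rewrite !big_ord_recr/=.
have {}IH := IH (fun k kT => H1 k (ltnW kT)) (fun k kT => H2 k (ltnW kT))
  (fun k kT => H3 k (ltnW kT)).
have [a0 aa c10 c20] := H1 T (ltnSn T).
(* [Q1] pays, at cost c1, for replacing h by hh in front of the increment of nu. [Q2] pays, at cost
   c2, for the change of the coefficients of the potential between two indices. *)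
have Q1 := quad_form_ge0 e (nu T.+1 - nu T) a0 c10 (H2 T (ltnSn T)).
have aa' : 0 <= a T - a T.+1 by rewrite subr_ge0.
have Q2 := quad_form_ge0 e (nu T.+1) aa' c20 (H3 T (ltnSn T)).
have Ee : dotv e (nu T.+1 - nu T) = dotv e (nu T.+1) - dotv e (nu T) by rewrite dotvBr.
rewrite Ee in Q1 *; lra.
Qed.

(** This is a_k * w_k / beta_k, where w_k is the averaging weight of index k + 1 and beta_k the
    weight of the multiplier step. As a_k times the increment of nu equals - beta_k * rho * r_(k+1),
    it is the factor turning w_k * <e, r_(k+1)> into a product of e with that increment, up to -
    rho. At k = t both weights lose their correction and a_(t+1) remains. *)
Definition dualcoef (theta : R) (a : nat -> R) t k : R :=
  if (k < t)%N then theta * a k * a k.+1 / (a k - (1 - theta) * a k.+1) else a k.+1.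

Definition totalweight (theta : R) (a : nat -> R) t : R :=
  a t.+1 + theta * \sum_(1 <= k < t.+1) a k.

(** The potential is switched off after index t, so that no terminal term survives; the whole of a_t
    then serves as slack for the last coefficient. *)
Definition cutoff (a : nat -> R) t k : R := if (k <= t)%N then a k else 0.

(** The two inequalities are the discriminant conditions of [dual_potential]. S is a budget, in
    units of a 0, that must cover both the initial coefficient and the total cost. *)
Definition admissible (theta : R) (a : nat -> R) t (S : R) :=
  exists hh c1 c2 : nat -> R,
  [/\ forall k, (k <= t)%N -> [/\ 0 <= c1 k, 0 <= c2 k,
        (dualcoef theta a t k - hh k) ^+ 2 <= a k * c1 k &
        (hh k - hh k.+1) ^+ 2 <= (a k - cutoff a t k.+1) * c2 k],
      hh t.+1 = 0, 0 <= hh 0%N <= S * a 0%N,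
      \sum_(k < t.+1) (c1 k + c2 k) <= S * a 0%N & 1 <= S].

(** The potential vanishes at t + 1, so only its initial value and the cost remain. Their three
    parts, in |nu_0|^2, |e| |nu_0| and |e|^2, are each bounded by the matching part of the
    square. *)
Lemma dual_bound m (nu : nat -> 'cV[R]_m) (e : 'cV[R]_m) theta a t S :
  (forall k, 0 < a k) -> (forall k, (k <= t)%N -> a k.+1 <= a k) ->
  admissible theta a t S ->
  - (S * a 0%N * (enorm (nu 0%N) + enorm e) ^+ 2)
  <= \sum_(k < t.+1) (a k * (dotv (nu k.+1) (nu k.+1) - dotv (nu k) (nu k)
       + dotv (nu k.+1 - nu k) (nu k.+1 - nu k))
       + 2 * dualcoef theta a t k * dotv e (nu k.+1 - nu k)).
Proof.
move=> a0 aa [hh [c1 [c2 [H hT /andP[hh0 hhS] cS S1]]]].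
pose a' := cutoff a t.
have a'E k : (k <= t)%N -> a' k = a k by rewrite /a' /cutoff => ->.
have P := @dual_potential m nu e a' (dualcoef theta a t) hh c1 c2 t.+1.
have -> : \sum_(k < t.+1) (a k * (dotv (nu k.+1) (nu k.+1) - dotv (nu k) (nu k)
       + dotv (nu k.+1 - nu k) (nu k.+1 - nu k))
       + 2 * dualcoef theta a t k * dotv e (nu k.+1 - nu k)) =
  \sum_(k < t.+1) (a' k * (dotv (nu k.+1) (nu k.+1) - dotv (nu k) (nu k)
       + dotv (nu k.+1 - nu k) (nu k.+1 - nu k))
       + 2 * dualcoef theta a t k * dotv e (nu k.+1 - nu k)).
  by apply: eq_bigr => k _; rewrite a'E// -ltnS.
apply: le_trans (P _ _ _).
- rewrite hT (a'E 0%N)// {1}/a' /cutoff ltnn !mul0r mulr0 mul0r.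
  have CS : - dotv e (nu 0%N) >= - (enorm e * enorm (nu 0%N)).
    by rewrite lerN2 cauchy_schwarz.
  have en := enorm_ge0 e; have nn := enorm_ge0 (nu 0%N).
  rewrite -!enorm_sqr; set E := enorm e in en CS *.
  set n0 := enorm _ in nn CS *.
  have h1 : (\sum_(k < t.+1) (c1 k + c2 k)) * E ^+ 2 <= S * a 0%N * E ^+ 2.
    by rewrite ler_wpM2r ?sqr_ge0.
  have h2 : a 0%N * n0 ^+ 2 <= S * a 0%N * n0 ^+ 2.
    apply: ler_wpM2r; first exact: sqr_ge0.
    by apply: ler_peMl => //; exact: ltW.
  have h3 : hh 0%N * dotv e (nu 0%N) <= hh 0%N * (E * n0).
    by rewrite ler_wpM2l// -lerN2.
  have h4 : hh 0%N * (E * n0) <= S * a 0%N * (E * n0).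
    by rewrite ler_wpM2r// mulr_ge0.
  have -> : (n0 + E) ^+ 2 = n0 ^+ 2 + 2 * (E * n0) + E ^+ 2 by ring.
  lra.
- move=> k; rewrite ltnS => kt; have [c10 c20 _ _] := H k kt.
  split=> //; first by rewrite a'E//; exact: ltW.
  rewrite (a'E k kt) /a' /cutoff; case: (k.+1 <= t)%N; first exact: aa.
  exact: ltW.
- by move=> k; rewrite ltnS => kt; have [_ _ + _] := H k kt; rewrite a'E.
- by move=> k; rewrite ltnS => kt; have [_ _ _ +] := H k kt; rewrite a'E.
Qed.

(** Coefficients and costs are homogeneous of degree one in the step sizes, so schedules need only
    be treated with a 0 = 1. *)
Lemma admissible_scale theta a t S al : 0 < al -> admissible theta a t S ->
  admissible theta (fun k => al * a k) t S.
Proof.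
move=> al0 [hh [c1 [c2 [H hT hh0 cS S1]]]].
have E k : dualcoef theta (fun k => al * a k) t k = al * dualcoef theta a t k.
  rewrite /dualcoef; case: ifP => // _.
  have -> : al * a k - (1 - theta) * (al * a k.+1)
     = al * (a k - (1 - theta) * a k.+1) by ring.
  rewrite invfM.
  have -> : theta * (al * a k) * (al * a k.+1) *
      (al^-1 * (a k - (1 - theta) * a k.+1)^-1) = (al * al^-1) * (al *
      (theta * a k * a k.+1 / (a k - (1 - theta) * a k.+1))) by ring.
  by rewrite divff ?gt_eqF// mul1r.
have Ec k : cutoff (fun k => al * a k) t k = al * cutoff a t k.
  by rewrite /cutoff; case: ifP => // _; rewrite mulr0.
exists (fun k => al * hh k), (fun k => al * c1 k), (fun k => al * c2 k); split=> //.
- move=> k kt; have [c10 c20 h1 h2] := H k kt.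
  split; try by rewrite mulr_ge0// ltW.
    rewrite E -mulrBr exprMn; have := ler_wpM2l (sqr_ge0 al) h1; rewrite expr2; lra.
  rewrite Ec -mulrBr -mulrBr exprMn; have := ler_wpM2l (sqr_ge0 al) h2.
  rewrite expr2; lra.
- by rewrite hT mulr0.
- by case/andP: hh0 => p1 p2; rewrite mulr_ge0 ?(ltW al0)//= mulrCA (ler_pM2l al0).
- under eq_bigr do rewrite -mulrDr.
  by rewrite -mulr_sumr mulrCA (ler_pM2l al0).
Qed.

End DualPotential.

(** * Constant steps, and the variation of the dual coefficient *)

Section Schedules.
Context {R : realType}.

Lemma sqrt_nat_gt0 k : (0 < k)%N -> 0 < Num.sqrt k%:R :> R.
Proof. by move=> k0; rewrite sqrtr_gt0 ltr0n. Qed.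

Lemma sqrt_nat_sqr k : Num.sqrt k%:R ^+ 2 = k%:R :> R.
Proof. by rewrite sqr_sqrtr. Qed.

(** From index 1 to t the dual coefficient is constantly v = 1 / sqrt t, so hh is v throughout. The
    costs are v^2 at index 0, where the coefficient lies between 0 and v, and v at index t, where
    the potential is switched off. Their sum fits in S = 1 + v^2 / theta. *)
Lemma admissible_const theta (a : nat -> R) t : 0 < theta <= 1 -> (1 <= t)%N ->
  a 0%N = 1 -> (forall k, (1 <= k)%N -> a k = (Num.sqrt t%:R)^-1) ->
  admissible theta a t (totalweight theta a t / (theta * Num.sqrt t%:R)).
Proof.
move=> /andP[th0 th1] t1 a0 ak; set s := Num.sqrt t%:R in ak *.
have s0 : 0 < s by exact: sqrt_nat_gt0.
have s2 : s ^+ 2 = t%:R by exact: sqrt_nat_sqr.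
have s1 : 1 <= s by rewrite -(@sqrtr1 R) ler_wsqrtr// ler1n.
set v := s^-1 in ak.
have v0 : 0 < v by rewrite invr_gt0.
have v1 : v <= 1 by rewrite invf_le1.
have vs : v * s = 1 by rewrite mulVf ?gt_eqF.
have -> : totalweight theta a t / (theta * s) = 1 + v ^+ 2 / theta.
  rewrite /totalweight ak// (eq_big_nat _ _ (F2 := fun=> v)); last first.
    by move=> k /andP[k1 _]; rewrite ak.
  rewrite sumr_const_nat subn1 /= -mulr_natr -s2 /v; field.
  by rewrite !gt_eqF.
have v2 : 0 <= v ^+ 2 / theta by rewrite divr_ge0 ?sqr_ge0// ltW.
have h0 : dualcoef theta a t 0%N = theta / (s - (1 - theta)).
  rewrite /dualcoef t1 a0 ak// /v; field.
  by rewrite !gt_eqF//=; nra.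
have h0b : (theta / (s - (1 - theta)) - v) ^+ 2 <= v ^+ 2.
  have D : 0 < s - (1 - theta) by lra.
  have hg : 0 <= theta / (s - (1 - theta)) by rewrite divr_ge0 ?ltW.
  have hv : theta / (s - (1 - theta)) <= v.
    by rewrite ler_pdivrMr// /v ler_pdivlMl//; nra.
  nra.
have hk k : (0 < k <= t)%N -> dualcoef theta a t k = v.
  move=> /andP[k1 kt]; rewrite /dualcoef; case: ifP => _; rewrite !ak//.
  have -> : v - (1 - theta) * v = theta * v by ring.
  by field; rewrite !gt_eqF.
exists (fun k => if (k <= t)%N then v else 0),
  (fun k => if k == 0%N then v ^+ 2 else 0), (fun k => if k == t then v else 0).
split.
- move=> k kt; rewrite kt; split.
  + by case: ifP => // _; exact: sqr_ge0.
  + by case: ifP => // _; exact: ltW.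
  + case: eqP => [->|/eqP kn]; first by rewrite h0 a0 mul1r.
    by rewrite hk ?lt0n ?kn// subrr expr0n/= mulr0.
  + rewrite /cutoff; case: ltngtP kt => // [kt _|-> _].
      by rewrite subrr expr0n/= mulr0.
    by rewrite ?ltnn ?eqxx /= !subr0 ak.
- by rewrite /= ltnn.
- by rewrite leq0n a0 mulr1; apply/andP; split; lra.
- rewrite a0 mulr1 big_split/= big_ord_recl/= big1 ?addr0 => [|i _//].
  rewrite big_ord_recr/= eqxx big1 ?add0r => [|i _]; last by rewrite ltn_eqF.
  have : v ^+ 2 <= v ^+ 2 / theta by rewrite ler_pdivlMr// ler_piMr// sqr_ge0.
  lra.
- lra.
Qed.

(* [theta / (y - (1 - theta) * x)] is the dual coefficient when the two
   surrounding step sizes are [1 / x] and [1 / y]; it varies less than the step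
   size itself, except at the very first indices. *)
Lemma dualcoef_variation theta (x y z : R) : 0 < theta <= 1 ->
  1 <= x -> x < y -> y < z -> z <= 2 * y ->
  y ^+ 2 = x ^+ 2 + 1 -> z ^+ 2 = y ^+ 2 + 1 ->
  (theta / (y - (1 - theta) * x) - theta / (z - (1 - theta) * y)) ^+ 2
  <= (y^-1 - z^-1) ^+ 2.
Proof.
move=> /andP[th0 th1] x1 xy yz z2 E1 E2.
set p := y - x; set q := z - y.
have p0 : 0 < p by rewrite /p subr_gt0.
have q0 : 0 < q by rewrite /q subr_gt0.
have y0 : 0 < y by lra.
have z0 : 0 < z by lra.
have pE : p * (x + y) = 1.
  have -> : p * (x + y) = y ^+ 2 - x ^+ 2 by rewrite /p; ring.
  rewrite E1; ring.
have qE : q * (y + z) = 1.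
  have -> : q * (y + z) = z ^+ 2 - y ^+ 2 by rewrite /q; ring.
  rewrite E2; ring.
have qp : q <= p by nra.
set eta := 1 - theta.
have eta0 : 0 <= eta by rewrite /eta; lra.
set A := y - eta * x; set B := z - eta * y.
have AE : A = theta * y + eta * p by rewrite /A /p /eta; ring.
have BE : B = theta * z + eta * q by rewrite /B /q /eta; ring.
have ep : 0 <= eta * p by rewrite mulr_ge0// ltW.
have eq0 : 0 <= eta * q by rewrite mulr_ge0// ltW.
have ty : 0 < theta * y by rewrite mulr_gt0.
have tz : 0 < theta * z by rewrite mulr_gt0.
have A0 : 0 < A by rewrite AE; lra.
have B0 : 0 < B by rewrite BE; lra.
have -> : theta / A - theta / B = theta * (q - eta * p) / (A * B).
  have -> : q - eta * p = B - A by rewrite /A /B /p /q; ring.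
  by field; rewrite !gt_eqF.
have -> : y^-1 - z^-1 = q / (y * z) by rewrite /q; field; rewrite !gt_eqF.
(* Only eta^2 * p * q is dropped; the cross term is kept because the lower bound [lo] consumes it
   through [key]. *)
have AB : theta ^+ 2 * (y * z) + theta * eta * (y * q + z * p) <= A * B.
  rewrite AE BE; nra.
have yz0 : 0 < y * z by rewrite mulr_gt0.
have AB0 : 0 < A * B by rewrite mulr_gt0.
have up : theta * (q - eta * p) * (y * z) <= q * (A * B).
  have h1 : theta * (q - eta * p) <= theta ^+ 2 * q.
    have : eta * q <= eta * p by rewrite ler_wpM2l.
    rewrite /eta; nra.
  have h2 : theta * (q - eta * p) * (y * z) <= theta ^+ 2 * q * (y * z).
    by rewrite ler_pM2r.
  have h3 : 0 <= theta * eta * (y * q + z * p).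
    by rewrite !mulr_ge0// ?addr_ge0// ?mulr_ge0// ltW.
  have h4 : q * (theta ^+ 2 * (y * z)) <= q * (A * B) by rewrite ler_pM2l//; lra.
  lra.
have key : (p - q) * (y * z) <= q * (y * q + z * p).
  (* Since p * (x + y) = q * (y + z) = 1, one has p = p q (y + z) and q = p q (x + y); subtract. *)
  have e1 : (p - q) = p * q * (p + q).
    have : p * (x + y) * q = q by rewrite pE mul1r.
    have : q * (y + z) * p = p by rewrite qE mul1r.
    have -> : y + z = x + y + (p + q) by rewrite /p /q; ring.
    lra.
  have ph : p <= 2^-1 by nra.
  have e2 : p * (x + y) = 1 := pE.
  have h : p * ((p + q) * y * z) <= y * q + z * p.
    have py : p * y = (1 + p ^+ 2) / 2.
      have -> : p ^+ 2 = p * (y - x) by rewrite /p; ring.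
      by lra.
    have -> : p * ((p + q) * y * z) = (p * y) * ((p + q) * z) by ring.
    rewrite py.
    have p2 : p ^+ 2 <= 4^-1 by nra.
    have h1 : p ^+ 2 * z <= y.
      have : p ^+ 2 * z <= 4^-1 * z by rewrite ler_wpM2r// ltW.
      lra.
    have h2 : q * (p ^+ 2 * z) <= q * y by rewrite ler_pM2l.
    have h3 : 0 <= (1 - p ^+ 2) * z * (p - q).
      by rewrite !mulr_ge0 ?subr_ge0 ?(ltW z0)//; lra.
    lra.
  rewrite e1; have := ler_wpM2l (ltW q0) h; lra.
have lo : - (theta * (q - eta * p) * (y * z)) <= q * (A * B).
  have h1 : theta * eta * ((p - q) * (y * z)) <= theta * eta * (q * (y * q + z * p)).
    by rewrite ler_wpM2l// mulr_ge0// ltW.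
  have h2 : q * (theta ^+ 2 * (y * z) + theta * eta * (y * q + z * p)) <= q * (A * B).
    by rewrite ler_pM2l.
  have h3 : 0 <= theta ^+ 2 * q * (y * z).
    by rewrite !mulr_ge0// ?sqr_ge0// ltW.
  have h4 : - (theta * (q - eta * p) * (y * z)) = theta * eta * ((p - q) * (y * z))
     - theta ^+ 2 * q * (y * z) by rewrite /eta; ring.
  rewrite h4; lra.
have : `|theta * (q - eta * p) / (A * B)| <= q / (y * z).
  rewrite ler_norml lerNl -mulNr; apply/andP; split.
    by rewrite ler_pdivlMr// mulrAC ler_pdivrMr// mulNr.
  by rewrite ler_pdivlMr// mulrAC ler_pdivrMr.
move=> h; rewrite -(@real_normK _ (_ / (A * B))) ?num_real//.
by rewrite ler_pXn2r// nnegrE ?normr_ge0// (le_trans _ h).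
Qed.

End Schedules.

(** * Steps decreasing as the inverse square root *)

Section SqrtSchedule.
Context {R : realType}.
Let s k : R := Num.sqrt k%:R.

Lemma sqrt_natS k : s k.+1 ^+ 2 = s k ^+ 2 + 1.
Proof. by rewrite /s !sqrt_nat_sqr -natr1. Qed.

Lemma sqrt_nat_lt k : s k < s k.+1.
Proof. by rewrite ltr_sqrt ?ltr0n// ltr_nat. Qed.

Lemma sqrt_nat_le j k : (j <= k)%N -> s j <= s k.
Proof. by move=> jk; rewrite ler_wsqrtr// ler_nat. Qed.

Lemma sqrt_nat_ge1 k : (0 < k)%N -> 1 <= s k.
Proof. by move=> k0; rewrite -(@sqrtr1 R) ler_wsqrtr// ler1n. Qed.

(** Telescoping of 2 * (sqrt (k + 1) - sqrt k) <= 1 / sqrt k. *)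
Lemma sum_inv_sqrt_ge t :
  2 * s t.+1 - 2 <= \sum_(1 <= k < t.+1) (s k)^-1.
Proof.
elim: t => [|t IH]; first by rewrite big_geq// /s sqrtr1; lra.
rewrite big_nat_recr//=.
suff : 2 * s t.+2 - 2 * s t.+1 <= (s t.+1)^-1 by lra.
have x0 : 0 < s t.+1 by exact: sqrt_nat_gt0.
have := sqrt_nat_lt t.+1; have := sqrt_natS t.+1.
move: (s t.+1) (s t.+2) x0 => x y x0 E xy.
by rewrite -div1r ler_pdivlMr//; nra.
Qed.

(** Here x, y, z stand for sqrt 2, sqrt t, sqrt (t + 1), and h is the dual coefficient at index 1. A
    small theta brings 1 - h close to 1 but also enlarges the budget S, hence the comparison over
    three ranges of theta. *)
Lemma sqrt_schedule_numeric (theta x y z h S : R) : 0 < theta <= 1 ->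
  0 < x -> x ^+ 2 = 2 -> x <= y -> y < z -> z ^+ 2 = y ^+ 2 + 1 ->
  h = theta / (x - (1 - theta)) ->
  (z^-1 + theta * (2 * z - 2)) / (theta * y) <= S ->
  (1 - h) ^+ 2 + x^-1 + (y^-1 - z^-1) <= S.
Proof.
move=> /andP[th0 th1] x0 x2 xy yz z2 hE; apply: le_trans.
have xl : 7 / 5 <= x by nra.
have xu : x <= 17 / 12 by nra.
have y0 : 0 < y by lra.
have z0 : 0 < z by lra.
have y2 : 2 <= y ^+ 2 by rewrite -x2 ler_pXn2r// nnegrE ltW.
have zl : 12 / 7 <= z by nra.
have g1 : x^-1 <= 5 / 7 by rewrite -div1r ler_pdivrMr//; lra.
have yz0 : 0 < y * z by rewrite mulr_gt0.
have d1 : (z - y) * (y + z) = 1.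
  have -> : (z - y) * (y + z) = z ^+ 2 - y ^+ 2 by ring.
  by rewrite z2; ring.
have g2 : y^-1 - z^-1 <= 1 / 7.
  have -> : y^-1 - z^-1 = (z - y) / (y * z) by field; rewrite !gt_eqF.
  rewrite ler_pdivrMr//.
  have : 12 / 5 <= y * z by nra.
  have : 3 <= y + z by lra.
  nra.
set v := y^-1 in g2 *.
have v0 : 0 < v by rewrite invr_gt0.
have vy : v * y = 1 by rewrite mulVf// gt_eqF.
set K := 1 + theta^-1.
have K0 : 0 < K by rewrite addr_gt0// invr_gt0.
have g3 : 2 - 2 * v + 4 / 5 * K * v ^+ 2
    <= (z^-1 + theta * (2 * z - 2)) / (theta * y).
  have -> : (z^-1 + theta * (2 * z - 2)) / (theta * y)
     = theta^-1 * (z^-1 * v) + (2 * z - 2) * v.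
    by rewrite /v; field; rewrite !gt_eqF.
  have w1 : 4 / 5 * v ^+ 2 <= z^-1 * v.
    have zy : z * (4 / 5) <= y by nra.
    rewrite expr2 mulrA ler_pM2r// -[z^-1]div1r ler_pdivlMr//.
    have := ler_wpM2l (ltW v0) zy; rewrite vy; lra.
  have w2 : 2 + z^-1 * v <= 2 * z * v.
    have : 2 * y + z^-1 <= 2 * z.
      have : z * z^-1 = 1 by rewrite divff// gt_eqF.
      have : 0 < z^-1 by rewrite invr_gt0.
      nra.
    have -> : 2 + z^-1 * v = (2 * y + z^-1) * v by rewrite mulrDl -mulrA [y * v]mulrC vy mulr1.
    by rewrite ler_pM2r.
  have w3 := ler_wpM2l (ltW (_ : 0 < theta^-1)) w1.
  have {}w3 : theta^-1 * (4 / 5 * v ^+ 2) <= theta^-1 * (z^-1 * v).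
    by apply: w3; rewrite invr_gt0.
  by rewrite /K; lra.
apply: le_trans g3.
(* The minimum over v of the quadratic, attained at v = 5 / (4 * K). *)
have g4 : 2 - 5 / (4 * K) <= 2 - 2 * v + 4 / 5 * K * v ^+ 2.
  have : 0 <= 4 / 5 * K * (v - 5 / (4 * K)) ^+ 2.
    by rewrite mulr_ge0 ?sqr_ge0// mulr_ge0// ltW.
  have -> : 4 / 5 * K * (v - 5 / (4 * K)) ^+ 2
     = 4 / 5 * K * v ^+ 2 - 2 * v + 5 / (4 * K) by field; rewrite gt_eqF.
  lra.
apply: le_trans g4.
have D0 : 0 < x - (1 - theta) by lra.
have h1E : 1 - h = (x - 1) / (x - (1 - theta)) by rewrite hE; field; rewrite gt_eqF.
have h0 : 0 <= 1 - h by rewrite h1E divr_ge0 ?(ltW D0)//; lra.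
have KL c : 0 < c -> c <= K -> 5 / (4 * K) <= 5 / 4 / c.
  move=> c0 cK; rewrite invfM mulrA; apply: ler_wpM2l; first by lra.
  by rewrite lef_pV2 ?posrE.
have sq c : 1 - h <= c -> (1 - h) ^+ 2 <= c ^+ 2.
  by move=> hc; rewrite ler_pXn2r// nnegrE// (le_trans h0).
have ith : theta^-1 * theta = 1 by rewrite mulVf// gt_eqF.
have iv c : theta <= c^-1 -> 0 < c -> c <= theta^-1.
  by move=> tc c0; rewrite -[c]invrK lef_pV2 ?posrE ?invr_gt0.
(* With theta cut at 1/2 and 1/8, the left side is at most c^2 + 5/7 + 1/7 for c = 1/2, 4/5, 1,
   while K is at least 2, 3, 9. *)
have [c1|c1] := lerP (2^-1) theta.
  have hb : 1 - h <= 2^-1 by rewrite h1E ler_pdivrMr//; lra.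
  have K2 : 2 <= K by have := iv 1; rewrite invr1 /K => /(_ th1 ltr01); lra.
  by have := KL 2 ltac:(lra) K2; have := sq _ hb; lra.
have [c2|c2] := lerP (8^-1) theta.
  have hb : 1 - h <= 4 / 5 by rewrite h1E ler_pdivrMr//; lra.
  have K2 : 3 <= K by have := iv 2 (ltW c1) ltac:(lra); rewrite /K; lra.
  by have := KL 3 ltac:(lra) K2; have := sq _ hb; lra.
have hb : 1 - h <= 1 by rewrite h1E ler_pdivrMr//; lra.
have K2 : 9 <= K by have := iv 8 (ltW c2) ltac:(lra); rewrite /K; lra.
by have := KL 9 ltac:(lra) K2; have := sq _ hb; lra.
Qed.

(** The costs at the inner indices telescope to a 2 - a t, and those at index t are at most 2 * a t
    - a t.+1. With (1 - h 1)^2 from index 0 the total is what [sqrt_schedule_numeric] bounds. *)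
Lemma admissible_sqrt theta (a : nat -> R) t : 0 < theta <= 1 -> (2 <= t)%N ->
  a 0%N = 1 -> (forall k, (1 <= k)%N -> a k = (s k)^-1) ->
  admissible theta a t (totalweight theta a t / (theta * s t)).
Proof.
case: t => [|[|t]]// th _ a0 ak; set T := t.+2; set S := _ / _.
have /andP[th0 th1] := th.
have ap k : 0 < a k by case: k => [|k]; rewrite ?a0// ak// invr_gt0 sqrt_nat_gt0.
have adec k : a k.+1 <= a k.
  case: k => [|k]; first by rewrite a0 ak// /s sqrtr1 invr1.
  by rewrite !ak// lef_pV2 ?posrE ?sqrt_nat_gt0// ltW// sqrt_nat_lt.
pose h := dualcoef theta a T.
have h0 : h 0%N = 1.
  by rewrite /h /dualcoef /= a0 ak// /s sqrtr1 invr1 !mulr1 opprB addrC subrK divff// gt_eqF.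
have D k : (0 < k)%N -> 0 < s k.+1 - (1 - theta) * s k.
  move=> k0; have := sqrt_nat_lt k; have := @sqrt_nat_gt0 R k k0; rewrite -/(s k); nra.
have hE k : (0 < k < T)%N -> h k = theta / (s k.+1 - (1 - theta) * s k).
  move=> /andP[k0 kT]; rewrite /h /dualcoef kT !ak//.
  have sk : 0 < s k by exact: sqrt_nat_gt0.
  have sk1 : 0 < s k.+1 by exact: sqrt_nat_gt0.
  have -> : (s k)^-1 - (1 - theta) * (s k.+1)^-1
    = (s k.+1 - (1 - theta) * s k) / (s k * s k.+1) by field; rewrite !gt_eqF.
  by field; rewrite !gt_eqF//; exact: D.
have hb k : (0 < k < T)%N -> 0 <= h k <= a k.+1.
  move=> kT; rewrite hE//; case/andP: kT => k0 _; have Dk := D k k0.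
  apply/andP; split; first by rewrite divr_ge0 ?ltW.
  rewrite ak// ler_pdivrMr// ler_pdivlMl ?sqrt_nat_gt0//.
  have := sqrt_nat_lt k; nra.
have hT : h T = a T.+1 by rewrite /h /dualcoef ltnn.
(* As a 0 = a 1, hh may not move between indices 0 and 1, so it starts at h 1 instead of h 0 = 1. At
   T the coefficient follows another formula; hh keeps its value at T - 1 and then drops to 0, using
   the slack a T. *)
pose hh k := if k == 0%N then h 1%N else if (k < T)%N then h k else
  if k == T then h T.-1 else 0.
pose c1 k := if k == 0%N then (1 - h 1%N) ^+ 2 else
  if k == T then (h T - h T.-1) ^+ 2 / a T else 0.
pose c2 k := if k == T then (h T.-1) ^+ 2 / a T else
  if (0 < k < T.-1)%N then a k.+1 - a k.+2 else 0.
have gam k : (0 < k)%N -> a k.+1 - a k.+2 <= a k - a k.+1.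
  move=> k0; rewrite !ak//.
  have x0 : 0 < s k by exact: sqrt_nat_gt0.
  have := sqrt_nat_lt k; have := sqrt_natS k.
  have := sqrt_nat_lt k.+1; have := sqrt_natS k.+1.
  move: (s k) (s k.+1) (s k.+2) x0 => x y z x0 Ez yz Ey xy.
  have y0 : 0 < y by lra.
  have z0 : 0 < z by lra.
  have -> : y^-1 - z^-1 = (z - y) * (y^-1 * z^-1) by field; rewrite !gt_eqF.
  have -> : x^-1 - y^-1 = (y - x) * (y^-1 * x^-1) by field; rewrite !gt_eqF.
  apply: ler_pM; [lra|by rewrite mulr_ge0 ?invr_ge0 ?ltW|nra|].
  by rewrite ler_pM2l ?invr_gt0// lef_pV2 ?posrE//; lra.
have cost : \sum_(k < T.+1) (c1 k + c2 k) <= S.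
  have e1 : \sum_(k < T.+1) c1 k = (1 - h 1%N) ^+ 2 + (h T - h T.-1) ^+ 2 / a T.
    rewrite big_ord_recl big_ord_recr/= big1 ?add0r; last first.
      by move=> i _; rewrite /c1 /bump /= add1n /T eqSS ltn_eqF.
    by rewrite /c1 /bump /= add1n eqxx.
  have e2 : \sum_(k < T.+1) c2 k = a 2%N - a T + (h T.-1) ^+ 2 / a T.
    have c20 : c2 0%N = 0 by [].
    have c2T : c2 T = (h T.-1) ^+ 2 / a T by rewrite /c2 eqxx.
    have c2T1 : c2 t.+1 = 0 by rewrite /c2 /T /= ltn_eqF//= ltnn.
    have c2k i : (i < t)%N -> c2 i.+1 = a i.+2 - a i.+3.
      move=> it; rewrite /c2 (_ : (i.+1 == T) = false); last by rewrite /T; lia.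
      by rewrite (_ : (0 < i.+1 < T.-1)%N) // /T; lia.
    rewrite big_ord_recr/= big_ord_recr/= big_ord_recl/= c2T c2T1 c20 add0r addr0.
    congr (_ + _).
    suff : forall n, (n <= t)%N -> \sum_(i < n) c2 (bump 0 i) = a 2%N - a n.+2.
      exact.
    elim=> [|n IH] nt; first by rewrite big_ord0 subrr.
    by rewrite big_ord_recr/= IH 1?ltnW// /bump /= add1n c2k//; lra.
  rewrite big_split/= e1 e2.
  have [b0 b1] := andP (hb T.-1 (ltnSn _)).
  have aT := ap T; have aT1 := ap T.+1; have dT := adec T.
  have e3 : (h T - h T.-1) ^+ 2 / a T + h T.-1 ^+ 2 / a T <= a T + (a T - a T.+1).
    rewrite -mulrDl ler_pdivrMr// hT.
    have b2 : h T.-1 <= a T := b1.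
    move: (h T.-1) (a T) (a T.+1) b0 b2 aT aT1 dT => p q w p0 pq q0 w0 wq; nra.
  suff : (1 - h 1%N) ^+ 2 + a 2%N + (a T - a T.+1) <= S by lra.
  rewrite !ak//; apply: (sqrt_schedule_numeric th).
  - exact: sqrt_nat_gt0.
  - exact: sqrt_nat_sqr.
  - exact: sqrt_nat_le.
  - exact: sqrt_nat_lt.
  - exact: sqrt_natS.
  - by rewrite hE// {2}/s sqrtr1 mulr1.
  rewrite /S /totalweight ak// ler_pM2r ?invr_gt0 ?mulr_gt0 ?sqrt_nat_gt0//.
  rewrite lerD2l ler_pM2l//; apply: le_trans (sum_inv_sqrt_ge T) _.
  by rewrite le_eqVlt; apply/orP; left; apply/eqP; apply: eq_big_nat => k /andP[k1 _]; rewrite ak.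
have S1 : 1 <= S.
  have sT : 0 < s T by exact: sqrt_nat_gt0.
  rewrite /S ler_pdivlMr ?mulr_gt0// mul1r /totalweight.
  have : s T <= \sum_(1 <= k < T.+1) a k.
    have -> : s T = \sum_(1 <= k < T.+1) (s T)^-1.
      rewrite sumr_const_nat subn1 /= -mulr_natr -(sqrt_nat_sqr T) -/(s T).
      by rewrite expr2 mulrA mulVf ?mul1r// gt_eqF.
    rewrite big_nat_cond [leRHS]big_nat_cond; apply: ler_sum => k /andP[/andP[k1 kT] _].
    by rewrite ak// lef_pV2 ?posrE ?sqrt_nat_gt0// sqrt_nat_le.
  move=> h1; have := ler_wpM2l (ltW th0) h1; have := ap T.+1; lra.
exists hh, c1, c2; split => //.
- move=> k kT; split.
  + rewrite /c1; case: ifP => _; first exact: sqr_ge0.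
    by case: ifP => // _; rewrite divr_ge0 ?sqr_ge0 ?ltW.
  + rewrite /c2; case: ifP => _; first by rewrite divr_ge0 ?sqr_ge0 ?ltW.
    by case: ifP => // _; rewrite subr_ge0.
  + rewrite -/h /hh /c1; case: (posnP k) => [->|k0]; first by rewrite /= h0 a0 mul1r.
    case: (ltngtP k T) kT => // [kT _|-> _].
      by rewrite subrr expr0n/= mulr0.
    by rewrite mulrC divfK// gt_eqF.
  + rewrite /hh /c2 /cutoff; case: (posnP k) => [->|k0].
      by rewrite /= subrr expr0n/= mulr0.
    rewrite /=; case: (ltngtP k T) kT => // [kT _|-> _]; last first.
      by rewrite ltnNge leqnSn/= gtn_eqF// subr0 subr0 mulrC divfK// gt_eqF.
    have [kT1|kT1] := ltnP k.+1 T; last first.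
      have -> : k = T.-1 by apply/eqP; rewrite eqn_leq -ltnS kT.
      by rewrite /= eqxx subrr expr0n/= ltnn mulr0.
    have -> : (k < T.-1)%N by [].
    have e1 : (0 < k < T)%N by rewrite k0.
    have e2 : (0 < k.+1 < T)%N by [].
    have V : (h k - h k.+1) ^+ 2 <= (a k.+1 - a k.+2) ^+ 2.
      rewrite (hE _ e1) (hE _ e2) !ak//; apply: dualcoef_variation => //.
      - exact: sqrt_nat_ge1.
      - exact: sqrt_nat_lt.
      - exact: sqrt_nat_lt.
      - have := sqrt_natS k.+1; have := sqrt_nat_ge1 (ltn0Sn k).
        move: (s k.+1) (s k.+2) (@sqrt_nat_gt0 R k.+2 isT) => y z; rewrite -/(s _); nra.
      - exact: sqrt_natS.
      - exact: sqrt_natS.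
    (* One factor is the cost c2 k; the other is at most a k - a k.+1 because the steps are convex
       in k. *)
    apply: le_trans V _; rewrite expr2 ler_wpM2r ?subr_ge0// gam//.
- by rewrite /hh /= ltnNge leqnSn/= gtn_eqF.
- rewrite /hh /= a0 mulr1; have /andP[-> h1] := hb 1%N isT.
  rewrite (le_trans h1)// (le_trans _ S1)// ak// invf_le1 ?sqrt_nat_gt0//.
  exact: sqrt_nat_ge1.
- by rewrite a0 mulr1.
Qed.

End SqrtSchedule.

(** * The error bound along one sample path *)

Section Pathwise.
Context {R : realType} {m : nat}.
Variables (theta rho : R) (al phi M nd X2 Y2 : nat -> R).
Variables (r lam : nat -> 'cV[R]_m) (ls : 'cV[R]_m) (t : nat) (S : R).
Hypothesis th01 : 0 < theta <= 1.
Hypothesis rho_gt0 : 0 < rho.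
Hypothesis al_gt0 : forall k, 0 < al k.
Hypothesis al_dec : forall k, al k.+1 <= al k.
Hypothesis X2_ge0 : forall k, 0 <= X2 k.
Hypothesis Y2_ge0 : forall k, 0 <= Y2 k.
Hypothesis r0 : r 0%N = 0.
Hypothesis lam0 : lam 0%N = 0.
Hypothesis lamS : forall k, lam k.+1 =
  lam k - ((1 - (1 - theta) * al k.+1 / al k) * rho) *: r k.+1.
Hypothesis phi_ge : forall k, dotv ls (r k) <= phi k.
Hypothesis step : forall k,
  phi k.+1 - (1 - theta) * phi k + M k
  - dotv (lam k) (r k.+1) + (1 - theta) * dotv (lam k) (r k)
  + rho * dotv (r k.+1) (r k.+1) - (1 - theta) * rho * dotv (r k) (r k)
  + 2^-1 * (X2 k.+1 - X2 k) + (2 * al k)^-1 * (Y2 k.+1 - Y2 k)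
  - al k / 2 * nd k <= 0.
Hypothesis adm : admissible theta al t S.

(** Index k + 1 receives al_k from step k and gives back (1 - theta) * al_(k+1) in step k + 1, hence
    beta_k; no step follows the last one. The w_k are the weights of [xhat], shifted by one. *)
Let beta k : R := if (k < t)%N then al k - (1 - theta) * al k.+1 else al k.
Let w k : R := if (k < t)%N then theta * al k.+1 else al k.+1.
(* The multipliers at which the telescoped inequality is expressed: the last
   one is not the multiplier of the algorithm. *)
Let L k : 'cV[R]_m := if (k <= t)%N then lam k else lam t - rho *: r t.+1.
Let nu k := L k - ls.

(** The part of the scaled inequality at step k that refers to iterate k; it cancels against what
    step k - 1 leaves. *)
Let Psi k := (1 - theta) * al k * (phi k - dotv (lam k) (r k) + rho * dotv (r k) (r k)).

Lemma step_scaled k :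
  al k * phi k.+1 - al k * dotv (lam k) (r k.+1)
  + rho * al k * dotv (r k.+1) (r k.+1) - Psi k + al k * M k - al k ^+ 2 / 2 * nd k
  + al k / 2 * (X2 k.+1 - X2 k) + 2^-1 * (Y2 k.+1 - Y2 k) <= 0.
Proof.
have := ler_wpM2l (ltW (al_gt0 k)) (step k); rewrite mulr0 /Psi.
set y := Y2 k.+1 - Y2 k.
have : al k * ((2 * al k)^-1 * y) = 2^-1 * y by field; rewrite gt_eqF.
lra.
Qed.

Lemma primal_telescope j : (j <= t)%N ->
  \sum_(k < j) beta k * (phi k.+1 - dotv (L k.+1) (r k.+1)) + Psi j
  + \sum_(k < j) (al k * M k - al k ^+ 2 / 2 * nd k)
  + 2^-1 * (al j * X2 j + Y2 j)
  <= (1 - theta) * al 0%N * phi 0%N + 2^-1 * (al 0%N * X2 0%N + Y2 0%N).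
Proof.
elim: j => [|j IH] jt.
  by rewrite !big_ord0 /Psi lam0 r0 !dotv0; lra.
have {}IH := IH (ltnW jt); rewrite !big_ord_recr/=.
have h := step_scaled j.
have bj : beta j = al j - (1 - theta) * al j.+1 by rewrite /beta jt.
have Lj : L j.+1 = lam j.+1 by rewrite /L jt.
(* This explains the step length in the multiplier update: multiplied by al_j it is beta_j * rho, so
   passing from lam_j to lam_(j+1) uses beta_j of the weight al_j on rho |r_(j+1)|^2 and leaves
   exactly the share needed by [Psi]. *)
have lj : al j * dotv (lam j) (r j.+1) = al j * dotv (lam j.+1) (r j.+1)
    + beta j * rho * dotv (r j.+1) (r j.+1).
  rewrite lamS dotvBl dotvZl bj; field; by rewrite gt_eqF.
have := ler_wpM2r (X2_ge0 j.+1) (al_dec j).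
rewrite Lj bj; rewrite bj in lj; rewrite /Psi in h IH *; lra.
Qed.

(** Nothing is carried over from the last step: with beta_t = al_t, a multiplier step of full length
    rho absorbs all of rho * al_t * |r_(t+1)|^2. This is the origin of the artificial last
    multiplier. *)
Lemma primal_bound :
  \sum_(k < t.+1) beta k * (phi k.+1 - dotv (L k.+1) (r k.+1))
  <= (1 - theta) * al 0%N * phi 0%N + 2^-1 * (al 0%N * X2 0%N + Y2 0%N)
     + \sum_(k < t.+1) (al k ^+ 2 / 2 * nd k - al k * M k).
Proof.
have h := step_scaled t; have IH := primal_telescope (leqnn t).
rewrite big_ord_recr/= [X in _ <= _ + X]big_ord_recr/=.
have -> : \sum_(k < t) (al k ^+ 2 / 2 * nd k - al k * M k)
   = - \sum_(k < t) (al k * M k - al k ^+ 2 / 2 * nd k).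
  by rewrite -sumrN; apply: eq_bigr => k _; rewrite opprB.
have bt : beta t = al t by rewrite /beta ltnn.
have Lt : L t.+1 = lam t - rho *: r t.+1 by rewrite /L ltnn.
rewrite bt Lt dotvBl dotvZl.
have := mulr_ge0 (ltW (al_gt0 t)) (X2_ge0 t.+1).
have := Y2_ge0 t.+1.
lra.
Qed.

Lemma nu_step k : (k <= t)%N -> al k *: (nu k.+1 - nu k) = - (beta k * rho) *: r k.+1.
Proof.
move=> kt; rewrite /nu opprB addrA subrK /L kt /beta.
have [kt'|kt'] := ltnP k t.
  rewrite lamS addrAC subrr add0r scalerN scalerA -scaleNr; congr (- _ *: _).
  by field; rewrite gt_eqF.
have -> : k = t by apply/eqP; rewrite eqn_leq kt.
by rewrite addrAC subrr add0r scalerN scalerA scaleNr.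
Qed.

Lemma weight_le k : (k <= t)%N -> 0 < w k <= beta k.
Proof.
move=> kt; have a1 := al_gt0 k.+1; have dk := al_dec k; case/andP: th01 => th0 th1.
by rewrite /w /beta; case: ifP => _; apply/andP; split => //; nra.
Qed.

Lemma weighted_bound e :
  \sum_(k < t.+1) w k * (phi k.+1 - dotv ls (r k.+1) + dotv e (r k.+1))
  <= (1 - theta) * al 0%N * phi 0%N + 2^-1 * (al 0%N * X2 0%N + Y2 0%N)
     + \sum_(k < t.+1) (al k ^+ 2 / 2 * nd k - al k * M k)
     + S * al 0%N / (2 * rho) * (enorm ls + enorm e) ^+ 2.
Proof.
have D := @dual_bound _ _ nu e theta al t S al_gt0 (fun k _ => al_dec k) adm.
have n0 : enorm (nu 0%N) = enorm ls.
  by rewrite /nu /L leq0n lam0 add0r -scaleN1r enormZ normrN1 mul1r.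
rewrite n0 in D.
have E k : (k <= t)%N ->
   al k * (dotv (nu k.+1) (nu k.+1) - dotv (nu k) (nu k)
      + dotv (nu k.+1 - nu k) (nu k.+1 - nu k))
    + 2 * dualcoef theta al t k * dotv e (nu k.+1 - nu k)
   = - (2 * rho) * (beta k * dotv (nu k.+1) (r k.+1) + w k * dotv e (r k.+1)).
  move=> kt; have ak := al_gt0 k; have s := nu_step kt.
  have [w0 wb] := andP (weight_le kt).
  have b0 : 0 < beta k by lra.
  have dE : dualcoef theta al t k = al k * w k / beta k.
    move: (b0); rewrite /dualcoef /w /beta; case: ifP => _ b1; field; by rewrite gt_eqF.
  set v := nu k.+1 - nu k in s *.
  have q1 : dotv (nu k.+1) (nu k.+1) - dotv (nu k) (nu k) + dotv v v
      = 2 * dotv (nu k.+1) v.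
    have -> : nu k = nu k.+1 - v by rewrite /v opprB addrC subrK.
    move: (nu k.+1) v {s} => y z.
    by rewrite dotvBl !dotvBr (dotvC z y); ring.
  have q2 : al k * dotv (nu k.+1) v = - (beta k * rho) * dotv (nu k.+1) (r k.+1).
    by rewrite -dotvZr s dotvZr.
  have q3 : al k * dotv e v = - (beta k * rho) * dotv e (r k.+1).
    by rewrite -dotvZr s dotvZr.
  rewrite q1 dE.
  have -> : 2 * (al k * w k / beta k) * dotv e v = 2 * w k / beta k * (al k * dotv e v) by ring.
  rewrite q3 mulrCA q2; field; by rewrite gt_eqF.
have {}D : \sum_(k < t.+1) (beta k * dotv (nu k.+1) (r k.+1) + w k * dotv e (r k.+1))
    <= S * al 0%N / (2 * rho) * (enorm ls + enorm e) ^+ 2.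
  move: D; rewrite (eq_bigr (fun k : 'I_t.+1 => - (2 * rho) * (beta k * dotv (nu k.+1) (r k.+1)
     + w k * dotv e (r k.+1)))); last by move=> k _; rewrite E// -ltnS.
  rewrite -mulr_sumr mulNr lerN2 => D.
  by rewrite mulrAC ler_pdivlMr ?mulr_gt0// mulrC.
have P := primal_bound.
apply: le_trans (lerD P D).
rewrite -big_split/=; apply: ler_sum => k _.
have kt : (k <= t)%N by rewrite -ltnS.
have [w0 wb] := andP (weight_le kt).
have p0 : 0 <= phi k.+1 - dotv ls (r k.+1) by rewrite subr_ge0.
have := ler_wpM2r p0 wb.
have -> : dotv (nu k.+1) (r k.+1) = dotv (L k.+1) (r k.+1) - dotv ls (r k.+1).
  by rewrite dotvBl.
lra.
Qed.

Lemma weights_sum (V : lmodType R) (g : nat -> V) :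
  \sum_(k < t.+1) w k *: g k.+1
  = al t.+1 *: g t.+1 + theta *: \sum_(1 <= k < t.+1) al k *: g k.
Proof.
rewrite big_ord_recr/= addrC /w ltnn; congr (_ + _).
rewrite scaler_sumr big_add1 /= big_mkord; apply: eq_bigr => k _.
by rewrite ltn_ord scalerA.
Qed.

(* The three choices of e below are ls, and the unit vector along rh multiplied
   by 1 and by the norm of ls. *)
Lemma pathwise_bound (Fh : R) (rh : 'cV[R]_m)
    (W := totalweight theta al t)
    (Z := (1 - theta) * al 0%N * phi 0%N + 2^-1 * (al 0%N * X2 0%N + Y2 0%N)
     + \sum_(k < t.+1) (al k ^+ 2 / 2 * nd k - al k * M k)
     + S * al 0%N / (2 * rho) * Num.max ((1 + enorm ls) ^+ 2) (4 * enorm ls ^+ 2)) :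
  W * Fh <= al t.+1 * phi t.+1 + theta * \sum_(1 <= k < t.+1) al k * phi k ->
  W *: rh = al t.+1 *: r t.+1 + theta *: \sum_(1 <= k < t.+1) al k *: r k ->
  dotv ls rh <= Fh ->
  W * `|Fh| <= Z /\ W * enorm rh <= Z.
Proof.
move=> hF hr hl.
have W0 : 0 < W.
  rewrite /W /totalweight; case/andP: th01 => th0 _.
  apply: ltr_wpDr; last exact: al_gt0.
  rewrite mulr_ge0 ?(ltW th0)//; apply: sumr_ge0 => k _; exact: ltW.
have c0 : 0 <= S * al 0%N / (2 * rho).
  case: adm => hh [c1 [c2 [_ _ _ _ S1]]].
  by rewrite divr_ge0 ?mulr_ge0 ?ltW// (lt_le_trans ltr01).
set K := (1 - theta) * _ * _ + _ + _ in Z *.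
have main e : W * (Fh - dotv ls rh + dotv e rh) <=
    K + S * al 0%N / (2 * rho) * (enorm ls + enorm e) ^+ 2.
  have := weighted_bound e; rewrite -/K => /(le_trans _); apply.
  have -> : \sum_(k < t.+1) w k * (phi k.+1 - dotv ls (r k.+1) + dotv e (r k.+1))
     = \sum_(k < t.+1) w k * phi k.+1 + dotv (e - ls) (\sum_(k < t.+1) w k *: r k.+1).
    rewrite dotv_sumr -big_split/=; apply: eq_bigr => k _.
    by rewrite dotvZr dotvBl; ring.
  rewrite (weights_sum r) -hr dotvZr dotvBl.
  have := weights_sum (phi : nat -> R^o); rewrite /GRing.scale/= => ->.
  lra.
have l0 := enorm_ge0 ls.
have m1 c : 0 <= c -> (enorm ls + c) ^+ 2 <= Num.max ((1 + enorm ls) ^+ 2) (4 * enorm ls ^+ 2) ->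
    forall e, enorm e = c -> W * (Fh - dotv ls rh + dotv e rh) <= Z.
  move=> _ hc e ec; apply: le_trans (main e) _; rewrite ec lerD2l.
  exact: ler_wpM2l.
(* The values c = 1 and c = |ls| of the norm of e produce the two terms of the maximum in [C0]. *)
have b1 : (enorm ls + 1) ^+ 2 <= Num.max ((1 + enorm ls) ^+ 2) (4 * enorm ls ^+ 2).
  by rewrite le_max addrC lexx.
have b2 : (enorm ls + enorm ls) ^+ 2 <= Num.max ((1 + enorm ls) ^+ 2) (4 * enorm ls ^+ 2).
  by rewrite le_max; apply/orP; right; rewrite le_eqVlt; apply/orP; left; apply/eqP; ring.
have up : W * Fh <= Z.
  by have := m1 _ l0 b2 ls erefl; rewrite subrK.
have rr c : 0 <= c -> (enorm ls + c) ^+ 2 <= Num.max ((1 + enorm ls) ^+ 2) (4 * enorm ls ^+ 2) ->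
    W * (c * enorm rh) <= Z.
  move=> cp hc; have [/eqP rz|rn] := boolP (enorm rh == 0).
    rewrite rz mulr0 mulr0.
    have := m1 _ l0 b2 ls erefl; rewrite subrK; apply: le_trans.
    by rewrite mulr_ge0 ?(ltW W0)//; move: hl; rewrite (enorm_eq0 rz) dotv0.
  have rp : 0 < enorm rh by rewrite lt_neqAle eq_sym rn enorm_ge0.
  pose e := (c / enorm rh) *: rh.
  have ne : enorm e = c.
    by rewrite /e enormZ ger0_norm ?divr_ge0 ?(ltW rp)// divfK.
  have de : dotv e rh = c * enorm rh.
    by rewrite /e dotvZl -enorm_sqr expr2 mulrA divfK.
  apply: le_trans (m1 c cp hc e ne); rewrite ler_pM2l// de lerDr subr_ge0//.
split; last by have := rr 1 ler01 b1; rewrite mul1r.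
(* For the lower bound, Fh >= <ls, rh> >= - |ls| |rh|, and W * |ls| * |rh| is bounded by the choice
   c = |ls|. *)
have lo := rr _ l0 b2.
have CS : - (enorm ls * enorm rh) <= Fh.
  apply: le_trans hl; have := cauchy_schwarz_norm ls rh.
  by rewrite ler_norml => /andP[].
have : - Z <= W * Fh.
  rewrite lerNl -mulrN; apply: le_trans lo; rewrite ler_pM2l//; lra.
move=> lo'; rewrite -[X in X * _](gtr0_norm W0) -normrM ler_norml.
by rewrite lo' up.
Qed.

End Pathwise.

Import HBNNSimple.

(** * Integrability and orthogonality *)

Section Measure.
Context {R : realType} {dsp : measure_display} {T : measurableType dsp}.
Variable P : probability T R.
Implicit Types Y Z D : T -> R.

Definition L1 (Y : T -> R) := P.-integrable setT (EFin \o Y).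

Lemma L1_measurable Y : L1 Y -> measurable_fun setT Y.
Proof. by move=> /integrableP[/measurable_EFinP]. Qed.

Lemma L1D Y Z : L1 Y -> L1 Z -> L1 (fun w => Y w + Z w).
Proof. by move=> iY iZ; exact: (integrableD measurableT iY iZ). Qed.

Lemma L1Z c Y : L1 Y -> L1 (fun w => c * Y w).
Proof. by move=> iY; exact: (integrableZl measurableT c iY). Qed.

Lemma L1N Y : L1 Y -> L1 (fun w => - Y w).
Proof. by move=> iY; exact: (integrableN iY). Qed.

Lemma L1B Y Z : L1 Y -> L1 Z -> L1 (fun w => Y w - Z w).
Proof. by move=> iY /L1N; exact: L1D. Qed.

Lemma L1_cst c : L1 (fun=> c).
Proof. exact: finite_measure_integrable_cst. Qed.

Lemma L1_sum (J : Type) (s : seq J) (p : pred J) (Y : J -> T -> R) :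
  (forall j, p j -> L1 (Y j)) -> L1 (fun w => \sum_(j <- s | p j) Y j w).
Proof.
move=> h; elim: s => [|j s IH].
  by rewrite (_ : (fun w => _) = fun=> 0); [exact: L1_cst|apply/funext => w; rewrite big_nil].
have [pj|pj] := boolP (p j).
  rewrite (_ : (fun w => _) = fun w => Y j w + \sum_(i <- s | p i) Y i w).
    by apply: L1D => //; exact: h.
  by apply/funext => w; rewrite big_cons pj.
rewrite (_ : (fun w => _) = fun w => \sum_(i <- s | p i) Y i w)//.
by apply/funext => w; rewrite big_cons (negbTE pj).
Qed.

Lemma L1_le Y Z : measurable_fun setT Y -> L1 Z -> (forall w, `|Y w| <= Z w) -> L1 Y.
Proof.
move=> mY iZ h; apply: (le_integrable measurableT _ _ iZ); first exact/measurable_EFinP.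
move=> w _; rewrite /= lee_fin; apply: le_trans (h w) (ler_norm _).
Qed.

Lemma L1_sandwich Y Z1 Z2 : measurable_fun setT Y -> L1 Z1 -> L1 Z2 ->
  (forall w, Z1 w <= Y w <= Z2 w) -> L1 Y.
Proof.
move=> mY i1 i2 h; apply: (@L1_le _ (fun w => `|Z1 w| + `|Z2 w|)) => //.
  by apply: L1D; [exact: (integrable_norm i1)|exact: (integrable_norm i2)].
move=> w; have /andP[h1 h2] := h w; rewrite ler_norml.
have := ler_norm (Z1 w); have := ler_norm (- Z1 w); rewrite normrN.
have := ler_norm (Z2 w); have := normr_ge0 (Z2 w); have := normr_ge0 (Z1 w).
by move=> *; apply/andP; split; lra.
Qed.

Lemma L1_mul Y Z : measurable_fun setT Y -> measurable_fun setT Z ->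
  L1 (fun w => Y w ^+ 2) -> L1 (fun w => Z w ^+ 2) -> L1 (fun w => Y w * Z w).
Proof.
move=> mY mZ iY iZ.
apply: (@L1_le _ (fun w => Y w ^+ 2 + Z w ^+ 2)).
- exact: measurable_funM.
- exact: L1D.
move=> w; rewrite ler_norml; apply/andP; split; nra.
Qed.

Lemma integral_simple_factor (D Y : T -> R) (phi : {nnsfun (measurableTypeR R) >-> R}) :
  L1 D -> measurable_fun setT Y ->
  (forall B : set R, measurable B -> \int[P]_(w in Y @^-1` B) (D w)%:E = 0)%E ->
  (\int[P]_w (D w * phi (Y w))%:E = 0)%E.
Proof.
move=> iD mY h.
pose F c w : \bar R := (c%:E * ((EFin \o D) \_ (Y @^-1` (phi @^-1` [set c])) w))%E.
have mA c : measurable (Y @^-1` (phi @^-1` [set c])).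
  rewrite -[X in measurable X]setTI; apply: mY => //.
  exact: (measurable_funPTI phi (measurable_set1 c)).
have iD' c : P.-integrable setT ((EFin \o D) \_ (Y @^-1` (phi @^-1` [set c]))).
  apply: (integrable_mkcond _ (mA c)).1.
  exact: (@integrableS _ _ _ P setT).
have FE w : (D w * phi (Y w))%:E = (\sum_(c <- finmap.enum_fset (fset_set (range phi))) F c w)%E.
  rewrite fimfunE mulrC fsbig_finite//= mulr_suml -sumEFin; apply: eq_bigr => c _.
  rewrite /F patchE indicE.
  have -> : (w \in Y @^-1` (phi @^-1` [set c])) = (Y w \in phi @^-1` [set c]) by [].
  by case: (_ \in _); rewrite /= ?mulr1 ?mulr0 ?mul0r ?mule0 ?EFinM.
under eq_integral do rewrite FE.
rewrite integral_sum//; last by move=> c; exact: integrableZl.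
rewrite big1// => c _; rewrite integralZl//.
rewrite -integral_mkcond h ?mule0//.
exact: (measurable_funPTI phi (measurable_set1 c)).
Qed.

(** Simple functions increase to g, and each gives a zero integral. The products are dominated by |D
    g(Y)|, so dominated convergence applies. *)
Lemma integral_factor_ge0 (D Y : T -> R) (g : R -> R) :
  L1 D -> measurable_fun setT Y -> measurable_fun setT g -> (forall y, 0 <= g y) ->
  (forall B : set R, measurable B -> \int[P]_(w in Y @^-1` B) (D w)%:E = 0)%E ->
  L1 (fun w => D w * g (Y w)) ->
  (\int[P]_w (D w * g (Y w))%:E = 0)%E.
Proof.
move=> iD mY mg g0 h iDg.
have mg' : measurable_fun (setT : set (measurableTypeR R)) (EFin \o g).
  exact/measurable_EFinP.
pose phi n := nnsfun_approx measurableT mg' n.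
have phi0 n y : 0 <= phi n y <= g y.
  apply/andP; split; first exact: fun_ge0.
  rewrite -lee_fin /phi nnsfun_approxE; apply: (@le_approx _ _ _ setT) => //.
  by move=> z _; rewrite lee_fin.
have cv y : (fun n => (phi n y)%:E) @ \oo --> (g y)%:E.
  by apply: (@cvg_nnsfun_approx _ _ _ setT) => // z _; rewrite lee_fin.
have mD := L1_measurable iD.
have [||||| _ _ lim0] := @dominated_convergence _ _ _ P setT measurableT
    (fun n w => (D w * phi n (Y w))%:E) (fun w => (D w * g (Y w))%:E)
    (fun w => `|D w * g (Y w)|%:E).
- move=> n; apply/measurable_EFinP; apply: measurable_funM => //.
  apply: (@measurableT_comp _ _ _ _ _ _ (phi n : measurableTypeR R -> R) _ Y) => //.
- exact: (measurable_int _ iDg).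
- apply: aeW => w _; apply/cvg_EFin.
    by near=> n.
  apply: cvgMr; have /fine_cvgP[_] := cv (Y w); apply: cvg_trans.
  exact: cvg_id.
- exact: (integrable_norm iDg).
- apply: aeW => w n _; rewrite /= lee_fin !normrM ler_wpM2l//.
  have /andP[p0 pg] := phi0 n (Y w); rewrite !ger0_norm//.
have z0 : (fun n => \int[P]_w (D w * phi n (Y w))%:E)%E = (fun=> 0%E).
  by apply/funext => n; exact: integral_simple_factor.
by move: lim0; rewrite z0 => /cvg_lim <- //; rewrite lim_cst.
Unshelve. all: by end_near. Qed.

(* If every event of sigma(Y) is D-null then D is orthogonal to Y: this covers
   both conditional centering and independence. *)
Lemma integral_factor (D Y : T -> R) :
  L1 D -> measurable_fun setT Y ->
  (forall B : set R, measurable B -> \int[P]_(w in Y @^-1` B) (D w)%:E = 0)%E ->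
  L1 (fun w => D w * Y w) -> (\int[P]_w (D w * Y w)%:E = 0)%E.
Proof.
move=> iD mY h iDY.
have mD := L1_measurable iD.
pose gp (y : R) := Num.max y 0; pose gn (y : R) := Num.max (- y) 0.
have mp : measurable_fun setT gp by exact: measurable_maxr.
have mn : measurable_fun setT gn by apply: measurable_maxr => //; exact: measurableT_comp.
have p0 y : 0 <= gp y by rewrite le_max lexx orbT.
have n0 y : 0 <= gn y by rewrite le_max lexx orbT.
have bp y : gp y <= `|y| by rewrite ge_max ler_norm normr_ge0.
have bn y : gn y <= `|y| by rewrite ge_max -normrN ler_norm normr_ge0.
have iN := integrable_norm iDY.
have ip : L1 (fun w => D w * gp (Y w)).
  apply: (L1_le _ iN) => [|w]; last by rewrite /= !normrM (ger0_norm (p0 _)) ler_wpM2l.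
  by apply: measurable_funM => //; exact: measurableT_comp.
have in_ : L1 (fun w => D w * gn (Y w)).
  apply: (L1_le _ iN) => [|w]; last by rewrite /= !normrM (ger0_norm (n0 _)) ler_wpM2l.
  by apply: measurable_funM => //; exact: measurableT_comp.
have -> : (\int[P]_w (D w * Y w)%:E
   = \int[P]_w ((D w * gp (Y w))%:E - (D w * gn (Y w))%:E))%E.
  apply: eq_integral => w _; rewrite -EFinB -mulrBr; congr (_ * _)%:E.
  rewrite /gp /gn; have [y0|y0] := leP 0 (Y w).
    by rewrite (max_idPr _) ?subr0 ?oppr_le0// (max_idPl _).
  by rewrite (max_idPl _) ?oppr_ge0 ?(ltW y0)// sub0r opprK.
rewrite integralB_EFin//.
by rewrite !integral_factor_ge0// sube0.
Qed.

End Measure.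

(** * Measurability of functions of random vectors *)

Section RandomVectors.
Context {R : realType} {dsp : measure_display} {T : measurableType dsp}.

Lemma measurable_box n (v : T -> 'cV[R]_n) (c : 'I_n -> R) (e : R) : random_vec v ->
  measurable [set w | forall i, `|v w i 0 - c i| < e].
Proof.
move=> mv.
rewrite [X in measurable X](_ : _ = \bigcap_(i in [set: 'I_n]) [set w | `|v w i 0 - c i| < e]).
  apply: fin_bigcap_measurable => // i _.
  have m1 : measurable_fun setT (fun w => `|v w i 0 - c i|).
    by apply: measurableT_comp => //; apply: measurable_funB => //; exact: mv.
  rewrite -[X in measurable X]setTI -(preimage_itvNyo (fun w => `|v w i 0 - c i|)).
  by apply: m1 => //; exact: measurable_itv.
by apply/seteqP; split => [w h i _|w h i]; exact: h.
Qed.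

(** Random vectors are measurable coordinate by coordinate; an open set is the countable union of
    the boxes it contains with rational center and radius 1 / (k + 1). *)
Lemma open_preimage_measurable n (v : T -> 'cV[R]_n) (O : set 'cV[R]_n) :
  random_vec v -> open O -> measurable (v @^-1` O).
Proof.
move=> mv oO.
pose box (q : 'cV[rat]_n * nat) : set 'cV[R]_n :=
  [set z | forall i, `|z i 0 - ratr (q.1 i 0)| < q.2.+1%:R^-1].
pose F q := [set w | box q (v w) /\ (box q `<=` O)].
have -> : v @^-1` O = \bigcup_q F q.
  apply/seteqP; split => [w Ow|w [q _ [bw bO]]]; last exact: bO.
  have /nbhs_ballP[e /= e0 eO] := open_nbhs_nbhs (conj oO Ow).
  (* Twice the radius below e keeps a box containing [v w] inside the ball of radius e around
     [v w]. *)
  have [k ke] : exists k : nat, 2 * k.+1%:R^-1 < e.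
    have [k] := ltr_add_invr (divr_gt0 e0 (ltr0n R 2)).
    by rewrite add0r ltr_pdivlMr// mulrC => hk; exists k.
  have [a [aE a0]] : exists a : R, a = k.+1%:R^-1 /\ 0 < a.
    by exists k.+1%:R^-1; rewrite invr_gt0.
  rewrite -aE in ke.
  have hq (i : 'I_n) : exists q : rat, `|v w i 0 - ratr q| < a.
    have := @rat_in_itvoo _ (v w i 0 - a) (v w i 0 + a).
    case; first by lra.
    move=> q; rewrite in_itv/= => /andP[q1 q2]; exists q.
    by rewrite ltr_norml; apply/andP; split; lra.
  have [q hq'] := choice hq.
  exists (\col_i q i, k) => //; split=> [i|z hz]; first by rewrite /= mxE -aE.
  apply: eO; split => // i j; rewrite (ord1 j) /ball /=.
  have := hz i; have := hq' i; rewrite /= mxE -aE => h1 h2.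
  have -> : v w i 0 - z i 0 = (v w i 0 - ratr (q i)) - (z i 0 - ratr (q i)) by ring.
  by apply: le_lt_trans (ler_normB _ _) _; lra.
apply: countable_bigcupT_measurable => [|q]; first exact: countableP.
have [bO|bO] := pselect (box q `<=` O).
  rewrite (_ : F q = [set w | forall i, `|v w i 0 - ratr (q.1 i 0)| < q.2.+1%:R^-1]).
    exact: measurable_box.
  by apply/seteqP; split => [w []|w].
by rewrite (_ : F q = set0) //; apply/seteqP; split => // w [].
Qed.

(** Strict superlevel sets of g are open. The u_i are extended-valued and merely lower
    semicontinuous, so their measurability comes from here. *)
Lemma lower_semicontinuous_random n (v : T -> 'cV[R]_n) (g : 'cV[R]_n -> \bar R) :
  random_vec v -> lower_semicontinuous g -> measurable_fun setT (g \o v).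
Proof.
move=> mv /lower_semicontinuousP lg.
apply: (measurability _ (ErealGenOInfty.measurableE R)).
move=> /= _ [_ [a ->]] <-; apply: measurableI => //.
by rewrite comp_preimage preimage_itvoy; exact: open_preimage_measurable.
Qed.

Lemma continuous_random n (v : T -> 'cV[R]_n) (g : 'cV[R]_n -> R) :
  random_vec v -> continuous g -> measurable_fun setT (fun w => g (v w)).
Proof.
move=> mv cg; apply/measurable_EFinP.
apply: (@lower_semicontinuous_random _ v (EFin \o g)) => //.
apply/lower_semicontinuousP => a.
rewrite (_ : [set x | _] = g @^-1` [set y | a < y]).
  by apply: open_comp => // x _; exact: cg.
by apply/seteqP; split => x /=; rewrite lte_fin.
Qed.

Lemma random_vec_cst n (c : 'cV[R]_n) : random_vec (fun _ : T => c).
Proof. by move=> i; exact: measurable_cst. Qed.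

Lemma random_vecD n (v z : T -> 'cV[R]_n) : random_vec v -> random_vec z ->
  random_vec (fun w => v w + z w).
Proof.
move=> mv mz i; rewrite (_ : (fun w => _) = fun w => v w i 0 + z w i 0).
  by apply: measurable_funD; [exact: mv|exact: mz].
by apply/funext => w; rewrite mxE.
Qed.

Lemma random_vecM m n (A : 'M[R]_(m, n)) (v : T -> 'cV[R]_n) : random_vec v ->
  random_vec (fun w => A *m v w).
Proof.
move=> mv i; rewrite (_ : (fun w => _) = fun w => \sum_j A i j * v w j 0).
  by apply: measurable_sum => j; apply: measurable_funM => //; exact: mv.
by apply/funext => w; rewrite mxE.
Qed.

Lemma random_vecZ n a (v : T -> 'cV[R]_n) : random_vec v ->
  random_vec (fun w => a *: v w).
Proof.
by move=> mv; have := random_vecM a%:M mv; under eq_fun do rewrite mul_scalar_mx.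
Qed.

Lemma random_vecB n (v z : T -> 'cV[R]_n) : random_vec v -> random_vec z ->
  random_vec (fun w => v w - z w).
Proof.
move=> mv mz; apply: random_vecD => //.
by have := random_vecZ (-1) mz; under eq_fun do rewrite scaleN1r.
Qed.

Lemma measurable_dotv n (v z : T -> 'cV[R]_n) : random_vec v -> random_vec z ->
  measurable_fun setT (fun w => dotv (v w) (z w)).
Proof.
move=> mv mz; under eq_fun do rewrite dotvE.
by apply: measurable_sum => i; apply: measurable_funM; [exact: mv|exact: mz].
Qed.

Lemma random_submxcol N (d : 'I_N -> nat) (v : T -> bvec R d) i : random_vec v ->
  random_vec (fun w => submxcol (v w) i).
Proof. by move=> mv j; under eq_fun do rewrite mxE; exact: mv. Qed.

Lemma measurable_blockgap N (d : 'I_N -> nat)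
    (u : forall i : 'I_N, 'cV[R]_(d i) -> \bar R) (g x : T -> bvec R d) xs i :
  lower_semicontinuous (u i) -> random_vec g -> random_vec x ->
  measurable_fun setT (fun w => blockgap u (g w) (x w) xs i).
Proof.
move=> lu mg mx; apply: measurable_funD.
  apply: measurable_funB => //.
  have := lower_semicontinuous_random (random_submxcol (i := i) mx) lu.
  by move=> /(measurableT_comp (fine_measurable measurableT)); apply.
apply: measurable_dotv; first exact: random_submxcol.
by apply: random_submxcol; apply: random_vecB => //; exact: random_vec_cst.
Qed.

End RandomVectors.

(** The sets of size n that avoid i are the subsets of its complement; Pascal's rule counts the
    others. *)
Lemma card_draws_containing N n (i : 'I_N) : (0 < n)%N ->
  #|[set S : {set 'I_N} | (#|S| == n) && (i \in S)]%SET| = 'C(N.-1, n.-1).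
Proof.
case: n => // n _; case: N i => [[]//|N] i /=.
have := cardsID [set S : {set 'I_N.+1} | i \in S]%SET
  [set S : {set 'I_N.+1} | #|S| == n.+1]%SET.
rewrite card_draws card_ord.
have -> : ([set S : {set 'I_N.+1} | #|S| == n.+1] :\: [set S : {set 'I_N.+1} | i \in S])%SET
    = [set S : {set 'I_N.+1} | S \subset ~: [set i] & #|S| == n.+1]%SET.
  apply/setP => S; rewrite !inE; congr (_ && _); apply/idP/fintype.subsetP => [iS j jS|h].
    by rewrite !inE; apply: contraNneq iS => <-.
  by apply/negP => iS; have := h i iS; rewrite !inE eqxx.
rewrite cards_draws cardsC1 card_ord /= binS.
have -> : ([set S : {set 'I_N.+1} | #|S| == n.+1] :&: [set S : {set 'I_N.+1} | i \in S])%SET =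
  [set S : {set 'I_N.+1} | (#|S| == n.+1) && (i \in S)]%SET by apply/setP => S; rewrite !inE.
by rewrite addnC => /addnI.
Qed.

(** * Centering of the noise and of the draw *)

Section Centering.
Context {R : realType} {dsp : measure_display} {T : measurableType dsp}.
Variable P : probability T R.

Lemma random_vec_sigma n (v : T -> 'cV[R]_n) (i : 'I_n) (B : set R) :
  measurable B -> sigma_vec v ((fun w => v w i 0) @^-1` B).
Proof.
move=> mB; apply: sub_sigma_algebra; rewrite (bigD1 i)//=; left.
by exists B => //; rewrite setTI.
Qed.

(** Retyping v over a smaller sigma-algebra lets the general measurability lemmas prove that an
    event belongs to the history. *)
Lemma random_vec_sub n (v : T -> 'cV[R]_n) (G : set (set T)) :
  sigma_vec v `<=` G -> random_vec (v : g_sigma_algebraType G -> 'cV[R]_n).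
Proof.
move=> vG i _ B mB; rewrite setTI; apply: sub_sigma_algebra; apply: vG.
exact: random_vec_sigma.
Qed.

Lemma cond_centered n (v : T -> 'cV[R]_n) (D : T -> R) (i : 'I_n) (c : R) :
  random_vec v -> is_cond_exp P (sigma_vec v) D (cst 0) ->
  L1 P (fun w => D w * (v w i 0 - c)) ->
  (\int[P]_w (D w * (v w i 0 - c))%:E = 0)%E.
Proof.
move=> mv [iD _ _ hD] iDv; apply: integral_factor => //.
  by apply: measurable_funB => //; exact: mv.
move=> B mB; rewrite hD ?integral0//.
have m1 : measurable_fun setT (fun y : R => y - c) by exact: measurable_funB.
have := random_vec_sigma (v := v) i (m1 measurableT B mB).
by rewrite setTI.
Qed.

Lemma draw_measurable N n (J : T -> {set 'I_N}) i : uniform_draw P n J ->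
  measurable_fun setT (fun w => (i \in J w)%:R : R).
Proof.
move=> [_ mJ _].
rewrite (_ : (fun w => _) = fun w =>
    \sum_(S : {set 'I_N}) (i \in S)%:R * \1_[set w | J w = S] w).
  apply: measurable_sum => S; apply: measurable_funM; first exact: measurable_cst.
  by have := @measurable_indic _ T R setT _ (mJ S).
apply/funext => w; rewrite (bigD1 (J w))//= indicE mem_set// mulr1 big1 ?addr0//.
by move=> S SJ; rewrite indicE memNset ?mulr0//= => e; rewrite e eqxx in SJ.
Qed.

(** Independence factors P E out of every event J = S, and the sets S that contain i carry total
    mass C(N - 1, n - 1) / C(N, n) = n / N. *)
Lemma draw_centered N n (J : T -> {set 'I_N}) (H : set (set T)) i E :
  (0 < n)%N -> uniform_draw P n J -> indep_draw P J H -> H E -> measurable E ->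
  (\int[P]_(w in E) ((i \in J w)%:R - n%:R / N%:R)%:E = 0)%E.
Proof.
move=> n0 uJ iJ HE mE; have [cJ mJ PJ] := uJ.
(* A probability space has a sample point, and the set drawn there has n of the N elements. *)
have nN : (n <= N)%N.
  have /set0P[w _] : [set: T] != set0.
    apply/eqP => T0; have := probability_setT P; rewrite T0 measure0 => /eqP.
    by rewrite eq_sym onee_eq0.
  by rewrite -(cJ w) -[X in (_ <= X)%N]card_ord max_card.
have fE : P E \is a fin_num by exact: fin_num_measure.
pose Q := fine (P E); have PE : P E = Q%:E by rewrite /Q fineK.
have e1 : (\int[P]_(w in E) ((i \in J w)%:R : R)%:E = (n%:R / N%:R * Q)%:E)%E.
  have -> : (\int[P]_(w in E) ((i \in J w)%:R : R)%:E
     = \int[P]_(w in E) \sum_(S : {set 'I_N} | (#|S| == n) && (i \in S))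
         (\1_[set w | J w = S] w)%:E)%E.
    apply: eq_integral => w _; rewrite sumEFin; congr _%:E.
    have [iw|iw] := boolP (i \in J w).
      rewrite (bigD1 (J w))/= ?cJ ?eqxx ?iw// indicE mem_set// big1 ?addr0// => S /andP[_ SJ].
      by rewrite indicE memNset//= => e; rewrite e eqxx in SJ.
    rewrite big1// => S /andP[_ iS]; rewrite indicE memNset//= => e.
    by rewrite e iS in iw.
  rewrite integral_sum//; last first.
    move=> S; apply: (@integrableS _ _ _ P setT) => //.
    exact: (integrable_indic P (mJ S)).
  rewrite (eq_bigr (fun=> (('C(N, n))%:R^-1 * Q)%:E)); last first.
    move=> S /andP[/eqP Sn iS]; rewrite integral_indic//= iJ// PJ//.
    by rewrite PE EFinM.
  rewrite sumEFin sumr_const; congr _%:E.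
  have -> : #|[pred S : {set 'I_N} | (#|S| == n) && (i \in S)]| = 'C(N.-1, n.-1).
    by rewrite -(card_draws_containing i n0) cardsE.
  rewrite -[LHS]mulr_natr [LHS]mulrAC; congr (_ * _).
  have bp : ('C(N, n))%:R != 0 :> R by rewrite pnatr_eq0 -lt0n bin_gt0.
  have Np : N%:R != 0 :> R by rewrite pnatr_eq0 -lt0n (leq_trans n0).
  apply: (mulfI bp); rewrite mulrA divff// mul1r.
  apply: (mulfI Np); rewrite mulrCA [_ * (n%:R / _)]mulrA [N%:R * n%:R]mulrC.
  rewrite -mulrA divff// mulr1 -!natrM; congr _%:R.
  case: (n) n0 (N) nN => // k _ [//|K] _ /=.
  by rewrite (mul_bin_diag K.+1 k) mulnC.
have iS : P.-integrable E (fun w => ((i \in J w)%:R : R)%:E).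
  apply: (@integrableS _ _ _ P setT) => //.
  apply: (@L1_le _ _ _ P (fun w => (i \in J w)%:R) (fun=> 1)) => //.
  - exact: draw_measurable uJ.
  - exact: L1_cst.
  - by move=> w; case: (i \in J w); rewrite /= ?normr1 ?normr0.
have iC : P.-integrable E (EFin \o (fun=> n%:R / N%:R : R)).
  by apply: (@integrableS _ _ _ P setT) => //; exact: L1_cst.
rewrite (_ : (\int[P]_(w in E) _)%E = (\int[P]_(w in E) (((i \in J w)%:R : R)%:E
    - (n%:R / N%:R : R)%:E))%E)//.
rewrite integralB_EFin// e1 integral_cst// EFinM -PE subee//.
by rewrite fin_numM.
Qed.

End Centering.

(** * Square integrable vectors and expectations *)

Section SquareIntegrable.
Context {R : realType} {dsp : measure_display} {T : measurableType dsp}.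
Variable P : probability T R.
Implicit Types Y Z : T -> R.

Definition L2 Y := measurable_fun setT Y /\ L1 P (fun w => Y w ^+ 2).

Lemma L2_mul Y Z : L2 Y -> L2 Z -> L1 P (fun w => Y w * Z w).
Proof. by move=> [mY iY] [mZ iZ]; exact: L1_mul. Qed.

Lemma L2_cst c : L2 (fun=> c).
Proof. by split; [exact: measurable_cst|exact: L1_cst]. Qed.

Lemma L2D Y Z : L2 Y -> L2 Z -> L2 (fun w => Y w + Z w).
Proof.
move=> hY hZ; split; first by apply: measurable_funD; [case: hY|case: hZ].
rewrite (_ : (fun w => _) = fun w => (Y w ^+ 2 + 2 * (Y w * Z w)) + Z w ^+ 2).
  apply: L1D; last by case: hZ.
  by apply: L1D; [case: hY|apply: L1Z; exact: L2_mul].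
by apply/funext => w; ring.
Qed.

Lemma L2Z c Y : L2 Y -> L2 (fun w => c * Y w).
Proof.
move=> [mY iY]; split; first exact: measurable_funM.
rewrite (_ : (fun w => _) = fun w => c ^+ 2 * Y w ^+ 2); first exact: L1Z.
by apply/funext => w; rewrite exprMn.
Qed.

Lemma L2_sum (J : Type) (s : seq J) (Y : J -> T -> R) :
  (forall j, L2 (Y j)) -> L2 (fun w => \sum_(j <- s) Y j w).
Proof.
move=> h; elim: s => [|j s IH].
  rewrite (_ : (fun w => _) = fun=> 0); first exact: L2_cst.
  by apply/funext => w; rewrite big_nil.
rewrite (_ : (fun w => _) = fun w => Y j w + \sum_(i <- s) Y i w).
  exact: L2D.
by apply/funext => w; rewrite big_cons.
Qed.

Definition sqint n (v : T -> 'cV[R]_n) := forall i, L2 (fun w => v w i 0).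

Lemma sqint_cst n (c : 'cV[R]_n) : sqint (fun=> c).
Proof. by move=> i; exact: L2_cst. Qed.

Lemma sqintD n (v z : T -> 'cV[R]_n) : sqint v -> sqint z ->
  sqint (fun w => v w + z w).
Proof.
move=> hv hz i; rewrite (_ : (fun w => _) = fun w => v w i 0 + z w i 0).
  exact: L2D.
by apply/funext => w; rewrite mxE.
Qed.

Lemma sqintM m n (A : 'M[R]_(m, n)) (v : T -> 'cV[R]_n) : sqint v ->
  sqint (fun w => A *m v w).
Proof.
move=> hv i; rewrite (_ : (fun w => _) = fun w => \sum_j A i j * v w j 0).
  by apply: L2_sum => j; exact: L2Z.
by apply/funext => w; rewrite mxE.
Qed.

Lemma sqintZ n c (v : T -> 'cV[R]_n) : sqint v -> sqint (fun w => c *: v w).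
Proof.
move=> hv; rewrite (_ : (fun w => _) = fun w => c%:M *m v w); first exact: sqintM.
by apply/funext => w; rewrite mul_scalar_mx.
Qed.

Lemma sqintB n (v z : T -> 'cV[R]_n) : sqint v -> sqint z ->
  sqint (fun w => v w - z w).
Proof.
move=> hv hz; apply: sqintD => //.
rewrite (_ : (fun w => _) = fun w => -1 *: z w); first exact: sqintZ.
by apply/funext => w; rewrite scaleN1r.
Qed.

Lemma sqint_submxcol N (d : 'I_N -> nat) (v : T -> bvec R d) i : sqint v ->
  sqint (fun w => submxcol (v w) i).
Proof.
move=> hv j; rewrite (_ : (fun w => _) = fun w => v w (tagnat.Rank i j) 0) //.
by apply/funext => w; rewrite mxE.
Qed.

Lemma sqint_dotv n (v z : T -> 'cV[R]_n) : sqint v -> sqint z ->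
  L1 P (fun w => dotv (v w) (z w)).
Proof.
move=> hv hz; rewrite (_ : (fun w => _) = fun w => \sum_i v w i 0 * z w i 0).
  by apply: L1_sum => i _; exact: L2_mul.
by apply/funext => w; rewrite dotvE.
Qed.

Lemma sqint_of_dotv n (v : T -> 'cV[R]_n) : random_vec v ->
  L1 P (fun w => dotv (v w) (v w)) -> sqint v.
Proof.
move=> mv iv i; split; first exact: mv.
apply: (L1_le _ iv) => [|w]; first by apply: measurable_funX; exact: mv.
by rewrite ger0_norm ?sqr_ge0// sqr_col_le_dotv.
Qed.

Lemma L1_finite_expectation Y : measurable_fun setT Y -> (forall w, 0 <= Y w) ->
  (\int[P]_w (Y w)%:E < +oo)%E -> L1 P Y.
Proof.
move=> mY Y0 h; apply/integrableP; split; first exact/measurable_EFinP.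
apply: le_lt_trans h; rewrite le_eqVlt; apply/orP; left; apply/eqP.
by apply: eq_integral => w _; rewrite /= ger0_norm.
Qed.

Definition Ex Y : R := fine (\int[P]_w (Y w)%:E).

Lemma ExE Y : L1 P Y -> (\int[P]_w (Y w)%:E = (Ex Y)%:E)%E.
Proof. by move=> iY; rewrite fineK// integrable_fin_num. Qed.

Lemma ExD Y Z : L1 P Y -> L1 P Z -> Ex (fun w => Y w + Z w) = Ex Y + Ex Z.
Proof. by move=> iY iZ; apply: (RintegralD measurableT iY iZ). Qed.

Lemma ExZ c Y : L1 P Y -> Ex (fun w => c * Y w) = c * Ex Y.
Proof. by move=> iY; apply: (RintegralZl c measurableT iY). Qed.

Lemma Ex_cst c : Ex (fun=> c) = c.
Proof.
rewrite /Ex integral_cst//=; have -> : P setT = 1%E by exact: probability_setT.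
by rewrite mule1.
Qed.

Lemma Ex_sum (J : Type) (s : seq J) (Y : J -> T -> R) :
  (forall j, L1 P (Y j)) ->
  Ex (fun w => \sum_(j <- s) Y j w) = \sum_(j <- s) Ex (Y j).
Proof.
move=> h; elim: s => [|j s IH].
  rewrite big_nil (_ : (fun w => _) = fun=> 0) ?Ex_cst//.
  by apply/funext => w; rewrite big_nil.
rewrite big_cons -IH -ExD//; last by apply: L1_sum.
by congr Ex; apply/funext => w; rewrite big_cons.
Qed.

Lemma Ex_le Y Z : L1 P Y -> L1 P Z -> (forall w, Y w <= Z w) -> Ex Y <= Ex Z.
Proof. by move=> iY iZ h; apply: (le_Rintegral measurableT iY iZ) => w _. Qed.

End SquareIntegrable.

(** * Co-coercivity of the gradient block by block *)

Section Coercivity.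
Context {R : realType} {N : nat} {d : 'I_N -> nat} {n : nat}.
Variables (f : bvec R d -> R) (Lf : R).
Hypothesis df : forall x, differentiable f x.
Hypothesis cf : convex_function setT f.
Hypothesis lip : block_lipschitz_grad n f Lf.
Hypothesis nN : (1 <= n <= N)%N.

(** The Lipschitz assumption speaks of index sets of size n; every single block lies in one of them
    and inherits the constant. *)
Lemma draw_containing (i : 'I_N) : exists2 J : {set 'I_N}, #|J| = n & i \in J.
Proof.
case/andP: nN => n1 nN'.
have : (0 < #|[set S : {set 'I_N} | (#|S| == n) && (i \in S)]%SET|)%N.
  by rewrite card_draws_containing// bin_gt0 -!subn1 leq_sub2r.
by move=> /card_gt0P [J]; rewrite inE => /andP[/eqP Jn iJ]; exists J.
Qed.

Lemma padv_sub (i : 'I_N) (J : {set 'I_N}) (z : bvec R d) : i \in J ->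
  padv J (padv [set i]%SET z) = padv [set i]%SET z.
Proof.
move=> iJ; apply/mxcolP => j; rewrite !submxcol_padv inE.
by case: eqVneq => [->|]; rewrite ?iJ//; case: ifP.
Qed.

Lemma dotv_padv1 (i : 'I_N) (x z : bvec R d) :
  dotv x (padv [set i]%SET z) = dotv (submxcol x i) (submxcol z i).
Proof. by rewrite dotv_padv dotv_subvec big_set1. Qed.

Lemma block_descent1 x z (i : 'I_N) :
  f (x + padv [set i]%SET z) <= f x + dotv (submxcol (grad f x) i) (submxcol z i)
    + Lf / 2 * dotv (submxcol z i) (submxcol z i).
Proof.
have [J Jn iJ] := draw_containing i.
have := block_descent x df lip Jn (padv_sub z iJ).
by rewrite dotv_padv1 dotv_padv1 submxcol_padv inE eqxx.
Qed.

(* Co-coercivity: minimise the Bregman distance of f along one block. *)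
Lemma grad_block_bound x y (i : 'I_N) (L : R) : 0 < L -> Lf <= L ->
  dotv (submxcol (grad f x - grad f y) i) (submxcol (grad f x - grad f y) i)
  <= 2 * L * (f x - f y - dotv (grad f y) (x - y)).
Proof.
move=> L0 LL; set g := grad f x - grad f y.
have h1 := block_descent1 x (- L^-1 *: g) i.
set x' := x + _ in h1.
have h2 := gradient_inequality y x' df cf.
have e : dotv (grad f y) (x' - y) = dotv (grad f y) (x - y)
    - L^-1 * dotv (submxcol (grad f y) i) (submxcol g i).
  have -> : x' - y = (x - y) + padv [set i]%SET (- L^-1 *: g) by rewrite /x' addrAC.
  by rewrite dotvDr dotv_padv1 submxcolZ dotvZr mulNr.
rewrite e in h2; rewrite !submxcolZ !dotvZr dotvZl in h1.
have gE : dotv (submxcol g i) (submxcol g i) = dotv (submxcol (grad f x) i) (submxcol g i)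
    - dotv (submxcol (grad f y) i) (submxcol g i).
  by rewrite -dotvBl -submxcolB.
have G0 := dotv_ge0 (submxcol g i).
set G := dotv (submxcol g i) (submxcol g i) in gE G0 h1 *.
set l := L^-1 in h1 h2.
have lL : l * L = 1 by rewrite /l mulVf// gt_eqF.
have l0 : 0 < l by rewrite invr_gt0.
have h3 : Lf / 2 * (- l * (- l * G)) <= l / 2 * G.
  have -> : l / 2 * G = L / 2 * (- l * (- l * G)).
    have -> : L / 2 * (- l * (- l * G)) = (l * L) * (l / 2 * G) by ring.
    by rewrite lL mul1r.
  rewrite ler_wpM2r//; last by rewrite ler_pM2r.
  by rewrite mulrA mulrNN; rewrite !mulr_ge0// ltW.
have h4 : l / 2 * G <= f x - f y - dotv (grad f y) (x - y) by rewrite mulNr in h1; nra.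
have -> : G = 2 * L * (l / 2 * G).
  have -> : 2 * L * (l / 2 * G) = (l * L) * G by field.
  by rewrite lL mul1r.
by rewrite ler_pM2l// mulr_gt0.
Qed.

End Coercivity.

(** * The iterates of the algorithm *)

Section Algorithm.
Context {R : realType} {dsp : measure_display} {T : measurableType dsp}.
Variable P : probability T R.
Context {N : nat} {d : 'I_N -> nat} {m n : nat}.
Variables (A : 'M[R]_(m, \sum_i d i)) (b : 'cV[R]_m).
Variables (X : forall i : 'I_N, set 'cV[R]_(d i)).
Variable u : forall i : 'I_N, 'cV[R]_(d i) -> \bar R.
Arguments u : clear implicits.
Variables (f : bvec R d -> R) (Lf sigma rho : R) (alpha : nat -> R).
Variables (Phat : 'M[R]_(\sum_i d i)) (x0 : bvec R d).
Variables (I : nat -> T -> {set 'I_N}) (G x : nat -> T -> bvec R d).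
Variables (r lam : nat -> T -> 'cV[R]_m) (xs : bvec R d) (ls : 'cV[R]_m).
Let F := objective f u.
Let theta : R := n%:R / N%:R.
Hypothesis H1 : convex_composite X f u.
Hypothesis H2 : primal_dual_solution A b X F xs ls.
Hypothesis H3 : block_lipschitz_grad n f Lf.
Hypothesis H4 : unbiased_bounded_variance P f x G sigma.
Hypothesis Hn : (1 <= n <= N)%N.
Hypothesis Hrho : 0 < rho.
Hypothesis Halpha : forall k, 0 < alpha k.
Hypothesis HPhat : psd Phat /\ block_diagonal Phat.
Hypothesis Hx0 : prodset X x0 /\ (F x0 < +oo)%E.
Hypothesis Halg : rpdbus P n A b X u rho alpha Phat x0 0 I G x r lam.
Hypothesis HPhat_ge : loewner_ge Phat (Lf%:M + rho *: (A^T *m A)).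
Hypothesis Hfeas0 : A *m x0 = b.

Let Q := Phat - rho *: (A^T *m A).

Lemma theta01 : 0 < theta <= 1.
Proof.
case/andP: Hn => n1 nN; have N0 : (0 < N)%N by exact: leq_trans nN.
by rewrite divr_gt0 ?ltr0n//= ler_pdivrMr ?ltr0n// mul1r ler_nat.
Qed.

Lemma f_differentiable x' : differentiable f x'.
Proof. by case: H1. Qed.

Lemma f_convex : convex_function setT f.
Proof. by case: H1. Qed.

Lemma x0_edom : edom u x0.
Proof. by case: Hx0 => _ /(objective_edom H1). Qed.

(** If F xs were +oo, the optimality condition at x0, where F is finite, would compare 0 with
    -oo. *)
Lemma xs_edom : edom u xs.
Proof.
case: H2 => _ _ h; case: Hx0 => X0 F0.
apply: (objective_edom H1); rewrite ltey; apply/negP => /eqP Fs.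
have := h _ X0; rewrite /F Fs (objective_fin f x0_edom).
by rewrite /= leeNy_eq.
Qed.

Lemma xs_feasible : A *m xs = b. Proof. by case: H2. Qed.

(* The primal-dual optimality condition, in terms of real numbers. *)
Lemma gap_ge0 y : edom u y -> prodset X y ->
  dotv ls (A *m y - b) <= realF f u y - realF f u xs.
Proof.
move=> ey Xy; case: H2 => _ Axs h; have := h _ Xy.
rewrite /F (objective_fin f ey) (objective_fin f xs_edom) -!EFinB lee_fin subr_ge0.
by rewrite -dotv_mull mulmxBr Axs dotvC.
Qed.

Lemma iterates k w :
  [/\ edom u (x k w), prodset X (x k w) & r k w = A *m x k w - b].
Proof.
case: Halg => a1 _ a3 a4; elim: k => [|k [ex Xx rx]].
  by case: (a1 w) => -> -> _; split=> //; [exact: x0_edom|case: Hx0].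
have [h1 h2 h3 _] := a4 k w; have [[cJ _ _] _] := a3 k.
rewrite rx in h2 h3.
case: H2 => Xs _ _; case: HPhat => HP HB.
split.
- exact: (step_edom H1 HB ex xs_edom Xs h1 h2).
- exact: (step_X Xx h1 h2).
rewrite h3 -subvecB mul_subcols (padv_step h1) mulmxBr.
by apply/colP => i; rewrite !mxE; ring.
Qed.

Let phi k w := realF f u (x k w) - realF f u xs.
Let delta k w := G k w - grad f (x k w).
Let g k w := G k w - A^T *m (lam k w - rho *: r k w).
Let M k w := \sum_i ((i \in I k w)%:R - theta) * blockgap u (g k w) (x k w) xs i
     + theta * dotv (delta k w) (x k w - xs).

Lemma phi_ge k w : dotv ls (r k w) <= phi k w.
Proof. by have [ex Xx ->] := iterates k w; exact: gap_ge0. Qed.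

Lemma algorithm_step k w :
  phi k.+1 w - (1 - theta) * phi k w + M k w
  - dotv (lam k w) (r k.+1 w) + (1 - theta) * dotv (lam k w) (r k w)
  + rho * dotv (r k.+1 w) (r k.+1 w) - (1 - theta) * rho * dotv (r k w) (r k w)
  + 2^-1 * (wnorm2 Q (x k.+1 w - xs) - wnorm2 Q (x k w - xs))
  + (2 * alpha k)^-1 * (dotv (x k.+1 w - xs) (x k.+1 w - xs)
       - dotv (x k w - xs) (x k w - xs))
  - alpha k / 2 * dotv (delta k w) (delta k w) <= 0.
Proof.
case: Halg => _ _ a3 a4; have [h1 h2 _ _] := a4 k w; have [[cJ _ _] _] := a3 k.
have [ex Xx rx] := iterates k w; have [_ _ rx'] := iterates k.+1 w.
case: H2 => Xs _ _; case: HPhat => HP HB.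
rewrite rx in h2.
have := step_descent H1 H3 HP HB HPhat_ge (cJ w) (Halpha k) ex Xx xs_edom Xs xs_feasible h1 h2.
by rewrite -rx -rx'.
Qed.

(** The Lipschitz bound forces Lf >= 0 as soon as some displacement is nonzero. All blocks might
    have dimension 0, hence the form as a product. *)
Lemma Lf_dotv_ge0 (z : bvec R d) : 0 <= Lf * dotv z z.
Proof.
case/andP: Hn => n1 nN.
rewrite dotv_blocks mulr_sumr; apply: sumr_ge0 => i _.
have [J Jn iJ] := draw_containing Hn i.
have := H3 Jn 0 (padv [set i]%SET z).
rewrite -[subvec J (padv _ _)]subvec_padv (padv_sub z iJ) => h.
have h0 := le_trans (enorm_ge0 _) h.
have e : enorm (subvec J (padv [set i]%SET z)) ^+ 2
    = dotv (submxcol z i) (submxcol z i).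
  rewrite enorm_sqr -dotv_padv (padv_sub z iJ) dotv_padv1.
  by rewrite submxcol_padv inE eqxx.
by rewrite -e expr2 mulrA mulr_ge0// enorm_ge0.
Qed.

Lemma wnormQ_ge0 z : 0 <= wnorm2 Q z.
Proof.
have L0 := Lf_dotv_ge0 z; case: HPhat_ge => _ /(_ z).
rewrite wnorm2BW wnorm2DW wnorm2_scalar /Q wnorm2BW; lra.
Qed.

(** A positive majorant of Lf, so that a gradient step of length 1 / L makes sense. *)
Let L := Num.max Lf 1.
Let L_gt0 : 0 < L. Proof. by rewrite lt_max ltr01 orbT. Qed.
Let Lf_le : Lf <= L. Proof. by rewrite le_max lexx. Qed.

(* Optimality tested along a single block gives a quadratic minorant of u_i. *)
Lemma u_lower_bound y i : edom u y -> prodset X y ->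
  dotv (submxcol (y - xs) i) (submxcol (A^T *m ls - grad f xs) i)
  - L / 2 * dotv (submxcol (y - xs) i) (submxcol (y - xs) i)
  <= realu u i (submxcol y i) - realu u i (submxcol xs i).
Proof.
move=> ey Xy; case: H2 => Xs _ _.
set z := padv [set i]%SET (y - xs).
have zE j : submxcol (xs + z) j = if j == i then submxcol y j else submxcol xs j.
  rewrite submxcolD submxcol_padv inE submxcolB.
  by case: ifP; rewrite ?addr0// addrC subrK.
have ez : edom u (xs + z) by move=> j; rewrite zE; case: ifP => _; [exact: ey|exact: xs_edom].
have Xz : prodset X (xs + z) by move=> j; rewrite zE; case: ifP.
have := gap_ge0 ez Xz; rewrite /realF -xs_feasible -mulmxBr [xs + z - xs]addrAC subrr add0r.
have := block_descent1 f_differentiable H3 Hn xs (y - xs) i; rewrite -/z => h1.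
have -> : \sum_j realu u j (submxcol (xs + z) j) =
   \sum_j realu u j (submxcol xs j) + (realu u i (submxcol y i) - realu u i (submxcol xs i)).
  rewrite (bigD1 i)//= [X in _ = X + _](bigD1 i)//= zE eqxx.
  rewrite (eq_bigr (fun j => realu u j (submxcol xs j))); first by ring.
  by move=> j ji; rewrite zE (negbTE ji).
rewrite dotv_mulr /z dotv_padv1 (submxcolB (A^T *m ls)) dotvBr (dotvC _ (submxcol (A^T *m ls) i)).
rewrite (dotvC _ (submxcol (grad f xs) i)).
have D0 := dotv_ge0 (submxcol (y - xs) i).
have := ler_wpM2r D0 Lf_le.
lra.
Qed.

Lemma x_random k : random_vec (x k).
Proof. by case: Halg => _ a2 _ _; case: (a2 k). Qed.

Lemma delta_L1 k i : L1 P (fun w => delta k w i 0).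
Proof. by have [h1 _] := H4 k; case: (h1 i). Qed.

Lemma delta_random k : random_vec (delta k).
Proof. by move=> i; apply: L1_measurable; exact: delta_L1. Qed.

Lemma delta_expectation k :
  (\int[P]_w (dotv (delta k w) (delta k w))%:E <= (sigma ^+ 2)%:E)%E.
Proof.
have [_] := H4 k; rewrite unlock; apply: le_trans.
rewrite le_eqVlt; apply/orP; left; apply/eqP; apply: eq_integral => w _.
by rewrite /= enorm_sqr.
Qed.

Lemma delta_dotv_L1 k : L1 P (fun w => dotv (delta k w) (delta k w)).
Proof.
apply: L1_finite_expectation.
- exact: measurable_dotv (@delta_random k) (@delta_random k).
- by move=> w; exact: dotv_ge0.
- exact: le_lt_trans (delta_expectation k) (ltry _).
Qed.

Lemma delta_sqint k : sqint P (delta k).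
Proof. exact: sqint_of_dotv (@delta_random k) (delta_dotv_L1 k). Qed.

Lemma Ex_delta k : Ex P (fun w => dotv (delta k w) (delta k w)) <= sigma ^+ 2.
Proof. by rewrite -lee_fin -ExE ?delta_expectation//; exact: delta_dotv_L1. Qed.

Lemma realF_measurable k : measurable_fun setT (fun w => realF f u (x k w)).
Proof.
apply: measurable_funD.
  apply: continuous_random; first exact: x_random.
  by move=> z; apply: differentiable_continuous; exact: f_differentiable.
apply: measurable_sum => i.
have [_ _ _ /(_ i)[_ lu _]] := H1.
have := lower_semicontinuous_random (random_submxcol (i := i) (@x_random k)) lu.
by move=> /(measurableT_comp (fine_measurable measurableT)); apply.
Qed.

Lemma phi_measurable k : measurable_fun setT (phi k).
Proof. by apply: measurable_funB => //; exact: realF_measurable. Qed.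

Let integrable_at k := [/\ sqint P (x k), sqint P (lam k) & L1 P (phi k)].

Lemma r_sqint k : sqint P (x k) -> sqint P (r k).
Proof.
move=> hx; rewrite (_ : r k = fun w => A *m x k w - b).
  by apply: sqintB; [exact: sqintM|exact: sqint_cst].
by apply/funext => w; have [_ _ ->] := iterates k w.
Qed.

Lemma dx_sqint k : sqint P (x k) -> sqint P (fun w => x k w - xs).
Proof. by move=> hx; apply: sqintB => //; exact: sqint_cst. Qed.

Let minorant k i w :=
  dotv (submxcol (x k w - xs) i) (submxcol (A^T *m ls - grad f xs) i)
  - L / 2 * dotv (submxcol (x k w - xs) i) (submxcol (x k w - xs) i).

Let dux k i w := realu u i (submxcol (x k w) i) - realu u i (submxcol xs i).

Lemma minorant_L1 k i : sqint P (x k) -> L1 P (minorant k i).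
Proof.
move=> /dx_sqint hx; have hi := sqint_submxcol (i := i) hx.
apply: L1B; first by apply: sqint_dotv => //; exact: sqint_cst.
by apply: L1Z; exact: sqint_dotv.
Qed.

Lemma minorant_le k i w : minorant k i w <= dux k i w.
Proof. by have [ex Xx _] := iterates k w; exact: u_lower_bound. Qed.

Lemma phiE k w : phi k w = f (x k w) - f xs + \sum_i dux k i w.
Proof. by rewrite /phi /realF /dux sumrB; ring. Qed.

Lemma bregman_le k w :
  f (x k w) - f xs - dotv (grad f xs) (x k w - xs)
  <= phi k w - \sum_i minorant k i w - dotv (grad f xs) (x k w - xs).
Proof.
rewrite phiE; have : \sum_i minorant k i w <= \sum_i dux k i w.
  by apply: ler_sum => i _; exact: minorant_le.
lra.
Qed.

Lemma grad_dx_L1 k : sqint P (x k) -> L1 P (fun w => dotv (grad f xs) (x k w - xs)).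
Proof. by move=> hx; apply: sqint_dotv; [exact: sqint_cst|exact: dx_sqint]. Qed.

(** Each u_i term has an integrable quadratic minorant, and f is above its linearisation at xs.
    Hence one term is at most phi minus the lower bounds of all the others. *)
Lemma dux_L1 k i : sqint P (x k) -> L1 P (phi k) -> L1 P (dux k i).
Proof.
move=> hx hp.
apply: (@L1_sandwich _ _ _ _ _ (minorant k i) (fun w => phi k w
   - dotv (grad f xs) (x k w - xs) - \sum_(j | j != i) minorant k j w)).
- apply: measurable_funB => //; have [_ _ _ /(_ i)[_ lu _]] := H1.
  have := lower_semicontinuous_random (random_submxcol (i := i) (@x_random k)) lu.
  by move=> /(measurableT_comp (fine_measurable measurableT)); apply.
- exact: minorant_L1.
- apply: L1B; first by apply: L1B => //; exact: grad_dx_L1.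
  by apply: L1_sum => j _; exact: minorant_L1.
move=> w; rewrite minorant_le /= phiE (bigD1 i)//=.
have := gradient_inequality xs (x k w) f_differentiable f_convex.
have : \sum_(j | j != i) minorant k j w <= \sum_(j | j != i) dux k j w.
  by apply: ler_sum => j _; exact: minorant_le.
lra.
Qed.

Lemma grad_random k : random_vec (fun w => grad f (x k w)).
Proof.
rewrite (_ : (fun w => _) = fun w => G k w - delta k w).
  apply: random_vecB; last exact: delta_random.
  by case: Halg => _ a2 _ _; case: (a2 k).
by apply/funext => w; rewrite /delta opprB addrC subrK.
Qed.

(** The iterate differs from xs in all blocks, while the Lipschitz assumption compares gradients
    only across moves in n blocks. Co-coercivity bounds each block of the gradient difference by the
    Bregman distance, which [bregman_le] bounds by an integrable function. *)
Lemma grad_sqint k : sqint P (x k) -> L1 P (phi k) ->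
  sqint P (fun w => grad f (x k w)).
Proof.
move=> hx hp.
have h : sqint P (fun w => grad f (x k w) - grad f xs).
  have mg : random_vec (fun w => grad f (x k w) - grad f xs).
    by apply: random_vecB; [exact: grad_random|exact: random_vec_cst].
  apply: sqint_of_dotv => //.
  apply: (@L1_sandwich _ _ _ _ _ (fun=> 0) (fun w => \sum_(i < N) (2 * L * (phi k w
     - \sum_i minorant k i w - dotv (grad f xs) (x k w - xs))))).
  - exact: measurable_dotv.
  - exact: L1_cst.
  - apply: L1_sum => i _; apply: L1Z; apply: L1B; last exact: grad_dx_L1.
    by apply: L1B => //; apply: L1_sum => j _; exact: minorant_L1.
  move=> w; rewrite dotv_ge0/= dotv_blocks; apply: ler_sum => i _.
  apply: le_trans (grad_block_bound f_differentiable f_convex H3 Hn (x k w) xs i L_gt0 Lf_le) _.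
  by rewrite ler_wpM2l ?bregman_le// mulr_ge0// ltW.
rewrite (_ : (fun w => _) = fun w => (grad f (x k w) - grad f xs) + grad f xs).
  by apply: sqintD => //; exact: sqint_cst.
by apply/funext => w; rewrite subrK.
Qed.

Lemma g_sqint k : integrable_at k -> sqint P (g k).
Proof.
move=> [hx hl hp]; apply: sqintB.
  rewrite (_ : G k = fun w => delta k w + grad f (x k w)).
    by apply: sqintD; [exact: delta_sqint|exact: grad_sqint].
  by apply/funext => w; rewrite /delta subrK.
by apply: sqintM; apply: sqintB => //; apply: sqintZ; exact: r_sqint.
Qed.

Lemma blockgap_L1 k i : integrable_at k -> L1 P (fun w => blockgap u (g k w) (x k w) xs i).
Proof.
move=> hk; have [hx _ hp] := hk; apply: L1D; first exact: dux_L1.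
by apply: sqint_dotv; apply: sqint_submxcol; [exact: g_sqint|exact: dx_sqint].
Qed.

Lemma draw_blockgap_L1 k i : integrable_at k ->
  L1 P (fun w => ((i \in I k w)%:R - theta) * blockgap u (g k w) (x k w) xs i).
Proof.
move=> hk; have ha := blockgap_L1 i hk.
apply: (L1_le _ (integrable_norm ha)) => [|w].
  apply: measurable_funM; last exact: L1_measurable ha.
  apply: measurable_funB => //; apply: (@draw_measurable _ _ _ P _ n).
  by case: Halg => _ _ /(_ k)[].
rewrite /= normrM ler_piMl//; have /andP[t0 t1] := theta01.
by case: (i \in I k w); rewrite /= ler_norml; apply/andP; split; lra.
Qed.

Lemma delta_dx_L1 k : integrable_at k -> L1 P (fun w => dotv (delta k w) (x k w - xs)).
Proof.
by move=> [hx _ _]; apply: sqint_dotv; [exact: delta_sqint|exact: dx_sqint].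
Qed.

Lemma M_L1 k : integrable_at k -> L1 P (M k).
Proof.
move=> hk; apply: L1D; last by apply: L1Z; exact: delta_dx_L1.
by apply: L1_sum => i _; exact: draw_blockgap_L1.
Qed.

Lemma integrable_at0 : integrable_at 0%N.
Proof.
case: Halg => a1 _ _ _.
have e1 : x 0%N = fun=> x0 by apply/funext => w; case: (a1 w).
have e2 : lam 0%N = fun=> 0 by apply/funext => w; case: (a1 w).
rewrite /integrable_at /phi e1 e2.
split; [exact: sqint_cst|exact: sqint_cst|exact: L1_cst].
Qed.

(** All terms of the step that concern iterate k form the integrable [B]. Since phi >= <ls, r> at k
    + 1, the terms of unknown sign reduce to <ls - lam_k, r_(k+1)>, and absorbing this product in
    rho |r_(k+1)|^2 leaves a bound on |x_(k+1) - xs|^2. The remaining claims follow from that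
    one. *)
Lemma integrable_atS k : integrable_at k -> integrable_at k.+1.
Proof.
move=> hk; have [hx hl hp] := hk; have hr := r_sqint hx; have hdx := dx_sqint hx.
pose B w := (1 - theta) * phi k w - M k w - (1 - theta) * dotv (lam k w) (r k w)
   + (1 - theta) * rho * dotv (r k w) (r k w)
   + 2^-1 * dotv (x k w - xs) (Q *m (x k w - xs))
   + (2 * alpha k)^-1 * dotv (x k w - xs) (x k w - xs)
   + alpha k / 2 * dotv (delta k w) (delta k w).
have iB : L1 P B.
  apply: L1D; last by apply: L1Z; exact: delta_dotv_L1.
  apply: L1D; last by apply: L1Z; exact: sqint_dotv.
  apply: L1D; last by apply: L1Z; apply: sqint_dotv => //; exact: sqintM.
  apply: L1D; last by apply: L1Z; exact: sqint_dotv.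
  apply: L1B; last by apply: L1Z; exact: sqint_dotv.
  by apply: L1B; [exact: L1Z|exact: M_L1].
have step w : phi k.+1 w + rho * dotv (r k.+1 w) (r k.+1 w)
   + (2 * alpha k)^-1 * dotv (x k.+1 w - xs) (x k.+1 w - xs)
   - dotv (lam k w) (r k.+1 w) <= B w.
  have := algorithm_step k w; have := wnormQ_ge0 (x k.+1 w - xs).
  by rewrite /B -wnorm2E; lra.
have hdx' : sqint P (fun w => x k.+1 w - xs).
  have md : random_vec (fun w => x k.+1 w - xs).
    by apply: random_vecB; [exact: x_random|exact: random_vec_cst].
  apply: sqint_of_dotv => //.
  apply: (@L1_sandwich _ _ _ _ _ (fun=> 0) (fun w => 2 * alpha k * (B w
     + (2 * (2 * rho))^-1 * dotv (lam k w - ls) (lam k w - ls)))).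
  - exact: measurable_dotv.
  - exact: L1_cst.
  - apply: L1Z; apply: L1D => //; apply: L1Z.
    by apply: sqint_dotv; apply: sqintB => //; exact: sqint_cst.
  move=> w; rewrite dotv_ge0/= mulrC -ler_pdivrMr ?mulr_gt0// mulrC.
  (* The parameter 2 * rho makes the residual term exactly rho * |r_(k+1)|^2. *)
  have y := young_dotv (r k.+1 w) (lam k w - ls) (mulr_gt0 (ltr0n R 2) Hrho).
  rewrite dotvBr (dotvC _ (lam k w)) (dotvC _ ls) in y.
  have := step w; have := phi_ge k.+1 w.
  have : 2 * rho / 2 * dotv (r k.+1 w) (r k.+1 w) = rho * dotv (r k.+1 w) (r k.+1 w).
    by field.
  lra.
have hx' : sqint P (x k.+1).
  rewrite (_ : x k.+1 = fun w => (x k.+1 w - xs) + xs).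
    by apply: sqintD => //; exact: sqint_cst.
  by apply/funext => w; rewrite subrK.
have hr' := r_sqint hx'.
split=> //.
  case: Halg => _ _ _ a4.
  rewrite (_ : lam k.+1 = fun w => lam k w - ((1 - (N - n)%:R * alpha k.+1
     / (N%:R * alpha k)) * rho) *: r k.+1 w).
    by apply: sqintB => //; exact: sqintZ.
  by apply/funext => w; case: (a4 k w).
apply: (@L1_sandwich _ _ _ _ _ (fun w => dotv ls (r k.+1 w))
   (fun w => B w + dotv (lam k w) (r k.+1 w))).
- exact: phi_measurable.
- by apply: sqint_dotv => //; exact: sqint_cst.
- by apply: L1D => //; exact: sqint_dotv.
move=> w; rewrite phi_ge /=; have := step w.
have := mulr_ge0 (ltW Hrho) (dotv_ge0 (r k.+1 w)).
have : 0 <= (2 * alpha k)^-1 * dotv (x k.+1 w - xs) (x k.+1 w - xs).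
  by rewrite mulr_ge0 ?dotv_ge0// invr_ge0 mulr_ge0// ltW.
lra.
Qed.

Lemma integrable_iterates k : integrable_at k.
Proof. by elim: k => [|k]; [exact: integrable_at0|exact: integrable_atS]. Qed.

Lemma M_centered k : Ex P (M k) = 0.
Proof.
have hk := integrable_iterates k; have hd := delta_dx_L1 hk.
rewrite /M ExD; last 2 first.
- by apply: L1_sum => i _; exact: draw_blockgap_L1.
- exact: L1Z.
rewrite Ex_sum; last by move=> i; exact: draw_blockgap_L1.
rewrite ExZ// big1 ?add0r; last first.
  move=> i _; rewrite /Ex (@integral_factor _ _ _ P (fun w => (i \in I k w)%:R - theta)
    (fun w => blockgap u (g k w) (x k w) xs i)) //.
  - apply: L1B; last exact: L1_cst.
    case: Halg => _ _ /(_ k)[uJ _] _.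
    apply: (@L1_le _ _ _ P _ (fun=> 1)); [exact: draw_measurable uJ|exact: L1_cst|].
    by move=> w; case: (i \in I k w); rewrite /= ?normr1 ?normr0.
  - by apply: L1_measurable; exact: blockgap_L1.
  - move=> E mE; have mY := L1_measurable (blockgap_L1 i hk).
    case: Halg => _ a2 /(_ k)[uJ iJ] _.
    have n0 : (0 < n)%N by case/andP: Hn.
    apply: (draw_centered i n0 uJ iJ); last first.
      by rewrite -[X in measurable X]setTI; exact: mY.
    (* The generators include the events of x k, lam k, r k and G k, so [g k], and with it the block
       gap, is measurable for the history from which the draw is independent. *)
    rewrite /history; set gen := (X in <<s X >>).
    have sx : random_vec (x k : g_sigma_algebraType gen -> bvec R d).
      apply: random_vec_sub => E' hE; left; exists k => //; exact: Or41.
    have sl : random_vec (lam k : g_sigma_algebraType gen -> 'cV[R]_m).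
      apply: random_vec_sub => E' hE; left; exists k => //; exact: Or42.
    have sr : random_vec (r k : g_sigma_algebraType gen -> 'cV[R]_m).
      apply: random_vec_sub => E' hE; left; exists k => //; exact: Or43.
    have sG : random_vec (G k : g_sigma_algebraType gen -> bvec R d).
      apply: random_vec_sub => E' hE; left; exists k => //; exact: Or44.
    have sg : random_vec (g k : g_sigma_algebraType gen -> bvec R d).
      by apply: random_vecB => //; apply: random_vecM; apply: random_vecB => //; apply: random_vecZ.
    have [_ _ _ /(_ i)[_ lu _]] := H1.
    have := measurable_blockgap xs lu sg sx measurableT mE.
    by rewrite setTI.
  - exact: draw_blockgap_L1.
(* The noise is centered given x k, hence orthogonal to each coordinate of x k - xs. *)
rewrite (_ : (fun w => _) = fun w => \sum_j delta k w j 0 * (x k w j 0 - xs j 0)); last first.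
  by apply/funext => w; rewrite dotvE; apply: eq_bigr => j _; rewrite !mxE.
have hj j : L1 P (fun w => delta k w j 0 * (x k w j 0 - xs j 0)).
  have [hx _ _] := hk.
  have [hm h2] := dx_sqint hx j.
  have h := L2_mul (delta_sqint k j) (conj hm h2).
  move: h; rewrite (_ : (fun w => _) = fun w => delta k w j 0 * (x k w j 0 - xs j 0))//.
  by apply/funext => w; rewrite !mxE.
rewrite Ex_sum// big1 ?mulr0// => j _; have [h1 _] := H4 k.
by rewrite /Ex (cond_centered (@x_random k) (h1 j) (hj j)).
Qed.

Lemma lam_step k w : lam k.+1 w =
  lam k w - ((1 - (1 - theta) * alpha k.+1 / alpha k) * rho) *: r k.+1 w.
Proof.
case: Halg => _ _ _ /(_ k w)[_ _ _ ->]; congr (_ - (_ - _) * _ *: _).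
case/andP: Hn => n1 nN; rewrite /theta natrB//; field.
by rewrite gt_eqF//= pnatr_eq0 -lt0n (leq_trans n1).
Qed.

(** * The averaged point and its expected errors *)

Section Averages.
Variables (t : nat) (S : R).
Hypothesis alpha_dec : forall k, alpha k.+1 <= alpha k.
Hypothesis adm : admissible theta alpha t S.

Let W := totalweight theta alpha t.
Let y w := xhat theta alpha x t w.
Let weight k : R := if (k <= t)%N then theta * alpha k else alpha k.

Lemma weighted_sum (V : lmodType R) (v : nat -> V) :
  \sum_(1 <= k < t.+2) weight k *: v k
  = alpha t.+1 *: v t.+1 + theta *: \sum_(1 <= k < t.+1) alpha k *: v k.
Proof.
rewrite big_nat_recr//= addrC /weight ltnn; congr (_ + _).
rewrite scaler_sumr; apply: eq_big_nat => k /andP[_ kt].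
by rewrite -ltnS kt scalerA.
Qed.

Lemma weightedR_sum (v : nat -> R) :
  \sum_(1 <= k < t.+2) weight k * v k
  = alpha t.+1 * v t.+1 + theta * \sum_(1 <= k < t.+1) alpha k * v k.
Proof. exact: (weighted_sum (v : nat -> R^o)). Qed.

Lemma weight_total : \sum_(1 <= k < t.+2) weight k = W.
Proof.
transitivity (\sum_(1 <= k < t.+2) weight k * 1).
  by apply: eq_bigr => k _; rewrite mulr1.
rewrite (weightedR_sum (fun=> 1)) mulr1; congr (_ + _ * _).
by apply: eq_bigr => k _; rewrite mulr1.
Qed.

Lemma weight_gt0 k : 0 < weight k.
Proof.
have /andP[t0 _] := theta01.
rewrite /weight; case: ifP => _; last exact: Halpha.
by apply: mulr_gt0 => //; exact: Halpha.
Qed.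

Lemma average_jensen w : [/\ 0 < W, edom u (y w), prodset X (y w) &
  W * (realF f u (y w) - realF f u xs)
  <= alpha t.+1 * phi t.+1 w + theta * \sum_(1 <= k < t.+1) alpha k * phi k w].
Proof.
have ex k : edom u (x k w) by case: (iterates k w).
have Xx k : prodset X (x k w) by case: (iterates k w).
have := realF_jensen H1 t weight_gt0 ex Xx.
rewrite /= weight_total weighted_sum => -[W0 ey Xy h]; split=> //.
rewrite -weightedR_sum /phi.
under eq_bigr do rewrite mulrBr.
by rewrite sumrB -mulr_suml weight_total mulrBr lerD2r.
Qed.

Lemma average_residual w : W *: (A *m y w - b) =
  alpha t.+1 *: r t.+1 w + theta *: \sum_(1 <= k < t.+1) alpha k *: r k w.
Proof.
have [W0 _ _ _] := average_jensen w.
rewrite -(weighted_sum (fun k => r k w)) scalerBr scalemxAr.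
have -> : W *: y w = \sum_(1 <= k < t.+2) weight k *: x k w.
  rewrite (weighted_sum (fun k => x k w)) /y /xhat -/W -/(totalweight theta alpha t) -/W.
  by rewrite scalerA divff ?scale1r// gt_eqF.
rewrite mulmx_sumr -weight_total scaler_suml -sumrB; apply: eq_bigr => k _.
by have [_ _ ->] := iterates k w; rewrite scalerBr scalemxAr.
Qed.

Let K := (1 - theta) * alpha 0%N * (realF f u x0 - realF f u xs)
  + 2^-1 * (alpha 0%N * wnorm2 Q (x0 - xs) + dotv (x0 - xs) (x0 - xs)).
Let D := S * alpha 0%N / (2 * rho)
  * Num.max ((1 + enorm ls) ^+ 2) (4 * enorm ls ^+ 2).
Let Z w := K + \sum_(k < t.+1) (alpha k ^+ 2 / 2 * dotv (delta k w) (delta k w)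
  - alpha k * M k w) + D.

Lemma error_bound w : W * `|realF f u (y w) - realF f u xs| <= Z w
  /\ W * enorm (A *m y w - b) <= Z w.
Proof.
case: (Halg) => /(_ w)[e1 e2 e3] _ _ _.
have [W0 ey Xy h] := average_jensen w.
have := @pathwise_bound _ _ theta rho alpha (phi ^~ w) (M ^~ w)
  (fun k => dotv (delta k w) (delta k w)) (fun k => wnorm2 Q (x k w - xs))
  (fun k => dotv (x k w - xs) (x k w - xs)) (r ^~ w) (lam ^~ w) ls t S
  theta01 Hrho Halpha alpha_dec.
rewrite /= /phi e1 => pb; apply: pb => //.
- by move=> k; exact: wnormQ_ge0.
- by move=> k; exact: dotv_ge0.
- by rewrite e2 Hfeas0 subrr.
- by move=> k; exact: lam_step.
- by move=> k; exact: phi_ge.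
- by move=> k; exact: algorithm_step.
- exact: average_residual.
- exact: gap_ge0.
Qed.

Lemma Z_L1 : L1 P Z.
Proof.
apply: L1D; last exact: L1_cst.
apply: L1D; first exact: L1_cst.
apply: L1_sum => k _; apply: L1B; apply: L1Z; first exact: delta_dotv_L1.
by apply: M_L1; exact: integrable_iterates.
Qed.

Let Zbar := K + \sum_(k < t.+1) alpha k ^+ 2 / 2 * sigma ^+ 2 + D.

Lemma Ex_Z : Ex P Z <= Zbar.
Proof.
have hM k : L1 P (M k) by apply: M_L1; exact: integrable_iterates.
have hk (k : nat) : L1 P (fun w => alpha k ^+ 2 / 2 * dotv (delta k w) (delta k w)
    - alpha k * M k w).
  by apply: L1B; apply: L1Z => //; exact: delta_dotv_L1.
have hs : L1 P (fun w => \sum_(k < t.+1) (alpha k ^+ 2 / 2 * dotv (delta k w) (delta k w)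
  - alpha k * M k w)) by apply: L1_sum => k _.
rewrite /Z ExD; [|by apply: L1D => //; exact: L1_cst|exact: L1_cst].
rewrite ExD//; last exact: L1_cst.
rewrite !Ex_cst lerD2r lerD2l Ex_sum//; apply: ler_sum => k _.
rewrite (_ : (fun w => _) = fun w => alpha k ^+ 2 / 2 * dotv (delta k w) (delta k w)
  + - alpha k * M k w); last by apply/funext => w; rewrite mulNr.
rewrite ExD; [|by apply: L1Z; exact: delta_dotv_L1|exact: L1Z].
rewrite !ExZ//; last exact: delta_dotv_L1.
rewrite M_centered mulr0 addr0 ler_wpM2l ?Ex_delta//.
by rewrite divr_ge0 ?sqr_ge0.
Qed.

Lemma average_random : random_vec y.
Proof.
have xr k : random_vec (x k) by exact: x_random.
apply: random_vecZ; apply: random_vecD; apply: random_vecZ => //.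
move=> i; rewrite (_ : (fun w => _) = fun w => \sum_(1 <= k < t.+1) alpha k * x k w i 0).
  by apply: measurable_sum => k; apply: measurable_funM => //; exact: xr.
by apply/funext => w; rewrite summxE; apply: eq_bigr => k _; rewrite mxE.
Qed.

Lemma expected_error : (max_error P A b F xs y <= (Zbar / W)%:E)%E.
Proof.
have [W0 _ _ _] : [/\ 0 < W, True, True & True].
  split=> //; rewrite /W /totalweight; have /andP[t0 _] := theta01.
  by apply: ltr_wpDr => //; rewrite mulr_ge0 ?(ltW t0)//; apply: sumr_ge0 => k _; exact: ltW.
have iZ : L1 P (fun w => W^-1 * Z w) by apply: L1Z; exact: Z_L1.
have EZ : Ex P (fun w => W^-1 * Z w) <= Zbar / W.
  by rewrite ExZ ?Z_L1// mulrC ler_pM2r ?invr_gt0//; exact: Ex_Z.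
pose e1 w := realF f u (y w) - realF f u xs.
have b1 w : `|e1 w| <= W^-1 * Z w.
  by rewrite ler_pdivlMl//; case: (error_bound w).
have b2 w : enorm (A *m y w - b) <= W^-1 * Z w.
  by rewrite ler_pdivlMl//; case: (error_bound w).
have m1 : measurable_fun setT e1.
  apply: measurable_funB => //; apply: measurable_funD.
    apply: continuous_random; first exact: average_random.
    by move=> z; apply: differentiable_continuous; exact: f_differentiable.
  apply: measurable_sum => i; have [_ _ _ /(_ i)[_ lu _]] := H1.
  have := lower_semicontinuous_random (random_submxcol (i := i) average_random) lu.
  by move=> /(measurableT_comp (fine_measurable measurableT)); apply.
have i1 : L1 P e1 by exact: (L1_le m1 iZ b1).
have m2 : measurable_fun setT (fun w => enorm (A *m y w - b)).
  have rr : random_vec (fun w => A *m y w - b).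
    by apply: random_vecB; [apply: random_vecM; exact: average_random|exact: random_vec_cst].
  have := measurable_dotv rr rr.
  by move=> /(measurableT_comp (continuous_measurable_fun (@sqrt_continuous R))); apply.
have i2 : L1 P (fun w => enorm (A *m y w - b)).
  by apply: (L1_le m2 iZ) => w; rewrite ger0_norm ?enorm_ge0.
rewrite /max_error ge_max; apply/andP; split.
  have -> : (\int[P]_w (F (y w) - F xs) = \int[P]_w (e1 w)%:E)%E.
    apply: eq_integral => w _; have [_ ey _ _] := average_jensen w.
    by rewrite /F (objective_fin f ey) (objective_fin f xs_edom).
  rewrite ExE// lee_fin; apply: le_trans EZ; rewrite ler_norml; apply/andP; split.
    rewrite lerNl -mulN1r -ExZ//; apply: Ex_le => //; first exact: L1Z.
    by move=> w; rewrite mulN1r; have := b1 w; rewrite ler_norml lerNl => /andP[].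
  by apply: Ex_le => // w; apply: le_trans (b1 w); exact: ler_norm.
rewrite unlock ExE// lee_fin; apply: le_trans EZ; exact: Ex_le.
Qed.

Lemma K_ge0 : 0 <= K.
Proof.
have := gap_ge0 x0_edom Hx0.1; rewrite Hfeas0 subrr dotv0 => h.
have /andP[_ t1] := theta01.
rewrite /K addr_ge0//; first by rewrite !mulr_ge0 ?subr_ge0 ?(ltW (Halpha 0))// -subr_ge0.
by rewrite mulr_ge0// addr_ge0 ?dotv_ge0// mulr_ge0 ?(ltW (Halpha 0))// wnormQ_ge0.
Qed.

(** Dividing by W = S * B, the dual term, which carries the factor S, becomes exactly the one of
    [C0] over B. The other terms are nonnegative and only gain from S >= 1. *)
Lemma expected_rate (V : R) (B := theta * alpha 0%N * Num.sqrt t%:R) :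
  (0 < t)%N -> S = W / B -> \sum_(k < t.+1) alpha k ^+ 2 / 2 <= V ->
  (max_error P A b F xs y
   <= C0 A F rho theta (alpha 0%N) Phat x0 xs ls * (B^-1)%:E
      + (V * sigma ^+ 2 / B)%:E)%E.
Proof.
move=> t0 SE hV; have /andP[th0 _] := theta01.
have a0 : 0 < alpha 0%N by exact: Halpha.
have B0 : 0 < B by apply: mulr_gt0; [exact: mulr_gt0|exact: sqrt_nat_gt0].
have S1 : 1 <= S by case: adm => hh [c1 [c2 []]].
have S0 : 0 < S by lra.
have WE : W = S * B by rewrite SE divfK// gt_eqF.
apply: (le_trans expected_error).
pose D' := alpha 0%N / (2 * rho) * Num.max ((1 + enorm ls) ^+ 2) (4 * enorm ls ^+ 2).
have -> : C0 A F rho theta (alpha 0%N) Phat x0 xs ls = (K + D')%:E.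
  rewrite /C0 /F (objective_fin f x0_edom) (objective_fin f xs_edom).
  rewrite -EFinB -EFinM -!EFinD; congr (_ + _ * _ + _)%:E.
  by rewrite wnorm2DW wnorm2ZW wnorm2_scalar mul1r.
rewrite -EFinM -EFinD lee_fin -mulrDl WE ler_pdivrMr; last exact: mulr_gt0.
rewrite mulrCA divfK; last by rewrite gt_eqF.
have -> : Zbar = K + (\sum_(k < t.+1) alpha k ^+ 2 / 2) * sigma ^+ 2 + S * D'.
  by rewrite /Zbar /D /D' mulr_suml; congr (_ + _ + _); ring.
have h1 := ler_wpM2r (sqr_ge0 sigma) hV.
have h2 : 0 <= V * sigma ^+ 2.
  apply: le_trans h1; rewrite mulr_ge0 ?sqr_ge0//; apply: sumr_ge0 => k _.
  by rewrite divr_ge0 ?sqr_ge0.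
have h3 := ler_peMl K_ge0 S1; have h4 := ler_peMl h2 S1.
lra.
Qed.

End Averages.

End Algorithm.

(** * The harmonic sum and the two step-size rules *)

Section StepSizes.
Context {R : realType}.

(** The inequality ln (1 + s) <= s at s = - 1 / (k + 1) bounds 1 / (k + 1) by ln (k + 1) - ln k. *)
Lemma harmonic_le_ln t : (0 < t)%N ->
  \sum_(1 <= k < t.+1) k%:R^-1 <= 1 + ln t%:R :> R.
Proof.
elim: t => [//|[|t] IH] _; first by rewrite big_nat1 ln1 invr1 addr0.
rewrite big_nat_recr//=; have {}IH := IH isT.
have p1 : 0 < t.+1%:R :> R by rewrite ltr0n.
have p2 : 0 < t.+2%:R :> R by rewrite ltr0n.
have E : t.+2%:R = t.+1%:R + 1 :> R by rewrite natr1.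
have q : 1 + - t.+2%:R^-1 = t.+1%:R / t.+2%:R :> R.
  have -> : t.+1%:R = t.+2%:R - 1 :> R by rewrite E addrK.
  by rewrite mulrBl mul1r divff// gt_eqF.
have h : -1 < - t.+2%:R^-1 :> R by rewrite ltrN2 invf_lt1// E ltrDr.
have := le_ln1Dx h; rewrite q ln_div ?posrE// lerNr opprB => hh.
apply: (le_trans (lerD IH hh)).
by rewrite -addrA [ln t.+1%:R + _]addrC subrK.
Qed.

End StepSizes.

Theorem proposition4p3 (R : realType) (dsp : measure_display)
    (T : measurableType dsp) (P : probability T R)
    (N : nat) (d : 'I_N -> nat) (m q n : nat)
    (A : 'M[R]_(m, \sum_i d i)) (b : 'cV[R]_m)
    (X : forall i : 'I_N, set 'cV[R]_(d i))
    (u : forall i : 'I_N, 'cV[R]_(d i) -> \bar R)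
    (xi : T -> 'cV[R]_q) (fxi : 'cV[R]_q -> bvec R d -> R)
    (f : bvec R d -> R) (Lf sigma rho : R) (alpha : nat -> R)
    (Phat : 'M[R]_(\sum_i d i)) (x0 : bvec R d)
    (I : nat -> T -> {set 'I_N}) (G x : nat -> T -> bvec R d)
    (r lam : nat -> T -> 'cV[R]_m)
    (xs : bvec R d) (ls : 'cV[R]_m)
    (F := objective f u) (theta := n%:R / N%:R : R)
    (C := C0 A F rho theta (alpha 0%N) Phat x0 xs ls)
    (Hf : expectation_function P xi fxi f)
    (H1 : convex_composite X f u)
    (H2 : primal_dual_solution A b X F xs ls)
    (H3 : block_lipschitz_grad n f Lf)
    (H4 : unbiased_bounded_variance P f x G sigma)
    (Hn : (1 <= n <= N)%N)
    (Hrho : 0 < rho)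
    (Halpha : forall k, 0 < alpha k)
    (HPhat : psd Phat /\ block_diagonal Phat)
    (Hx0 : prodset X x0 /\ (F x0 < +oo)%E)
    (Halg : rpdbus P n A b X u rho alpha Phat x0 0 I G x r lam)
    (HPhat_ge : loewner_ge Phat (Lf%:M + rho *: (A^T *m A)))
    (Hfeas0 : A *m x0 = b) :
  ((forall k, (1 <= k)%N -> alpha k = alpha 0%N / Num.sqrt k%:R) ->
   forall t, (2 <= t)%N ->
     (max_error P A b F xs (xhat theta alpha x t)
      <= C * ((theta * alpha 0%N * Num.sqrt t%:R)^-1)%R%:E
         + (alpha 0%N * (ln t%:R + 2) * sigma ^+ 2
            / (2 * theta * Num.sqrt t%:R))%R%:E)%E)
  /\
  (forall t, (1 <= t)%N ->
   (forall k, (1 <= k)%N -> alpha k = alpha 0%N / Num.sqrt t%:R) ->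
     (max_error P A b F xs (xhat theta alpha x t)
      <= C * ((theta * alpha 0%N * Num.sqrt t%:R)^-1)%R%:E
         + (alpha 0%N * sigma ^+ 2 / (theta * Num.sqrt t%:R))%R%:E)%E).
Proof.
have th01 : 0 < theta <= 1 := theta01 Hn.
have a0 : 0 < alpha 0%N by exact: Halpha.
have rate t S dec adm V := @expected_rate _ _ _ P N d m n A b X u f Lf sigma rho alpha
  Phat x0 I G x r lam xs ls H1 H2 H3 H4 Hn Hrho Halpha HPhat Hx0 Halg HPhat_ge
  Hfeas0 t S dec adm V.
(* Normalised steps with a 0 = 1, as the admissibility lemmas require; the ratio S is unchanged by
   the scaling. *)
pose a k := alpha k / alpha 0%N.
have aE : alpha = fun k => alpha 0%N * a k.
  by apply/funext => k; rewrite /a mulrCA divff ?mulr1 ?gt_eqF.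
have a0E : a 0%N = 1 by rewrite /a divff ?gt_eqF.
have SE t : totalweight theta a t / (theta * Num.sqrt t%:R)
    = totalweight theta alpha t / (theta * alpha 0%N * Num.sqrt t%:R).
  have -> : totalweight theta alpha t = alpha 0%N * totalweight theta a t.
    rewrite {1}aE /totalweight mulrDr; congr (_ + _).
    by rewrite mulrCA; congr (_ * _); rewrite mulr_sumr.
  rewrite [theta * alpha 0%N]mulrC -(mulrA (alpha 0%N) theta) -mulf_div divff ?mul1r//.
  by rewrite gt_eqF.
split=> [Hal t t2|t t1 Hal].
- have t0 : (0 < t)%N by exact: leq_trans t2.
  have ak k : (1 <= k)%N -> a k = (Num.sqrt k%:R)^-1.
    by move=> k1; rewrite /a (Hal k)// mulrAC divff ?mul1r// gt_eqF.
  have adm : admissible theta alpha t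
      (totalweight theta a t / (theta * Num.sqrt t%:R)).
    by rewrite {1}aE; apply: admissible_scale => //; exact: admissible_sqrt.
  have dec k : alpha k.+1 <= alpha k.
    case: k => [|k]; first by rewrite (Hal 1%N)// sqrtr1 divr1.
    rewrite (Hal k.+1)// (Hal k.+2)// ler_pM2l// lef_pV2 ?posrE ?sqrt_nat_gt0//.
    exact: sqrt_nat_le.
  have st0 := @sqrt_nat_gt0 R t t0; have /andP[th0 _] := th01.
  have -> : alpha 0%N * (ln t%:R + 2) * sigma ^+ 2 / (2 * theta * Num.sqrt t%:R)
    = (alpha 0%N ^+ 2 / 2 * (ln t%:R + 2)) * sigma ^+ 2
      / (theta * alpha 0%N * Num.sqrt t%:R).
    by field; rewrite !gt_eqF.
  apply: (rate t _ dec adm _ t0 (SE t)).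
  (* The sum starts at index 0, whose step is alpha_0 itself. This adds 1 to the harmonic sum and
     gives ln t + 2. *)
  have -> : \sum_(k < t.+1) alpha k ^+ 2 / 2
     = alpha 0%N ^+ 2 / 2 * (1 + \sum_(1 <= k < t.+1) k%:R^-1).
    rewrite mulrDr mulr1 big_ord_recl/=; congr (_ + _).
    rewrite mulr_sumr big_add1/= big_mkord; apply: eq_bigr => k _.
    by rewrite (Hal k.+1)// exprMn exprVn sqrt_nat_sqr mulrAC.
  apply: ler_wpM2l; first by rewrite divr_ge0 ?sqr_ge0.
  by have := @harmonic_le_ln R t t0; lra.
- have st0 := @sqrt_nat_gt0 R t t1; have /andP[th0 _] := th01.
  have ak k : (1 <= k)%N -> a k = (Num.sqrt t%:R)^-1.
    by move=> k1; rewrite /a (Hal k)// mulrAC divff ?mul1r// gt_eqF.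
  have adm : admissible theta alpha t
      (totalweight theta a t / (theta * Num.sqrt t%:R)).
    by rewrite {1}aE; apply: admissible_scale => //; exact: admissible_const.
  have dec k : alpha k.+1 <= alpha k.
    case: k => [|k]; last by rewrite (Hal k.+1)// (Hal k.+2).
    rewrite (Hal 1%N)// ler_piMr ?(ltW a0)// invf_le1//; exact: sqrt_nat_ge1.
  have -> : alpha 0%N * sigma ^+ 2 / (theta * Num.sqrt t%:R)
    = alpha 0%N ^+ 2 * sigma ^+ 2 / (theta * alpha 0%N * Num.sqrt t%:R).
    by field; rewrite !gt_eqF.
  apply: (rate t _ dec adm _ t1 (SE t)).
  (* Index 0 contributes alpha_0^2 / 2 and the t equal later terms together contribute as much
     again. *)
  rewrite big_ord_recl/= (eq_bigr (fun=> alpha 0%N ^+ 2 / 2 / t%:R)); last first.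
    by move=> k _; rewrite (Hal k.+1)// exprMn exprVn sqrt_nat_sqr mulrAC.
  rewrite sumr_const card_ord -[_ *+ t]mulr_natr divfK; last by rewrite pnatr_eq0 -lt0n.
  lra.
Qed.
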